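(* Let $V\subseteq\mathbb{H}^n$ and $W\subseteq\Omega$ be measurable sets, and assume that $$W\subseteq\big\{(\lambda,(2k+n)|\lambda|):|\lambda|>M,\ k\in\mathbb{N}\cup\{0\}\big\}$$ for some $M>0$. Suppose further that both $V$ and $W$ have finite measure (with respect to Lebesgue measure on $\mathbb{H}^n$ and $\nu_2$ on $\Omega$, respectively). If $f\in L^2(\mathbb{H}^n)$ satisfies $\operatorname{supp}(f)\subseteq V$ and $\operatorname{supp}(\mathcal{F}(f))\subseteq W\times B$ for some measurable $B\subseteq\mathbb{C}^n$, then $f=0$.
   Context: Let $n\ge 1$. The Heisenberg group is $\mathbb{H}^n=\mathbb{C}^n\times\mathbb{R}$ with group law $(z,t)(w,s)=(z+w,\,t+s+\tfrac12\operatorname{Im}(z\overline{w}))$, where $z\overline{w}=\sum_j z_j\overline{w_j}$; its Haar measure is Lebesgue measure $dz\,dt$. For $\lambda\in\mathbb{R}^*=\mathbb{R}\setminus\{0\}$ and $k\in\mathbb{N}\cup\{0\}$ put $\varphi^{n-1}_{k,\lambda}(z)=L^{n-1}_k(\tfrac12|\lambda||z|^2)\,e^{-\frac14|\lambda||z|^2}$, where $L^{n-1}_k$ is the Laguerre polynomial of type $n-1$ and degree $k$, and $e^{n-1}_{k,\lambda}(z,t)=e^{i\lambda t}\varphi^{n-1}_{k,\lambda}(z)$. The Heisenberg fan $\Omega\subseteq\mathbb{R}^2$ is the union of the rays $R_k=\{(\lambda,(2k+n)|\lambda|):\lambda\in\mathbb{R}^*\}$, $k=0,1,2,\dots$, and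 $R_\infty=\{(0,\tau):\tau\ge0\}$. For $a=(\lambda,(2k+n)|\lambda|)\in R_k$ write $e_a=e^{n-1}_{k,\lambda}$. Let $c_{n,k}=\frac{k!(n-1)!}{(k+n-1)!}$. For $f\in (L^1\cap L^2)(\mathbb{H}^n)$ the normalized Strichartz Fourier transform is, for $a\in R_k$, $w\in\mathbb{C}^n$, $$\mathcal{F}(f)(a,w)=c_{n,k}\int_{\mathbb{H}^n}f(z,t)\,e_a\big((z,t)^{-1}(w,0)\big)\,dz\,dt .$$ The measure $\nu_2$ on $\Omega$ is $$\int_\Omega\phi\,d\nu_2=(2\pi)^{-2n-1}\int_{-\infty}^\infty\Big(\sum_{k=0}^\infty c_{n,k}^{-2}\,\phi(\lambda,(2k+n)|\lambda|)\Big)|\lambda|^{2n}\,d\lambda ,$$ so $R_\infty$ is $\nu_2$-null. By the Plancherel identity $\|f\|_{L^2(\mathbb{H}^n)}=\|\mathcal{F}(f)\|_{L^2(\Omega\times\mathbb{C}^n,\,d\nu_2\,dw)}$, $\mathcal{F}$ extends to an isometry of $L^2(\mathbb{H}^n)$ into $L^2(\Omega\times\mathbb{C}^n,d\nu_2\,dw)$. An inclusion $\operatorname{supp}(g)\subseteq S$ for a measurable set $S$ means that $g$ vanishes almost everywhere outside $S$. *)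

(* Defs.v *)
From HB Require Import structures.
From mathcomp Require Import all_boot all_order all_algebra.
From mathcomp Require Import complex.
From mathcomp Require Import all_classical all_reals all_analysis measurable_realfun.

Set Implicit Arguments.
Unset Strict Implicit.
Unset Printing Implicit Defensive.
Import Order.TTheory GRing.Theory Num.Theory.
Import numFieldNormedType.Exports.

Local Open Scope classical_set_scope.
Local Open Scope ring_scope.
Local Open Scope complex_scope.

Section pushforward_iso.
Context d1 d2 (T1 : measurableType d1) (T2 : measurableType d2) (R : realType).
Variable mu : {measure set T1 -> \bar R}.
Variables (f : T1 -> T2) (g : T2 -> T1).

Lemma pushforward_semi_sigma_additive : measurable_fun setT f ->
  semi_sigma_additive (pushforward mu f).
Proof.
move=> mf F mF tF mUF; rewrite /pushforward preimage_bigcup.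
apply: measure_semi_sigma_additive.
- by move=> n; rewrite -[X in measurable X]setTI; exact: mf.
- apply/trivIsetP => /= i j _ _ ij; rewrite -preimage_setI.
  by move/trivIsetP : tF => /(_ _ _ _ _ ij) ->//; rewrite preimage_set0.
- by rewrite -preimage_bigcup -[X in measurable X]setTI; exact: mf.
Qed.

Lemma pushforward_sigma_finite : sigma_finite setT mu ->
  measurable_fun setT g -> cancel f g ->
  sigma_finite setT (pushforward mu f).
Proof.
move=> [F TF Foo] mg fK.
exists (fun i => g @^-1` F i).
  by rewrite -preimage_bigcup -TF preimage_setT.
move=> i; have [mF Fi] := Foo i; split.
  by rewrite -[X in measurable X]setTI; exact: mg.
rewrite /pushforward (_ : _ @^-1` _ = F i)//.
by apply/seteqP; split=> x /=; rewrite fK.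
Qed.

End pushforward_iso.
Arguments pushforward_semi_sigma_additive {d1 d2 T1 T2 R} mu {f}.
Arguments pushforward_sigma_finite {d1 d2 T1 T2 R} mu {f g}.

(* The canonical sigma-finite instance on \x is shadowed in the library by the
   one for subprobabilities. *)
Lemma product_sigma_finite d1 d2 (T1 : measurableType d1)
    (T2 : measurableType d2) (R : realType)
    (m1 : {sigma_finite_measure set T1 -> \bar R})
    (m2 : {sigma_finite_measure set T2 -> \bar R}) :
  sigma_finite setT (m1 \x m2)%E.
Proof.
have /sigma_finiteP[F [TF ndF Foo]] := sigma_finiteT m1.
have /sigma_finiteP[G [TG ndG Goo]] := sigma_finiteT m2.
exists (fun n => F n `*` G n).
  rewrite -setXTT TF TG predeqE => -[x y]; split.
    move=> [/= [i _ Fx] [j _ Gy]]; exists (maxn i j) => //; split.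
    - by move: x Fx; exact/subsetPset/ndF/leq_maxl.
    - by move: y Gy; exact/subsetPset/ndG/leq_maxr.
  by move=> [i _ []/= ? ?]; split; exists i.
move=> k; have [? ?] := Foo k; have [? ?] := Goo k.
split; first exact: measurableX.
by rewrite product_measure1E// lte_mul_pinfty// ge0_fin_numE.
Qed.

Section tuple_measure.
Context d (T : measurableType d) (R : realType).
Variable mu : {sigma_finite_measure set T -> \bar R}.

Definition tuple_cons n (p : T * n.-tuple T) : n.+1.-tuple T :=
  [tuple of p.1 :: p.2].

Definition tuple_uncons n (s : n.+1.-tuple T) : T * n.-tuple T :=
  (thead s, [tuple of behead s]).

Lemma tuple_consK n : cancel (@tuple_cons n) (@tuple_uncons n).
Proof.
by move=> [x s]; congr pair => //; exact/val_inj.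
Qed.

Lemma measurable_tuple_cons n : measurable_fun setT (@tuple_cons n).
Proof. exact: measurable_cons. Qed.

Lemma measurable_tuple_uncons n : measurable_fun setT (@tuple_uncons n).
Proof.
apply/measurable_fun_pairP; split; first exact: measurable_tnth.
exact: measurable_behead.
Qed.

Definition cons_measure n (nu : {sigma_finite_measure set (n.-tuple T) -> \bar R})
  : set (n.+1.-tuple T) -> \bar R :=
  pushforward (mu \x nu)%E (@tuple_cons n).

Section cons_measure_instances.
Variables (n : nat) (nu : {sigma_finite_measure set (n.-tuple T) -> \bar R}).

Let cons_measure0 : cons_measure nu set0 = 0%E.
Proof. by rewrite /cons_measure /pushforward preimage_set0 measure0. Qed.

Let cons_measure_ge0 A : (0 <= cons_measure nu A)%E.
Proof. exact: (measure_ge0 (mu \x nu)%E). Qed.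

Let cons_measure_semi_sigma_additive : semi_sigma_additive (cons_measure nu).
Proof.
exact: (pushforward_semi_sigma_additive (mu \x nu)%E (@measurable_tuple_cons n)).
Qed.

HB.instance Definition _ := isMeasure.Build _ _ _ (cons_measure nu)
  cons_measure0 cons_measure_ge0 cons_measure_semi_sigma_additive.

Let cons_measure_sigma_finite : sigma_finite setT (cons_measure nu).
Proof.
exact: (pushforward_sigma_finite (mu \x nu)%E (product_sigma_finite mu nu)
  (@measurable_tuple_uncons n) (@tuple_consK n)).
Qed.

HB.instance Definition _ := Measure_isSigmaFinite.Build _ _ _ (cons_measure nu)
  cons_measure_sigma_finite.

End cons_measure_instances.

Fixpoint tuple_measure (n : nat) :
    {sigma_finite_measure set (n.-tuple T) -> \bar R} :=
  if n is m.+1 then cons_measure (tuple_measure m) else \d_([tuple]).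

End tuple_measure.


HB.instance Definition _ (R : realType) := isPointed.Build R[i] 0.

Definition complex_parts (R : realType) (z : R[i]) : measurableTypeR R * measurableTypeR R :=
  (complex.Re z, complex.Im z).

Definition complex_of_parts (R : realType) (p : measurableTypeR R * measurableTypeR R) : R[i] := p.1 +i* p.2.

(* The Borel sets of C, i.e. those of R^2. *)
HB.instance Definition _ (R : realType) := Measurable.copy R[i]
  (g_sigma_algebra_preimageType (@complex_parts R)).

Section complex_measure.
Context (R : realType).

Lemma measurable_complex_parts : measurable_fun setT (@complex_parts R).
Proof. by move=> _ A mA; exists A. Qed.

Lemma measurable_complex_of_parts : measurable_fun setT (@complex_of_parts R).
Proof.
move=> _ A [B mB <-]; rewrite !setTI -comp_preimage (_ : _ \o _ = id)//.
by apply/funext => -[].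
Qed.

Let complex_of_partsK : cancel (@complex_of_parts R) (@complex_parts R).
Proof. by case. Qed.

Definition lebesgue_C : set R[i] -> \bar R :=
  pushforward (@lebesgue_measure R \x @lebesgue_measure R)%E
    (@complex_of_parts R).

Let lebesgue_C0 : lebesgue_C set0 = 0%E.
Proof. by rewrite /lebesgue_C /pushforward preimage_set0 measure0. Qed.

Let lebesgue_C_ge0 A : (0 <= lebesgue_C A)%E.
Proof. exact: (measure_ge0 (@lebesgue_measure R \x @lebesgue_measure R)%E). Qed.

Let lebesgue_C_semi_sigma_additive : semi_sigma_additive lebesgue_C.
Proof.
exact: (pushforward_semi_sigma_additive
  (@lebesgue_measure R \x @lebesgue_measure R)%E measurable_complex_of_parts).
Qed.

HB.instance Definition _ := isMeasure.Build _ _ _ lebesgue_C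
  lebesgue_C0 lebesgue_C_ge0 lebesgue_C_semi_sigma_additive.

Let lebesgue_C_sigma_finite : sigma_finite setT lebesgue_C.
Proof.
exact: (pushforward_sigma_finite (@lebesgue_measure R \x @lebesgue_measure R)%E
  (product_sigma_finite _ _) measurable_complex_parts complex_of_partsK).
Qed.

HB.instance Definition _ := Measure_isSigmaFinite.Build _ _ _ lebesgue_C
  lebesgue_C_sigma_finite.

End complex_measure.

Section complex_functions.
Context d (T : measurableType d) (R : realType) (mu : {measure set T -> \bar R}).

Definition cintegral (f : T -> R[i]) : R[i] :=
  (\int[mu]_x complex.Re (f x)) +i* (\int[mu]_x complex.Im (f x)).

Definition cLnorm (p : R) (f : T -> R[i]) : \bar R :=
  Lnorm mu p%:E (fun x => (Normc.normc (f x))%:E).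

Definition in_Lp (p : R) (f : T -> R[i]) : Prop :=
  measurable_fun setT f /\ (cLnorm p f < +oo)%E.

(* For sigma-finite mu the Caratheodory-measurable sets of mu^* are those of
   the completion of mu (for Lebesgue measure: the Lebesgue-measurable sets),
   and mu^* restricted to them is the completed measure. *)
Definition completion_measurable (A : set T) : Prop :=
  (mu^*)%mu.-caratheodory A.

Definition completion_finite_measure (A : set T) : Prop :=
  completion_measurable A /\ ((mu^*)%mu A < +oo)%E.

Definition vanishes_ae_outside (f : T -> R[i]) (S : set T) : Prop :=
  {ae mu, forall x, ~ S x -> f x = 0}.

End complex_functions.

(* lebesgue_measure lives on measurableTypeR R, i.e. on R with its Borel sets. *)
Notation Cn R n := (n.-tuple R[i])%type.
Notation Heis R n := (Cn R n * measurableTypeR R)%type.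
Notation plane R := (measurableTypeR R * measurableTypeR R)%type.

Section heisenberg.
Context (R : realType) (n : nat).

Definition lebesgue_Cn : {sigma_finite_measure set (Cn R n) -> \bar R} :=
  tuple_measure (@lebesgue_C R) n.

Definition haar : set (Heis R n) -> \bar R :=
  (lebesgue_Cn \x @lebesgue_measure R)%E.
HB.instance Definition _ := Measure.on haar.
HB.instance Definition _ := Measure_isSigmaFinite.Build _ _ _ haar
  (product_sigma_finite lebesgue_Cn (@lebesgue_measure R)).


Definition hermitian (z w : Cn R n) : R[i] :=
  \sum_(j < n) tnth z j * conjc (tnth w j).

Definition sqnorm (z : Cn R n) : R := \sum_(j < n) Normc.normc (tnth z j) ^+ 2.

Definition hmul (p q : Heis R n) : Heis R n :=
  ([tuple tnth p.1 j + tnth q.1 j | j < n],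
   (p.2 : R) + (q.2 : R) + 2^-1 * complex.Im (hermitian p.1 q.1)).

Definition hinv (p : Heis R n) : Heis R n :=
  ([tuple - tnth p.1 j | j < n], - (p.2 : R)).

End heisenberg.

Arguments lebesgue_Cn {R n}.
Arguments haar {R n}.

Section strichartz.
Context (R : realType) (n : nat).

Definition laguerre (a k : nat) : {poly R} :=
  \poly_(i < k.+1) ((-1) ^+ i * 'C(k + a, k - i)%:R / i`!%:R).

Definition cis (x : R) : R[i] := cos x +i* sin x.

Definition phi (k : nat) (l : R) (z : Cn R n) : R :=
  (laguerre (n - 1) k).[2^-1 * `|l| * sqnorm z] *
  expR (- (4^-1 * `|l| * sqnorm z)).

Definition e_kl (k : nat) (l : R) (p : Heis R n) : R[i] :=
  cis (l * (p.2 : R)) * (phi k l p.1)%:C.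

Definition c_nk (k : nat) : R := (k`! * (n - 1)`!)%:R / ((k + n - 1)`!)%:R.

Definition ray_point (k : nat) (l : R) : plane R := (l, (2 * k + n)%:R * `|l|).

Definition ray (k : nat) : set (plane R) := [set ray_point k l | l in [set l | l != 0]].

Definition ray_infty : set (plane R) := [set a | a.1 = 0 :> R /\ 0 <= (a.2 : R)].

Definition fan : set (plane R) := (\bigcup_k ray k) `|` ray_infty.

(* For n > 0 the rays are pairwise disjoint, so this is the only k with
   a \in ray k, for a on a ray; the value elsewhere is immaterial since the
   complement of the rays is nu2-null. *)
Definition ray_index (a : plane R) : nat := xget 0%N [set k | ray k a].

Definition e_fan (a : plane R) : Heis R n -> R[i] := e_kl (ray_index a) a.1.

(* Only meaningful for f in L^1. *)
Definition strichartz (f : Heis R n -> R[i]) (x : plane R * Cn R n) : R[i] :=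
  (c_nk (ray_index x.1))%:C *
  cintegral haar (fun p => f p * e_fan x.1 (hmul (hinv p) (x.2, 0 : R))).

Definition nu2_density (A : set (plane R)) (l : R) : \bar R :=
  ((\sum_(0 <= k <oo) ((c_nk k) ^- 2)%:E * (\1_A (ray_point k l))%:E) *
   (`|l| ^+ (2 * n))%:E)%E.

Definition nu2 (A : set (plane R)) : \bar R :=
  (((2 * pi) ^- (2 * n + 1))%:E *
   \int[@lebesgue_measure R]_l nu2_density A l)%E.

Let c_nk2_ge0 k : (0 <= ((c_nk k) ^- 2)%:E)%E.
Proof. by rewrite lee_fin invr_ge0 sqr_ge0. Qed.

Let nu2_density_ge0 A l : (0 <= nu2_density A l)%E.
Proof.
apply: mule_ge0; last by rewrite lee_fin exprn_ge0.
by apply: nneseries_ge0 => k _ _; apply: mule_ge0 => //; rewrite lee_fin.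
Qed.

Let nu2_const_ge0 : (0 <= ((2 * pi : R) ^- (2 * n + 1))%:E)%E.
Proof. by rewrite lee_fin invr_ge0 exprn_ge0// mulr_ge0// pi_ge0. Qed.

Let nu2_0 : nu2 set0 = 0%E.
Proof.
rewrite /nu2 integral0_eq ?mule0// => l _; rewrite /nu2_density eseries0 ?mul0e//.
by move=> k _ _; rewrite indic0 mule0.
Qed.

Let nu2_ge0 A : (0 <= nu2 A)%E.
Proof. by apply: mule_ge0 => //; apply: integral_ge0. Qed.

Let measurable_ray_point k : measurable_fun setT (ray_point k).
Proof.
apply/measurable_fun_pairP; split; first exact: measurable_id.
by apply: (@measurable_funM _ (measurableTypeR R)) => //; exact: normr_measurable.
Qed.

Let measurable_nu2_density A : measurable A ->
  measurable_fun setT (nu2_density A : measurableTypeR R -> \bar R).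
Proof.
move=> mA; apply: emeasurable_funM; last first.
  by apply/measurable_EFinP/measurable_funX; exact: normr_measurable.
apply: ge0_emeasurable_sum => [k l _ _|k _].
  by apply: mule_ge0 => //; rewrite lee_fin.
apply: measurable_funeM; apply/measurable_EFinP.
apply: measurableT_comp; last exact: measurable_ray_point.
exact: measurable_indic.
Qed.

Let nu2_density_bigcup (F : (set (plane R))^nat) l :
  (forall i, measurable (F i)) -> trivIset setT F ->
  measurable (\bigcup_i F i) ->
  nu2_density (\bigcup_i F i) l = (\sum_(0 <= i <oo) nu2_density (F i) l)%E.
Proof.
move=> mF tF mUF; rewrite /nu2_density.
under [in RHS]eq_eseriesr do rewrite muleC.
rewrite nneseriesZl; last first.
  move=> i _; apply: nneseries_ge0 => k _ _.
  by apply: mule_ge0 => //; rewrite lee_fin.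
rewrite muleC; congr (_ * _)%E.
rewrite nneseries_interchange; last first.
  by move=> i k; apply: mule_ge0 => //; rewrite lee_fin.
apply: eq_eseriesr => k _.
rewrite nneseriesZl; last by move=> i _; rewrite lee_fin.
congr (_ * _)%E.
apply/esym/cvg_lim => //.
exact: (@measure_semi_sigma_additive _ _ R (dirac (ray_point k l)) F mF tF mUF).
Qed.

Let nu2_sigma_additive : semi_sigma_additive nu2.
Proof.
move=> F mF tF mUF.
rewrite [X in _ --> X](_ : _ = \sum_(0 <= i <oo) nu2 (F i))%E.
  by apply/cvg_closeP; split; [exact: is_cvg_nneseries|rewrite closeE].
rewrite /nu2 nneseriesZl; last by move=> i _; exact: integral_ge0.
congr (_ * _)%E; rewrite -integral_nneseries//; last first.
  by move=> i; exact: measurable_nu2_density.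
by apply: eq_integral => l _; rewrite nu2_density_bigcup.
Qed.

HB.instance Definition _ := isMeasure.Build _ _ _ nu2
  nu2_0 nu2_ge0 nu2_sigma_additive.

Definition fan_measure : set (plane R * Cn R n) -> \bar R :=
  (nu2 \x @lebesgue_Cn R n)%E.
HB.instance Definition _ := Measure.on fan_measure.

(* g represents F(f), for f in L^2: F is extended from the intersection of L^1
   and L^2 to L^2 by density, the limit being taken in L^2(fan x C^n). By
   Plancherel such a g exists, and is unique up to null sets. *)
Definition is_strichartz_transform (f : Heis R n -> R[i])
    (g : plane R * Cn R n -> R[i]) : Prop :=
  in_Lp fan_measure 2 g /\
  exists u : nat -> Heis R n -> R[i],
    [/\ forall m, in_Lp haar 1 (u m) /\ in_Lp haar 2 (u m),
        cLnorm haar 2 (fun p => u m p - f p) @[m --> \oo] --> 0%E &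
        cLnorm fan_measure 2 (fun x => strichartz (u m) x - g x)
          @[m --> \oo] --> 0%E].

End strichartz.

(* Main.v *)
(* Write [f^l] for the Fourier transform of [f] in the central variable. Being
   in L^2 and supported in a set of finite measure, [f] is integrable, and its
   transform on the ray [R_k] at [l] is, up to [c_nk], the twisted convolution of
   [f^l] with the [k]-th Laguerre function. The density of [nu2] on each ray
   is at least [M ^ 2n] over [|l| > M], so the [l] at which some ray meets [W] form
   a set of finite Lebesgue measure; for almost all other [l] with [|l| > M] all
   these twisted convolutions vanish. This forces [f^l = 0]: Laguerre functions
   span the polynomials times a Gaussian, exponential series then give narrower
   and narrower Gaussians, and twisted Gaussians are an approximate identity.
   So for almost every [z] the function [f (z, .)] is supported in a set of finite
   measure and its Fourier transform vanishes outside a set of finite measure;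
   it is zero by Benedicks' theorem, proved by periodizing it at almost every
   frequency into a trigonometric polynomial with a zero set of positive measure.

   The transform of [f] being defined as an L^2 limit, it must also be seen to
   be given by the integral formula along the rays: if integrable functions tend
   to zero in L^2, then a Plancherel inequality in the central variable, on bounded
   frequencies, shows that their transforms along a ray tend to zero locally in
   L^1. *)
Require Import Defs.
From HB Require Import structures.
From mathcomp Require Import all_boot all_order all_algebra.
From mathcomp Require Import complex.
From mathcomp Require Import all_classical all_reals all_analysis measurable_realfun.
From mathcomp Require Import ring lra zify.

Set Implicit Arguments.
Unset Strict Implicit.
Unset Printing Implicit Defensive.
Import Order.TTheory GRing.Theory Num.Theory.
Import numFieldNormedType.Exports.

Local Open Scope classical_set_scope.
Local Open Scope ring_scope.

(** * Complex-valued integrals *)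

(** Estimates along the rays degenerate at [l = 0], where the density of [nu2] and the Gaussian
    decay of the Laguerre functions are both lost. The bounded strip [|l| <= M] is therefore put
    into the exceptional set [L], of which Benedicks' theorem only asks that its measure be finite.

    Uniqueness always comes from moments: an integrable [Phi] orthogonal to all powers of a bounded
    [Y] is orthogonal to the indicators of all sets defined by [Y]. With sine and cosine for [Y]
    this gives periodic sets, so the periodization is never summed: it is known through its Fourier
    coefficients and its integrals over periodic sets. For Laguerre functions the variable is
    unbounded, and its exponential weight dominates the exponential series only up to a proportion
    of its own rate.

    Along a ray, [g] must be compared with [strichartz u], which is shown to be measurable along
    each ray, not on the whole fan. Integrals along a ray are therefore bounded by integrals over
    the fan for functions measurable along that ray; a free parameter [e] takes the place of the
    Cauchy-Schwarz inequality. *)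

Section ae_lemmas.
Context d (T : measurableType d) (R : realType) (mu : {measure set T -> \bar R}).
Implicit Types P Q S U : T -> Prop.

Lemma ae_S P Q : (forall x, P x -> Q x) ->
  {ae mu, forall x, P x} -> {ae mu, forall x, Q x}.
Proof. by move=> PQ; apply: filterS. Qed.

Lemma ae_S2 P Q S : (forall x, P x -> Q x -> S x) -> {ae mu, forall x, P x} ->
  {ae mu, forall x, Q x} -> {ae mu, forall x, S x}.
Proof. by move=> PQ; apply: filterS2. Qed.

Lemma ae_S3 P Q S U : (forall x, P x -> Q x -> S x -> U x) ->
  {ae mu, forall x, P x} -> {ae mu, forall x, Q x} ->
  {ae mu, forall x, S x} -> {ae mu, forall x, U x}.
Proof. by move=> PQ; apply: filterS3. Qed.

End ae_lemmas.

(** * Measurability of complex-valued functions *)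

Section complex_measurability.
Context (R : realType).

Lemma measurable_Re : measurable_fun setT (@complex.Re R : R[i] -> R).
Proof. exact: (measurableT_comp measurable_fst (@measurable_complex_parts R)). Qed.

Lemma measurable_Im : measurable_fun setT (@complex.Im R : R[i] -> R).
Proof. exact: (measurableT_comp measurable_snd (@measurable_complex_parts R)). Qed.

Context d (T : measurableType d).
Implicit Types f g : T -> R[i].

Lemma measurable_fun_complexP f : measurable_fun setT f <->
  measurable_fun setT (fun x => complex.Re (f x)) /\
  measurable_fun setT (fun x => complex.Im (f x)).
Proof.
split=> [mf|[mr mi]].
  split; [exact: (measurableT_comp measurable_Re)|].
  exact: (measurableT_comp measurable_Im).
have -> : f = (@complex_of_parts R) \o
    (fun x => (complex.Re (f x), complex.Im (f x))).
  by apply/funext => x /=; rewrite /complex_of_parts; case: (f x).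
apply: measurableT_comp; first exact: measurable_complex_of_parts.
exact/measurable_fun_pairP.
Qed.

Lemma measurable_fun_Re f : measurable_fun setT f ->
  measurable_fun setT (fun x => complex.Re (f x)).
Proof. by move/measurable_fun_complexP => []. Qed.

Lemma measurable_fun_Im f : measurable_fun setT f ->
  measurable_fun setT (fun x => complex.Im (f x)).
Proof. by move/measurable_fun_complexP => []. Qed.

Lemma ReD (a b : R[i]) : complex.Re (a + b) = complex.Re a + complex.Re b.
Proof. by case: a b => [? ?] [? ?]. Qed.

Lemma ImD (a b : R[i]) : complex.Im (a + b) = complex.Im a + complex.Im b.
Proof. by case: a b => [? ?] [? ?]. Qed.

Lemma ReN (a : R[i]) : complex.Re (- a) = - complex.Re a.
Proof. by case: a. Qed.

Lemma ImN (a : R[i]) : complex.Im (- a) = - complex.Im a.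
Proof. by case: a. Qed.

Lemma ReM (a b : R[i]) : complex.Re (a * b) =
  complex.Re a * complex.Re b - complex.Im a * complex.Im b.
Proof. by case: a b => [? ?] [? ?]. Qed.

Lemma ImM (a b : R[i]) : complex.Im (a * b) =
  complex.Re a * complex.Im b + complex.Im a * complex.Re b.
Proof. by case: a b => [? ?] [? ?]. Qed.

Lemma complex_eqP (a b : R[i]) :
  complex.Re a = complex.Re b -> complex.Im a = complex.Im b -> a = b.
Proof. by case: a b => [? ?] [? ?] /= -> ->. Qed.

Lemma normc_sqr (a : R[i]) :
  Normc.normc a ^+ 2 = complex.Re a ^+ 2 + complex.Im a ^+ 2.
Proof. by case: a => x y /=; rewrite sqr_sqrtr// addr_ge0// sqr_ge0. Qed.

Lemma normc_ge0 (a : R[i]) : 0 <= Normc.normc a.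
Proof. by case: a => x y /=; rewrite sqrtr_ge0. Qed.

Lemma Re_le_normc (a : R[i]) : `|complex.Re a| <= Normc.normc a.
Proof.
by case: a => x y /=; rewrite -sqrtr_sqr ler_sqrt ?addr_ge0 ?sqr_ge0// lerDl sqr_ge0.
Qed.

Lemma Im_le_normc (a : R[i]) : `|complex.Im a| <= Normc.normc a.
Proof.
by case: a => x y /=; rewrite -sqrtr_sqr ler_sqrt ?addr_ge0 ?sqr_ge0// lerDr sqr_ge0.
Qed.

Lemma normc_le (a : R[i]) : Normc.normc a <= `|complex.Re a| + `|complex.Im a|.
Proof.
rewrite -(ler_pXn2r (n := 2))// ?nnegrE ?normc_ge0 ?addr_ge0//.
rewrite normc_sqr sqrrD !real_normK ?num_real//.
have : 0 <= `|complex.Re a| * `|complex.Im a| by rewrite mulr_ge0.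
lra.
Qed.

Lemma normcR (x : R) : Normc.normc (x%:C)%C = `|x|.
Proof. by rewrite /= expr0n/= addr0 sqrtr_sqr. Qed.

Lemma measurable_funC_M f g : measurable_fun setT f -> measurable_fun setT g ->
  measurable_fun setT (fun x => f x * g x).
Proof.
move=> /measurable_fun_complexP[fr fi] /measurable_fun_complexP[gr gi].
apply/measurable_fun_complexP; split.
  under eq_fun do rewrite ReM.
  by apply: measurable_funB; apply: measurable_funM.
under eq_fun do rewrite ImM.
by apply: measurable_funD; apply: measurable_funM.
Qed.

Lemma measurable_funC_D f g : measurable_fun setT f -> measurable_fun setT g ->
  measurable_fun setT (fun x => f x + g x).
Proof.
move=> /measurable_fun_complexP[fr fi] /measurable_fun_complexP[gr gi].
apply/measurable_fun_complexP; split.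
  under eq_fun do rewrite ReD.
  by apply: measurable_funD.
under eq_fun do rewrite ImD.
by apply: measurable_funD.
Qed.

Lemma measurable_funC_N f : measurable_fun setT f ->
  measurable_fun setT (fun x => - f x).
Proof.
move=> /measurable_fun_complexP[fr fi].
apply/measurable_fun_complexP; split.
  under eq_fun do rewrite ReN.
  exact: measurable_funN.
under eq_fun do rewrite ImN.
exact: measurable_funN.
Qed.

Lemma measurable_funC_B f g : measurable_fun setT f -> measurable_fun setT g ->
  measurable_fun setT (fun x => f x - g x).
Proof. by move=> mf mg; apply: measurable_funC_D => //; exact: measurable_funC_N. Qed.

Lemma measurable_funC_real (h : T -> R) : measurable_fun setT h ->
  measurable_fun setT (fun x => (h x)%:C%C).
Proof. by move=> mh; apply/measurable_fun_complexP; split. Qed.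

Lemma measurable_fun_cis (h : T -> R) : measurable_fun setT h ->
  measurable_fun setT (fun x => cis (h x)).
Proof.
move=> mh; apply/measurable_fun_complexP; split; rewrite /cis/=.
  apply: (measurableT_comp _ mh).
  by apply: continuous_measurable_fun; exact: continuous_cos.
apply: (measurableT_comp _ mh).
by apply: continuous_measurable_fun; exact: continuous_sin.
Qed.

Lemma measurable_fun_conjc f : measurable_fun setT f ->
  measurable_fun setT (fun x => conjc (f x)).
Proof.
move=> /measurable_fun_complexP[fr fi].
apply/measurable_fun_complexP; split.
  by rewrite (_ : (fun _ => _) = (fun x => complex.Re (f x)))//; apply/funext => x; case: (f x).
rewrite (_ : (fun _ => _) = (fun x => - complex.Im (f x))).
  exact: measurable_funN.
by apply/funext => x; case: (f x).
Qed.

Lemma measurable_fun_sqrt (h : T -> R) : measurable_fun setT h ->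
  measurable_fun setT (fun x => Num.sqrt (h x)).
Proof.
move=> mh; apply: (measurableT_comp _ mh).
by apply: continuous_measurable_fun; exact: sqrt_continuous.
Qed.

Lemma measurable_fun_normc f : measurable_fun setT f ->
  measurable_fun setT (fun x => Normc.normc (f x)).
Proof.
move=> /measurable_fun_complexP[fr fi].
rewrite (_ : (fun _ => _) = (fun x => Num.sqrt (complex.Re (f x) ^+ 2 + complex.Im (f x) ^+ 2))).
  apply: measurable_fun_sqrt; apply: measurable_funD; exact: measurable_funX.
by apply/funext => x; case: (f x).
Qed.

End complex_measurability.

Lemma normc_cis (R : realType) (x : R) : Normc.normc (cis x) = 1.
Proof. by rewrite /= cos2Dsin2 sqrtr1. Qed.

Lemma cisD (R : realType) (x y : R) : cis (x + y) = cis x * cis y.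
Proof. by apply: complex_eqP; rewrite /= ?sinD ?cosD// addrC mulrC [X in _ + X]mulrC addrC. Qed.

Lemma cis0 (R : realType) : cis (0 : R) = 1.
Proof. by rewrite /cis cos0 sin0. Qed.

Section complex_convergence.
Context (R : realType).
Implicit Types (u v : nat -> R[i]) (a b : R[i]).

(** Convergence in the plane stated on the two parts, the form in which dominated convergence of
    [cintegral] produces it. *)
Definition ccvg u a := complex.Re (u n) @[n --> \oo] --> complex.Re a /\
  complex.Im (u n) @[n --> \oo] --> complex.Im a.

Lemma ccvg_cst a : ccvg (fun=> a) a.
Proof. by split; exact: cvg_cst. Qed.

Lemma ccvgM u v a b : ccvg u a -> ccvg v b -> ccvg (fun n => u n * v n) (a * b).
Proof.
move=> [ur ui] [vr vi]; split.
  rewrite ReM; under eq_fun do rewrite ReM.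
  by apply: cvgB; exact: cvgM.
rewrite ImM; under eq_fun do rewrite ImM.
by apply: cvgD; exact: cvgM.
Qed.

Lemma ccvg_prod (I : Type) (r : seq I) (u : I -> nat -> R[i]) (a : I -> R[i]) :
  (forall i, ccvg (u i) (a i)) ->
  ccvg (fun n => \prod_(i <- r) u i n) (\prod_(i <- r) a i).
Proof.
move=> ua; elim: r => [|i r IHr].
  by rewrite big_nil; under eq_fun do rewrite big_nil; exact: ccvg_cst.
by rewrite big_cons; under eq_fun do rewrite big_cons; exact: ccvgM.
Qed.

Lemma ccvg_unique u a b : ccvg u a -> ccvg u b -> a = b.
Proof.
move=> [ur ui] [vr vi]; apply: complex_eqP.
  exact: (cvg_unique (@Rhausdorff R) ur vr).
exact: (cvg_unique (@Rhausdorff R) ui vi).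
Qed.

End complex_convergence.

(** * Linearity, modulus bound and dominated convergence *)

Section complex_integral.
Context d (T : measurableType d) (R : realType) (mu : {measure set T -> \bar R}).
Implicit Types (f g : T -> R[i]) (h k : T -> R).

Lemma integrable_bounded_mul h k (M : R) :
  mu.-integrable setT (EFin \o h) -> measurable_fun setT k ->
  (forall x, `|k x| <= M) ->
  mu.-integrable setT (EFin \o (fun x => h x * k x)).
Proof.
move=> ih mk kM.
have -> : EFin \o (fun x => h x * k x) = ((EFin \o h) \* (EFin \o k))%E by [].
apply: integrableMl => //.
exists M; split; first exact: num_real.
by move=> N MN x _; rewrite /= (le_trans (kM x))// ltW.
Qed.

Lemma integrable_dominated h k : measurable_fun setT h ->
  mu.-integrable setT (EFin \o k) -> (forall x, `|h x| <= k x) ->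
  mu.-integrable setT (EFin \o h).
Proof.
move=> mh ik hk; apply: (le_integrable _ _ _ ik) => //.
  exact/measurable_EFinP.
by move=> x _ /=; rewrite lee_fin (le_trans (hk x))// ler_norm.
Qed.

Lemma measurable_integrable h : mu.-integrable setT (EFin \o h) ->
  measurable_fun setT h.
Proof. by move/measurable_int/measurable_EFinP. Qed.

Lemma Rintegral_dominated (h_ : nat -> T -> R) h k :
  (forall n, measurable_fun setT (h_ n)) -> measurable_fun setT h ->
  mu.-integrable setT (EFin \o k) ->
  {ae mu, forall x, h_ n x @[n --> \oo] --> h x} ->
  (forall n x, `|h_ n x| <= k x) ->
  \int[mu]_x h_ n x @[n --> \oo] --> \int[mu]_x h x.
Proof.
move=> mh_ mh ik cv bd.
have [] := @dominated_convergence _ T R mu setT measurableT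
  (fun n => EFin \o h_ n) (EFin \o h) (EFin \o k).
- by move=> n; exact/measurable_EFinP.
- exact/measurable_EFinP.
- by apply: filterS cv => x cvx _; apply: cvg_EFin => //; exact: nearW.
- by [].
- by apply: aeW => x n _ /=; rewrite lee_fin.
move=> ih _ cvi; apply: fine_cvg.
by rewrite fineK//; exact: integrable_fin_num.
Qed.

(** The shape of most limit arguments below: [h] is a limit of functions whose integrals are already
    known to vanish. *)
Lemma Rintegral_dominated_eq0 (h_ : nat -> T -> R) h k :
  (forall n, measurable_fun setT (h_ n)) -> measurable_fun setT h ->
  mu.-integrable setT (EFin \o k) ->
  {ae mu, forall x, h_ n x @[n --> \oo] --> h x} ->
  (forall n x, `|h_ n x| <= k x) ->
  (forall n, \int[mu]_x h_ n x = 0) -> \int[mu]_x h x = 0.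
Proof.
move=> mh_ mh ik cv bd h0; have := Rintegral_dominated mh_ mh ik cv bd.
by under eq_fun do rewrite h0; move/(cvg_unique (@Rhausdorff R) (cvg_cst _)) => <-.
Qed.

Lemma integrable0_fun : mu.-integrable setT (EFin \o (fun=> 0 : R)).
Proof. exact: (@integrable0 _ T R mu setT). Qed.

Definition cintegrable f :=
  mu.-integrable setT (EFin \o (fun x => complex.Re (f x))) /\
  mu.-integrable setT (EFin \o (fun x => complex.Im (f x))).

Lemma cintegrable_measurable f : cintegrable f -> measurable_fun setT f.
Proof.
by move=> [fr fi]; apply/measurable_fun_complexP; split; exact: measurable_integrable.
Qed.

Lemma cintegrable_dominated f k : measurable_fun setT f ->
  mu.-integrable setT (EFin \o k) -> (forall x, Normc.normc (f x) <= k x) ->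
  cintegrable f.
Proof.
move=> /measurable_fun_complexP[mr mi] ik fk; split.
  by apply: (integrable_dominated _ ik) => // x; exact: le_trans (Re_le_normc _) (fk x).
by apply: (integrable_dominated _ ik) => // x; exact: le_trans (Im_le_normc _) (fk x).
Qed.

Lemma cintegrable_normc f : cintegrable f ->
  mu.-integrable setT (EFin \o (fun x => Normc.normc (f x))).
Proof.
move=> intf; have mf := cintegrable_measurable intf; case: intf => ir ii.
apply: (@integrable_dominated _ (fun x => `|complex.Re (f x)| + `|complex.Im (f x)|)).
- exact: measurable_fun_normc.
- have := integrableD measurableT (integrable_norm ir) (integrable_norm ii).
  by apply: eq_integrable.
- by move=> x; rewrite ger0_norm ?normc_ge0// normc_le.
Qed.

Lemma cintegrableP f : cintegrable f <-> measurable_fun setT f /\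
  mu.-integrable setT (EFin \o (fun x => Normc.normc (f x))).
Proof.
split=> [intf|[mf intf]].
  by split; [exact: cintegrable_measurable|exact: cintegrable_normc].
exact: (cintegrable_dominated mf intf).
Qed.

Lemma cintegrableMl f g (M : R) : cintegrable f -> measurable_fun setT g ->
  (forall x, Normc.normc (g x) <= M) -> cintegrable (fun x => f x * g x).
Proof.
move=> /cintegrableP[mf intf] mg gM.
apply: (@cintegrable_dominated _ (fun x => Normc.normc (f x) * M)).
- exact: measurable_funC_M.
- by apply: (@integrable_bounded_mul _ (cst M) `|M|).
- by move=> x; rewrite Normc.normcM ler_wpM2l// normc_ge0.
Qed.

Lemma cintegrableD f g : cintegrable f -> cintegrable g ->
  cintegrable (fun x => f x + g x).
Proof.
move=> [fr fi] [gr gi]; split.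
  apply: eq_integrable (integrableD measurableT fr gr) => // x _ /=.
  by rewrite ReD.
apply: eq_integrable (integrableD measurableT fi gi) => // x _ /=.
by rewrite ImD.
Qed.

Lemma cintegrableN f : cintegrable f -> cintegrable (fun x => - f x).
Proof.
move=> [fr fi]; split.
  apply: eq_integrable (integrableN fr) => // x _ /=.
  by rewrite ReN.
apply: eq_integrable (integrableN fi) => // x _ /=.
by rewrite ImN.
Qed.

Lemma cintegrableB f g : cintegrable f -> cintegrable g ->
  cintegrable (fun x => f x - g x).
Proof. by move=> fi gi; apply: cintegrableD => //; exact: cintegrableN. Qed.

Lemma cintegrable_real h : mu.-integrable setT (EFin \o h) ->
  cintegrable (fun x => (h x)%:C%C).
Proof. by move=> ih; split => //=; exact: integrable0_fun. Qed.

Lemma cintegrableZl (c : R[i]) f : cintegrable f -> cintegrable (fun x => c * f x).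
Proof.
move=> fi; under eq_fun do rewrite mulrC.
exact: (@cintegrableMl _ (cst c) (Normc.normc c)).
Qed.

Lemma cintegral_real h : cintegral mu (fun x => (h x)%:C%C) = (\int[mu]_x h x)%:C%C.
Proof. by apply: complex_eqP => //=; rewrite Rintegral_cst// mul0r. Qed.

Lemma cintegralD f g : cintegrable f -> cintegrable g ->
  cintegral mu (fun x => f x + g x) = cintegral mu f + cintegral mu g.
Proof.
move=> [fr fi] [gr gi]; apply: complex_eqP; rewrite /cintegral/=.
  rewrite -RintegralD//.
  by apply: eq_Rintegral => x _; rewrite ReD.
rewrite -RintegralD//.
by apply: eq_Rintegral => x _; rewrite ImD.
Qed.

Lemma cintegralZl (c : R[i]) f : cintegrable f ->
  cintegral mu (fun x => c * f x) = c * cintegral mu f.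
Proof.
move=> [fr fi].
have bM (r : R) h : mu.-integrable setT (EFin \o h) ->
    mu.-integrable setT (EFin \o (fun x => r * h x)).
  by move=> ih; apply: eq_integrable (integrableZl measurableT r ih).
apply: complex_eqP; rewrite /cintegral ?ReM ?ImM/=.
  rewrite -!RintegralZl// -RintegralB//; [|exact: bM..].
  by apply: eq_Rintegral => x _; rewrite ReM.
rewrite -!RintegralZl// -RintegralD//; [|exact: bM..].
by apply: eq_Rintegral => x _; rewrite ImM.
Qed.

Lemma cintegralZr (c : R[i]) f : cintegrable f ->
  cintegral mu (fun x => f x * c) = cintegral mu f * c.
Proof.
by move=> fi; rewrite mulrC -cintegralZl//; congr cintegral; apply/funext => x; rewrite mulrC.
Qed.

Lemma cintegralN f : cintegrable f ->
  cintegral mu (fun x => - f x) = - cintegral mu f.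
Proof.
move=> fi; rewrite -mulN1r -cintegralZl//.
by congr cintegral; apply/funext => x; rewrite mulN1r.
Qed.

Lemma cintegralB f g : cintegrable f -> cintegrable g ->
  cintegral mu (fun x => f x - g x) = cintegral mu f - cintegral mu g.
Proof. by move=> fi gi; rewrite cintegralD ?cintegralN//; exact: cintegrableN. Qed.

Lemma cintegral0 : cintegral mu (fun=> 0) = 0.
Proof. by apply: complex_eqP; rewrite /= Rintegral_cst// mul0r. Qed.

Lemma cintegrable0 : cintegrable (fun=> 0).
Proof. by split; exact: integrable0_fun. Qed.

Lemma cintegrable_sum (I : Type) (s : seq I) (F : I -> T -> R[i]) :
  (forall i, cintegrable (F i)) ->
  cintegrable (fun x => \sum_(i <- s) F i x).
Proof.
move=> iF; elim: s => [|i s IHs].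
  by under eq_fun do rewrite big_nil; exact: cintegrable0.
by under eq_fun do rewrite big_cons; exact: cintegrableD.
Qed.

Lemma cintegral_sum (I : Type) (s : seq I) (F : I -> T -> R[i]) :
  (forall i, cintegrable (F i)) ->
  cintegral mu (fun x => \sum_(i <- s) F i x) = \sum_(i <- s) cintegral mu (F i).
Proof.
move=> iF; elim: s => [|i s IHs].
  by under eq_fun do rewrite big_nil; rewrite big_nil cintegral0.
under eq_fun do rewrite big_cons.
by rewrite big_cons cintegralD ?IHs//; exact: cintegrable_sum.
Qed.

(** Rotating by the unit complex number [u] makes the integral real and nonnegative; its modulus is
    then the integral of a real part. *)
Lemma normc_cintegral f : cintegrable f ->
  Normc.normc (cintegral mu f) <= \int[mu]_x Normc.normc (f x).
Proof.
move=> fi; set I := cintegral mu f.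
have [I0|I0] := eqVneq (Normc.normc I) 0.
  by rewrite I0; apply: Rintegral_ge0 => x _; exact: normc_ge0.
have Igt0 : 0 < Normc.normc I by rewrite lt_neqAle eq_sym I0 normc_ge0.
pose u : R[i] := conjc I * ((Normc.normc I)^-1)%:C%C.
have nu : Normc.normc u = 1.
  rewrite Normc.normcM normcR gtr0_norm ?invr_gt0//.
  have -> : Normc.normc I^*%C = Normc.normc I by case: (I) => a b /=; rewrite sqrrN.
  by rewrite divff.
have -> : Normc.normc I = complex.Re (cintegral mu (fun x => u * f x)).
  rewrite cintegralZl// -/I /u mulrAC.
  have -> : I^*%C * I = (Normc.normc I ^+ 2)%:C%C.
    rewrite normc_sqr; case: (I) => a b; apply: complex_eqP; rewrite ?ReM ?ImM/=; ring.
  by rewrite -rmorphM/= expr2 mulfK.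
have [ur _] := cintegrableZl u fi.
apply: le_Rintegral => //; first exact: cintegrable_normc.
move=> x _; rewrite (le_trans (ler_norm _))// (le_trans (Re_le_normc _))//.
by rewrite Normc.normcM nu mul1r.
Qed.

Lemma eq_cintegral_ae f g : measurable_fun setT f -> measurable_fun setT g ->
  {ae mu, forall x, f x = g x} -> cintegral mu f = cintegral mu g.
Proof.
move=> /measurable_fun_complexP[fr fi] /measurable_fun_complexP[gr gi] fg.
apply: complex_eqP => /=; congr fine; apply: ae_eq_integral => //.
- exact/measurable_EFinP.
- exact/measurable_EFinP.
- by apply: filterS fg => x + _ => ->.
- exact/measurable_EFinP.
- exact/measurable_EFinP.
- by apply: filterS fg => x + _ => ->.
Qed.

Lemma cintegral_dominated (f_ : nat -> T -> R[i]) f k :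
  (forall n, measurable_fun setT (f_ n)) -> measurable_fun setT f ->
  mu.-integrable setT (EFin \o k) ->
  {ae mu, forall x, ccvg (f_ ^~ x) (f x)} ->
  (forall n x, Normc.normc (f_ n x) <= k x) ->
  ccvg (fun n => cintegral mu (f_ n)) (cintegral mu f).
Proof.
move=> mf_ mf ik cv bd; split => /=.
  apply: (@Rintegral_dominated (fun n x => complex.Re (f_ n x)) _ k) => //.
  - by move=> n; exact: measurable_fun_Re.
  - exact: measurable_fun_Re.
  - by apply: ae_S cv => x [].
  - by move=> n x; exact: le_trans (Re_le_normc _) (bd n x).
apply: (@Rintegral_dominated (fun n x => complex.Im (f_ n x)) _ k) => //.
- by move=> n; exact: measurable_fun_Im.
- exact: measurable_fun_Im.
- by apply: ae_S cv => x [].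
- by move=> n x; exact: le_trans (Im_le_normc _) (bd n x).
Qed.

End complex_integral.

(** * Fubini's theorem and almost everywhere statements on products *)

Section complex_fubini.
Context d1 d2 (T1 : measurableType d1) (T2 : measurableType d2) (R : realType).
Variables (m1 : {sigma_finite_measure set T1 -> \bar R})
          (m2 : {sigma_finite_measure set T2 -> \bar R}).
Local Notation m12 := (m1 \x m2)%E.

Section real.
Variable h : T1 * T2 -> R.
Hypothesis ih : m12.-integrable setT (EFin \o h).

Lemma ae_integrable_section1 :
  {ae m1, forall x, m2.-integrable setT (EFin \o (fun y => h (x, y)))}.
Proof. exact: ae_integrable1 ih. Qed.

Lemma ae_integrable_section2 :
  {ae m2, forall y, m1.-integrable setT (EFin \o (fun x => h (x, y)))}.
Proof. exact: ae_integrable2 ih. Qed.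

Let ae_fin1 : {ae m1, forall x, (fubini_F m2 (EFin \o h) x) = (\int[m2]_y h (x, y))%:E}.
Proof.
apply: filterS ae_integrable_section1 => x ihx.
by rewrite /fubini_F /Rintegral fineK//; exact: integrable_fin_num.
Qed.

Let ae_fin2 : {ae m2, forall y, (fubini_G m1 (EFin \o h) y) = (\int[m1]_x h (x, y))%:E}.
Proof.
apply: filterS ae_integrable_section2 => x ihx.
by rewrite /fubini_G /Rintegral fineK//; exact: integrable_fin_num.
Qed.

Lemma measurable_Rintegral1 : measurable_fun setT (fun x => \int[m2]_y h (x, y)).
Proof.
by have := measurableT_comp (@fine_measurable R setT measurableT) (measurable_fubini_F ih).
Qed.

Lemma measurable_Rintegral2 : measurable_fun setT (fun y => \int[m1]_x h (x, y)).
Proof.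
by have := measurableT_comp (@fine_measurable R setT measurableT) (measurable_fubini_G ih).
Qed.

(** The inner [Rintegral] is [fine] of the extended integral, so the two agree wherever the section
    is integrable, hence almost everywhere. *)
Lemma integrable_Rintegral1 :
  m1.-integrable setT (EFin \o (fun x => \int[m2]_y h (x, y))).
Proof.
apply/integrableP; split; first exact/measurable_EFinP/measurable_Rintegral1.
have /integrableP[mF] := integrable_fubini_F ih.
apply: le_lt_trans; rewrite le_eqVlt; apply/orP; left; apply/eqP.
apply: ge0_ae_eq_integral => //.
- by apply: measurableT_comp => //; exact/measurable_EFinP/measurable_Rintegral1.
- exact: measurableT_comp.
- by apply: filterS ae_fin1 => x -> _.
Qed.

Lemma Rintegral_fubini1 :
  \int[m12]_p h p = \int[m1]_x \int[m2]_y h (x, y).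
Proof.
rewrite /Rintegral -(integral12_prod_meas1 ih); congr fine.
apply: ae_eq_integral => //.
- by case/integrableP: (integrable_fubini_F ih).
- exact/measurable_EFinP/measurable_Rintegral1.
- by apply: filterS ae_fin1 => x -> _.
Qed.

Lemma Rintegral_fubini2 :
  \int[m12]_p h p = \int[m2]_y \int[m1]_x h (x, y).
Proof.
rewrite /Rintegral -(integral21_prod_meas1 ih); congr fine.
apply: ae_eq_integral => //.
- exact: (measurable_fubini_G ih).
- exact/measurable_EFinP/measurable_Rintegral2.
- by apply: filterS ae_fin2 => x -> _.
Qed.

Lemma integrable_Rintegral2 :
  m2.-integrable setT (EFin \o (fun y => \int[m1]_x h (x, y))).
Proof.
apply/integrableP; split; first exact/measurable_EFinP/measurable_Rintegral2.
have /integrable21ltyP : measurable_fun setT (EFin \o h) by exact: measurable_int ih.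
move=> /(_ m1 m2) [/(_ ih) h21 _]; apply: le_lt_trans h21.
apply: ae_ge0_le_integral => //.
- by apply: measurableT_comp => //; exact/measurable_EFinP/measurable_Rintegral2.
- by move=> y _; exact: integral_ge0.
- apply: (@measurable_fun_fubini_tonelli_G _ _ _ _ _ m1 (abse \o (EFin \o h))) => //.
    by apply: measurableT_comp => //; exact: measurable_int ih.
  by move=> x; exact: abse_ge0.
- apply: filterS ae_integrable_section2 => y ihy _ /=.
  rewrite EFin_normr_Rintegral//.
  by apply: le_abse_integral => //; exact: measurable_int ihy.
Qed.

End real.

Lemma ae_cintegrable1 f : cintegrable m12 f ->
  {ae m1, forall x, cintegrable m2 (fun y => f (x, y))}.
Proof.
move=> [/ae_integrable_section1 fr /ae_integrable_section1 fi].
by apply: filterS2 fr fi => x ? ?; split.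
Qed.

Lemma cintegrable_cintegral1 f : cintegrable m12 f ->
  cintegrable m1 (fun x => cintegral m2 (fun y => f (x, y))).
Proof. by move=> [/integrable_Rintegral1 fr /integrable_Rintegral1 fi]; split. Qed.

Lemma cintegrable_cintegral2 f : cintegrable m12 f ->
  cintegrable m2 (fun y => cintegral m1 (fun x => f (x, y))).
Proof. by move=> [/integrable_Rintegral2 fr /integrable_Rintegral2 fi]; split. Qed.

Lemma cintegral_fubini1 f : cintegrable m12 f ->
  cintegral m12 f = cintegral m1 (fun x => cintegral m2 (fun y => f (x, y))).
Proof.
move=> [fr fi]; apply: complex_eqP => /=.
  exact: (Rintegral_fubini1 fr).
exact: (Rintegral_fubini1 fi).
Qed.

Lemma cintegral_fubini2 f : cintegrable m12 f ->
  cintegral m12 f = cintegral m2 (fun y => cintegral m1 (fun x => f (x, y))).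
Proof.
move=> [fr fi]; apply: complex_eqP => /=.
  exact: (Rintegral_fubini2 fr).
exact: (Rintegral_fubini2 fi).
Qed.

Lemma integrable_prodM (h : T1 -> R) (k : T2 -> R) :
  m1.-integrable setT (EFin \o h) -> m2.-integrable setT (EFin \o k) ->
  m12.-integrable setT (EFin \o (fun p => h p.1 * k p.2)).
Proof.
move=> ih ik; have mh := measurable_integrable ih.
have mk := measurable_integrable ik.
have m : measurable_fun setT (EFin \o (fun p : T1 * T2 => h p.1 * k p.2)).
  by apply/measurable_EFinP; apply: measurable_funM; exact: measurableT_comp.
apply/(integrable12ltyP m1 m2 m) => /=.
have E x : (\int[m2]_y `|(h x * k y)%:E| = `|h x|%:E * \int[m2]_y `|(k y)%:E|)%E.
  under eq_integral do rewrite abse_EFin normrM EFinM.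
  by rewrite ge0_integralZl//; apply/measurable_EFinP; exact: measurableT_comp.
under eq_integral do rewrite E.
rewrite ge0_integralZr//.
- apply: lte_mul_pinfty.
  + exact: integral_ge0.
  + rewrite ge0_fin_numE; last exact: integral_ge0.
    by have /integrableP[] := ih.
  + by have /integrableP[] := ik.
- by apply/measurable_EFinP; exact: measurableT_comp.
- exact: integral_ge0.
Qed.

Lemma cintegrable_prodM f g : cintegrable m1 f -> cintegrable m2 g ->
  cintegrable m12 (fun p => f p.1 * g p.2).
Proof.
move=> fi gi; have mf := cintegrable_measurable fi.
have mg := cintegrable_measurable gi.
apply: (cintegrable_dominated _ (integrable_prodM (cintegrable_normc fi) (cintegrable_normc gi))).
  by apply: measurable_funC_M; exact: measurableT_comp.
by move=> p; rewrite Normc.normcM.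
Qed.

Lemma cintegral_prodM f g : cintegrable m1 f -> cintegrable m2 g ->
  cintegral m12 (fun p => f p.1 * g p.2) = cintegral m1 f * cintegral m2 g.
Proof.
move=> fi gi; rewrite cintegral_fubini1; last exact: cintegrable_prodM.
rewrite -cintegralZr//; congr cintegral; apply/funext => x /=.
by rewrite cintegralZl.
Qed.

End complex_fubini.

Section ae_prod.
Context d1 d2 (T1 : measurableType d1) (T2 : measurableType d2) (R : realType).
Variables (m1 : {measure set T1 -> \bar R})
          (m2 : {sigma_finite_measure set T2 -> \bar R}).
Local Notation m12 := (m1 \x m2)%E.

(** Tonelli for the exceptional set: its measure is the integral of the measures of its sections,
    hence zero exactly when almost all of these are. *)
Lemma ae_prod (P : T1 -> T2 -> Prop) : measurable [set p | P p.1 p.2] ->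
  {ae m12, forall p, P p.1 p.2} <-> {ae m1, forall x, {ae m2, forall y, P x y}}.
Proof.
move=> mP; have mC : measurable (~` [set p | P p.1 p.2]) by exact: measurableC.
have xE x : xsection (~` [set p | P p.1 p.2]) x = ~` [set y | P x y].
  by apply/seteqP; split => y /=; rewrite /xsection/= inE.
have m12E : m12 (~` [set p | P p.1 p.2]) = (\int[m1]_x m2 (~` [set y | P x y]))%E.
  by rewrite /product_measure1; apply: eq_integral => x _ /=; rewrite xE.
have mx x : measurable (~` [set y | P x y]) by rewrite -xE; exact: measurable_xsection.
have mF : measurable_fun setT (fun x => m2 (~` [set y | P x y])).
  by under eq_fun do rewrite -xE; exact: measurable_fun_xsection.
have aeE x : {ae m2, forall y, P x y} <-> m2 (~` [set y | P x y]) = 0%E.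
  by split; [move/negligibleP; apply|move=> ?; apply/negligibleP].
have F0 := ae_eq_integral_abs m1 measurableT mF.
split=> [/negligibleP-/(_ mC)|H].
  move=> H; have /F0 : (\int[m1]_x `|m2 (~` [set y | P x y])| = 0)%E.
    by rewrite -[RHS]H [RHS]m12E; apply: eq_integral => x _; rewrite gee0_abs.
  by apply: filterS => x /(_ I) /aeE.
apply/negligibleP => //; rewrite [LHS]m12E.
have : (\int[m1]_x `|m2 (~` [set y | P x y])| = 0)%E.
  by apply/F0; apply: filterS H => x /aeE + _.
by move=> <-; apply: eq_integral => x _; rewrite gee0_abs.
Qed.

End ae_prod.
(** * Vanishing moments *)

Lemma cvg_series_expR (R : realType) (x : R) :
  (\sum_(0 <= j < n) x ^+ j / j`!%:R) @[n --> \oo] --> expR x.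
Proof. exact: is_cvg_series_exp_coeff. Qed.

Lemma normr_series_exp_le (R : realType) (x : R) n :
  `|\sum_(0 <= j < n) x ^+ j / j`!%:R| <= expR `|x|.
Proof.
apply: (@le_trans _ _ (\sum_(0 <= j < n) `|x| ^+ j / j`!%:R)).
  apply: (le_trans (ler_norm_sum _ _ _)); apply: ler_sum => j _.
  by rewrite normrM normrX normfV normr_nat.
apply: (@nondecreasing_cvgn_le _ (fun n => \sum_(0 <= j < n) `|x| ^+ j / j`!%:R)).
  apply/nondecreasing_seqP => m; rewrite big_nat_recr//= lerDl.
  by rewrite mulr_ge0// ?exprn_ge0// invr_ge0.
exact: is_cvg_series_exp_coeff.
Qed.

Lemma cvg_expR_mul (R : realType) (t : R) : 0 < t ->
  expR (- (m%:R * t)) @[m --> \oo] --> 0.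
Proof.
move=> t0; under eq_fun do rewrite -mulrN expRM_natl.
by apply: cvg_expr; rewrite ger0_norm ?expR_ge0// expR_lt1 oppr_lt0.
Qed.

Section moments.
Context d (T : measurableType d) (R : realType) (mu : {measure set T -> \bar R}).
Implicit Types (Phi Y k : T -> R).

Lemma Rintegral_sum_seq (I : Type) (s : seq I) (F : I -> T -> R) :
  (forall i, mu.-integrable setT (EFin \o F i)) ->
  \int[mu]_x (\sum_(i <- s) F i x) = \sum_(i <- s) \int[mu]_x F i x.
Proof.
move=> iF; pose G i x := (F i x)%:C%C.
have iG i : cintegrable mu (G i) by exact: cintegrable_real.
have := cintegral_sum s iG.
under eq_fun do rewrite -rmorph_sum.
rewrite cintegral_real; under eq_bigr do rewrite cintegral_real.
by rewrite -rmorph_sum => -[].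
Qed.

(** Termwise integration of the exponential series. Its partial sums are bounded by the exponential
    of the modulus of [s * Y], which is what [k] has to absorb. *)
Lemma moments_expR Phi Y k (s : R) :
  measurable_fun setT Phi -> measurable_fun setT Y ->
  mu.-integrable setT (EFin \o k) ->
  (forall x, `|Phi x| * expR `|s * Y x| <= k x) ->
  (forall j, mu.-integrable setT (EFin \o (fun x => Phi x * Y x ^+ j))) ->
  (forall j, \int[mu]_x (Phi x * Y x ^+ j) = 0) ->
  \int[mu]_x (Phi x * expR (s * Y x)) = 0.
Proof.
move=> mP mY ik Pk iPY PY0.
have PE n x : Phi x * (\sum_(0 <= j < n) (s * Y x) ^+ j / j`!%:R) =
    \sum_(0 <= j < n) (s ^+ j / j`!%:R) * (Phi x * Y x ^+ j).
  by rewrite mulr_sumr; apply: eq_bigr => j _; rewrite exprMn; ring.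
have iS j : mu.-integrable setT
    (EFin \o (fun x => (s ^+ j / j`!%:R) * (Phi x * Y x ^+ j))).
  by apply: eq_integrable (integrableZl measurableT (s ^+ j / j`!%:R) (iPY j)).
apply: (@Rintegral_dominated_eq0 _ _ _ mu
  (fun n x => Phi x * (\sum_(0 <= j < n) (s * Y x) ^+ j / j`!%:R)) _ k) => //.
- move=> n; apply: measurable_funM => //; apply: measurable_sum => j.
  apply: measurable_funM => //; apply: measurable_funX.
  exact: measurable_funM.
- apply: measurable_funM => //; apply: (measurableT_comp (@measurable_expR R)).
  exact: measurable_funM.
- apply: aeW => x; apply: cvgM; first exact: cvg_cst.
  exact: cvg_series_expR.
- move=> n x; rewrite normrM (le_trans _ (Pk x))// ler_wpM2l//.
  exact: normr_series_exp_le.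
- move=> n; under eq_Rintegral do rewrite PE.
  rewrite Rintegral_sum_seq//; apply: big1 => j _.
  by rewrite RintegralZl// PY0 mulr0.
Qed.

Section bounded_moments.
Variables (Phi Y : T -> R) (K : R).
Hypothesis iPhi : mu.-integrable setT (EFin \o Phi).
Hypothesis mY : measurable_fun setT Y.

Let mPhi : measurable_fun setT Phi.
Proof. exact: measurable_integrable iPhi. Qed.

(** Stated for an arbitrary bounded [Z] because it serves twice: for [Y], and for exponentials of
    [Y], whose powers are again exponentials of [Y]. *)
Lemma bounded_moments_expR (Z : T -> R) (L s : R) : measurable_fun setT Z ->
  (forall x, `|Z x| <= L) ->
  (forall j, \int[mu]_x (Phi x * Z x ^+ j) = 0) ->
  \int[mu]_x (Phi x * expR (s * Z x)) = 0.
Proof.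
move=> mZ ZL PZ.
apply: (@moments_expR _ _ (fun x => `|Phi x| * expR (`|s| * L))) => //.
- apply: (@integrable_bounded_mul _ _ _ _ _ (cst (expR (`|s| * L))) `|expR (`|s| * L)|) => //.
  exact: integrable_norm.
- move=> x; rewrite ler_wpM2l// ler_expR normrM.
  by rewrite ler_wpM2l.
- move=> j; apply: (@integrable_bounded_mul _ _ _ _ _ _ (L ^+ j)) => //.
    exact: measurable_funX.
  by move=> x; rewrite normrX lerXn2r// nnegrE (le_trans _ (ZL x)).
Qed.

Hypothesis YK : forall x, `|Y x| <= K.
Hypothesis PhiY : forall j, \int[mu]_x (Phi x * Y x ^+ j) = 0.

Let expY s : \int[mu]_x (Phi x * expR (s * Y x)) = 0.
Proof. exact: bounded_moments_expR YK PhiY. Qed.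

(* [expR (- expR (- m (y - c)))] is a bounded function of [expR (- m y)], and
   tends to the indicator of the half-line [y > c] as [m] tends to infinity. *)
Let gompertz (m : nat) c :
  \int[mu]_x (Phi x * expR (- expR (- (m%:R * (Y x - c))))) = 0.
Proof.
pose Z x := expR (- m%:R * Y x).
have mZ : measurable_fun setT Z.
  apply: (measurableT_comp (@measurable_expR R)); exact: measurable_funM.
have -> : (fun x => Phi x * expR (- expR (- (m%:R * (Y x - c))))) =
    (fun x => Phi x * expR (- expR (m%:R * c) * Z x)).
  apply/funext => x; congr (_ * expR _); rewrite mulNr; congr (- _).
  by rewrite /Z -expRD; congr expR; ring.
apply: (@bounded_moments_expR Z (expR (m%:R * K))) => //.
  move=> x; rewrite ger0_norm ?expR_ge0// ler_expR mulNr -mulrN ler_wpM2l//.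
  by rewrite (le_trans (ler_norm _))// normrN.
move=> j; rewrite -[RHS](expY (- m%:R * j%:R)); apply: eq_Rintegral => x _.
by rewrite /Z -expRM_natr; congr (_ * expR _); ring.
Qed.

(** The pointwise limit of the double exponentials of [gompertz]; at [y = c] they are constantly
    [expR (- 1)]. *)
Let step (c y : R) : R := if c < y then 1 else if y == c then expR (- 1) else 0.

Let measurable_step c : measurable_fun setT (fun x => step c (Y x)).
Proof.
apply: measurable_fun_ifT => //; first exact: measurable_fun_ltr.
by apply: measurable_fun_ifT => //; exact: measurable_fun_eqr.
Qed.

Let step_le1 c y : `|step c y| <= 1.
Proof.
rewrite /step; case: ifP => _; first by rewrite normr1.
case: ifP => _; last by rewrite normr0.
by rewrite ger0_norm ?expR_ge0// expR_le1 lerN10.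
Qed.

Let cvg_step c y : expR (- expR (- (m%:R * (y - c)))) @[m --> \oo] --> step c y.
Proof.
rewrite /step; case: ifPn => [cy|].
  rewrite -[X in _ --> X]expR0 -[X in expR X]oppr0.
  apply: (@cvg_comp _ _ _ _ expR).
    by apply: cvgN; apply: cvg_expR_mul; rewrite subr_gt0.
  exact: continuous_expR.
rewrite -leNgt => yc; case: eqP => [->|/eqP yc'].
  under eq_fun do rewrite subrr mulr0 oppr0 expR0.
  exact: cvg_cst.
have {yc yc'}yc : 0 < c - y by rewrite subr_gt0 lt_neqAle yc'.
(* With [u = m * (c - y)], the inequality [expR u <= expR (expR u)] bounds the double exponential by
   [expR (- u)]. *)
apply: (@squeeze_cvgr _ _ _ _ (fun=> 0) (fun m => expR (- (m%:R * (c - y))))).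
- apply: nearW => m; rewrite expR_ge0/= expRN.
  rewrite -[in leRHS](opprB y c) mulrN opprK -[in leRHS](opprK (_ * _)) [leRHS]expRN.
  rewrite lef_pV2 ?posrE ?expR_gt0//.
  by apply: le_trans (expR_ge1Dx _); rewrite lerDr.
- exact: cvg_cst.
- exact: cvg_expR_mul.
Qed.

Let integral_step c : \int[mu]_x (Phi x * step c (Y x)) = 0.
Proof.
apply: (@Rintegral_dominated_eq0 _ _ _ mu
  (fun m x => Phi x * expR (- expR (- (m%:R * (Y x - c))))) _ (fun x => `|Phi x|)) => //.
- move=> m; apply: measurable_funM => //.
  apply: (measurableT_comp (@measurable_expR R)); apply: measurable_funN.
  apply: (measurableT_comp (@measurable_expR R)); apply: measurable_funN.
  by apply: measurable_funM => //; exact: measurable_funB.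
- exact: measurable_funM.
- exact: integrable_norm.
- by apply: aeW => x; apply: cvgM; [exact: cvg_cst|exact: cvg_step].
- by move=> m x; rewrite normrM ler_piMr// ger0_norm ?expR_ge0// expR_le1 oppr_le0 expR_ge0.
Qed.

(** The steps at [c - m.+1%:R^-1] equal 1 wherever [c <= y] and are eventually 0 wherever [y < c];
    approaching [c] from below removes the spurious value of [step] at its threshold. *)
Lemma bounded_moments_ge c : \int[mu]_x (Phi x * (c <= Y x)%R%:R) = 0.
Proof.
apply: (@Rintegral_dominated_eq0 _ _ _ mu
  (fun m x => Phi x * step (c - m.+1%:R^-1) (Y x)) _ (fun x => `|Phi x|)) => //.
- by move=> m; exact: measurable_funM.
- apply: measurable_funM => //.
  have -> : (fun x => (c <= Y x)%R%:R) = (fun x => if c <= Y x then 1 else 0 : R).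
    by apply/funext => x; case: ifP.
  by apply: measurable_fun_ifT => //; exact: measurable_fun_ler.
- exact: integrable_norm.
- apply: aeW => x; apply: cvgM; first exact: cvg_cst.
  have cv : (c - m.+1%:R^-1) @[m --> \oo] --> c.
    by rewrite -[X in _ --> X]subr0; apply: cvgB; [exact: cvg_cst|exact: cvg_harmonic].
  have [cY|Yc] := leP c (Y x).
    apply: cvg_near_cst; apply: nearW => m; rewrite /step.
    by rewrite (_ : _ < _)// (lt_le_trans _ cY)// ltrBlDr ltrDl.
  apply: cvg_near_cst.
  apply: filterS (cvgr_gt _ cv _ Yc) => m h.
  by rewrite /step ltNge (ltW h)/= lt_eqF.
- by move=> m x; rewrite normrM ler_piMr.
Qed.

End bounded_moments.

Lemma RintegralM_indic Phi Y (A : set R) :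
  \int[mu]_x (Phi x * \1_A (Y x)) = \int[mu]_(x in Y @^-1` A) Phi x.
Proof.
rewrite [RHS]Rintegral_mkcond; apply: eq_Rintegral => x _.
rewrite patchE indicE; case: ifPn; rewrite !(inE, notin_setE)/=.
  by move=> AY; rewrite mem_set// mulr1.
by move=> AY; rewrite memNset// mulr0.
Qed.

Lemma RintegralM_indic_id Phi (D : set T) :
  \int[mu]_x (Phi x * \1_D x) = \int[mu]_(x in D) Phi x.
Proof.
rewrite [RHS]Rintegral_mkcond; apply: eq_Rintegral => x _.
by rewrite patchE indicE; case: ifPn => _; rewrite ?mulr1 ?mulr0.
Qed.

(* Half-lines generate the Borel sets. *)
Lemma Rintegral_ge_indic Phi Y (A : set R) :
  mu.-integrable setT (EFin \o Phi) -> measurable_fun setT Y ->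
  \int[mu]_x Phi x = 0 ->
  (forall c, \int[mu]_x (Phi x * (c <= Y x)%R%:R) = 0) ->
  measurable A -> \int[mu]_x (Phi x * \1_A (Y x)) = 0.
Proof.
move=> iP mY P0 Pc mA.
have GE : (default_measure_display.-measurable : set (set R)) = <<s @RGenCInfty.G R >>.
  exact: RGenCInfty.measurableE.
have mpre B : measurable B -> measurable (Y @^-1` B).
  by move=> mB; rewrite -[X in measurable X]setTI; exact: mY.
have iM (B : set R) : measurable B ->
    mu.-integrable setT (EFin \o (fun x => Phi x * \1_B (Y x))).
  move=> mB; apply: (@integrable_bounded_mul _ _ _ _ _ _ 1) => //.
    by apply: measurableT_comp => //; exact: measurable_indic.
  by move=> x; rewrite indicE; case: (_ \in _); rewrite ?normr1 ?normr0.
move: mA; rewrite GE.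
apply: (@dynkin_induction _ _ (@RGenCInfty.G R)
  (fun A => \int[mu]_x (Phi x * \1_A (Y x)) = 0)) => //.
- move=> _ _ [a ->] [b ->]; exists (Num.max a b).
  by apply/seteqP; split => x /=; rewrite !in_itv/= !andbT ge_max => /andP.
- by rewrite -[RHS]P0; apply: eq_Rintegral => x _; rewrite indicT mulr1.
- move=> _ [c ->]; rewrite -[RHS](Pc c); apply: eq_Rintegral => x _.
  by rewrite indicE; congr (_ * (nat_of_bool _)%:R); apply/idP/idP; rewrite inE/= in_itv/= andbT.
- move=> B mB B0.
  have -> : (fun x => Phi x * \1_(~` B) (Y x)) = (fun x => Phi x - Phi x * \1_B (Y x)).
    by apply/funext => x; rewrite !indicE in_setC; case: (_ \in _); rewrite /= ?mulr1 ?mulr0 ?subrr ?subr0.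
  by rewrite RintegralB// ?P0 ?B0 ?subrr//; exact: iM.
- move=> F mF tF F0; rewrite RintegralM_indic /Rintegral preimage_bigcup integral_bigcup//.
  + rewrite eseries0// => n _ _.
    rewrite -[LHS]fineK; first by rewrite -[fine _]RintegralM_indic F0.
    apply: integrable_fin_num; first exact: mpre.
    by apply: integrableS iP => //; exact: mpre.
  + apply/trivIsetP => i j _ _ ij; rewrite -preimage_setI.
    by move/trivIsetP : tF => /(_ _ _ _ _ ij) ->//; rewrite preimage_set0.
  + by move=> n; exact: mpre.
  + apply: integrableS iP => //; rewrite -preimage_bigcup; apply: mpre.
    exact: bigcup_measurable.
Qed.

Lemma bounded_moments_indic Phi Y (K : R) (A : set R) :
  mu.-integrable setT (EFin \o Phi) -> measurable_fun setT Y ->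
  (forall x, `|Y x| <= K) ->
  (forall j, \int[mu]_x (Phi x * Y x ^+ j) = 0) ->
  measurable A -> \int[mu]_x (Phi x * \1_A (Y x)) = 0.
Proof.
move=> iP mY YK PY mA; apply: Rintegral_ge_indic => //.
  by rewrite -[RHS](PY 0%N); apply: eq_Rintegral => x _; rewrite expr0 mulr1.
by move=> c; exact: bounded_moments_ge iP mY YK PY c.
Qed.

End moments.
(** * Benedicks' theorem on the line *)

Definition pushforward_measure d1 d2 (T1 : measurableType d1)
    (T2 : measurableType d2) (R : realType) (m : {measure set T1 -> \bar R})
    (f : T1 -> T2) (mf : measurable_fun setT f) : {measure set T2 -> \bar R} :=
  measure_function_pushforward__canonical__measure_function_Measure m mf.

(** * Affine changes of variable on the line *)

Section affine_change.
Context (R : realType).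
Local Notation mu := (@lebesgue_measure R).
Variables (s c : R).
Hypothesis s0 : 0 < s.

Let phi (x : measurableTypeR R) : measurableTypeR R := s * x + c.

Let mphi : measurable_fun setT phi.
Proof. by apply: measurable_funD => //; exact: measurable_funM. Qed.

Let smeas : {measure set (measurableTypeR R) -> \bar R} :=
  mscale (NngNum (ltW s0)) (pushforward_measure mu mphi).

(** [s] times the image of Lebesgue measure under [phi] gives half-open intervals their length, and
    this characterizes Lebesgue measure. *)
Let smeasE A : measurable A -> mu A = smeas A.
Proof.
apply: lebesgue_measure_unique => _ [[a b] _ <-] /=.
rewrite /smeas /= /mscale/= /pushforward/=.
have -> : phi @^-1` `]a, b]%classic = `](a - c) / s, (b - c) / s]%classic.
  apply/seteqP; split => x /=; rewrite /phi !in_itv/= => /andP[ax xb]; apply/andP; split.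
  - by rewrite ltr_pdivrMr// ltrBlDr mulrC.
  - by rewrite ler_pdivlMr// lerBrDr mulrC.
  - by move: ax; rewrite ltr_pdivrMr// ltrBlDr mulrC.
  - by move: xb; rewrite ler_pdivlMr// lerBrDr mulrC.
rewrite !lebesgue_measure_itv/= !lte_fin ltr_pM2r ?invr_gt0// ltrD2r.
case: ifPn => _; last by rewrite mule0.
by rewrite -!EFinD -EFinM; congr EFin; field; rewrite gt_eqF.
Qed.

Lemma lebesgue_measure_affine (A : set R) : measurable A ->
  mu A = (s%:E * mu ((fun x : R => (s * x + c)%R) @^-1` A))%E.
Proof. by move=> mA; rewrite smeasE. Qed.

Lemma ge0_integral_affine (g : R -> \bar R) :
  measurable_fun setT g -> (forall x, 0 <= g x)%E ->
  (\int[mu]_x g x = s%:E * \int[mu]_x g (s * x + c)%R)%E.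
Proof.
move=> mg g0.
rewrite (eq_measure_integral smeas) => [|A mA _]; last exact: smeasE.
rewrite ge0_integral_mscale//=; congr (_ * _)%E.
by rewrite ge0_integral_pushforward.
Qed.

Lemma integrable_affine (h : R -> R) : mu.-integrable setT (EFin \o h) ->
  mu.-integrable setT (EFin \o (fun x => h (s * x + c))).
Proof.
move=> ih; have mh := measurable_integrable ih.
have mh' : measurable_fun setT (fun x => h (s * x + c)) by exact: (measurableT_comp mh mphi).
apply/integrableP; split; first exact/measurable_EFinP.
have mah : measurable_fun setT (abse \o (EFin \o h)).
  by apply: measurableT_comp => //; exact/measurable_EFinP.
have /integrableP[_] := ih.
rewrite (ge0_integral_affine mah) => [|x]; last exact: abse_ge0.
rewrite /=; set I := (\int[_]_x _)%E => sI; rewrite -[ltLHS]/I.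
have I0 : (0 <= I)%E by exact: integral_ge0.
rewrite ltNge leye_eq; apply/negP => /eqP Iy.
by move: sI; rewrite Iy gt0_muley ?lte_fin// ltxx.
Qed.

(** The nonnegative case is applied to the modulus of [h] and to the modulus minus [h], whose
    difference is [h]. *)
Lemma Rintegral_affine (h : R -> R) : mu.-integrable setT (EFin \o h) ->
  \int[mu]_x h x = s * \int[mu]_x h (s * x + c).
Proof.
have pos (k : R -> R) : mu.-integrable setT (EFin \o k) -> (forall x, 0 <= k x) ->
    \int[mu]_x k x = s * \int[mu]_x k (s * x + c).
  move=> ik k0; have ik' := integrable_affine ik.
  rewrite -[s in RHS]/(fine s%:E) -fineM//; last exact: (integrable_fin_num measurableT ik').
  by congr fine; apply: (ge0_integral_affine (g := EFin \o k)) => //; exact: measurable_int ik.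
move=> ih; have ia := integrable_norm ih.
have ib : mu.-integrable setT (EFin \o (fun x => `|h x| - h x)).
  by apply: eq_integrable (integrableB measurableT ia ih).
have hE x : h x = `|h x| - (`|h x| - h x) by rewrite opprB addrC subrK.
under eq_Rintegral do rewrite hE.
under [in RHS]eq_Rintegral do rewrite hE.
have pb : \int[mu]_x (`|h x| - h x) = s * \int[mu]_x (`|h (s * x + c)| - h (s * x + c)).
  by apply: (pos _ ib) => x; rewrite subr_ge0 ler_norm.
have pa : \int[mu]_x `|h x| = s * \int[mu]_x `|h (s * x + c)|.
  by apply: (pos _ ia) => x; exact: normr_ge0.
transitivity (\int[mu]_x `|h x| - \int[mu]_x (`|h x| - h x)).
  exact: (RintegralB measurableT ia ib).
rewrite pa pb.
have ia' := integrable_affine ia; have ib' := integrable_affine ib.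
rewrite -mulrBr; congr (_ * _).
by rewrite -(RintegralB measurableT ia' ib').
Qed.

End affine_change.

Section translation.
Context (R : realType).
Local Notation mu := (@lebesgue_measure R).
Variable c : R.

Lemma lebesgue_measure_translation (A : set R) : measurable A ->
  mu ((fun x => x + c) @^-1` A) = mu A.
Proof.
move=> mA; rewrite [RHS](lebesgue_measure_affine c ltr01)// mul1e.
by congr mu; apply/seteqP; split => x /=; rewrite mul1r.
Qed.

Lemma negligible_translation (A : set R) :
  mu.-negligible A -> mu.-negligible ((fun x => x + c) @^-1` A).
Proof.
move=> [B [mB B0 AB]].
have mB' : measurable ((fun x => x + c) @^-1` B).
  rewrite -[X in measurable X]setTI.
  by apply: measurable_funD => //.
exists ((fun x => x + c) @^-1` B); split => //; last by move=> x /AB.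
by rewrite -[RHS]B0 -(lebesgue_measure_translation mB).
Qed.

Lemma ae_translation (P : R -> Prop) :
  {ae mu, forall x, P x} -> {ae mu, forall x, P (x + c)}.
Proof. by move/negligible_translation. Qed.

End translation.

(** * Trigonometric moments and periodic sets *)

Section trigonometric_moments.
Context (R : realType).
Local Notation mu := (@lebesgue_measure R).
Variable w : R.

(** For [w > 0] this expresses that the periodization of [f] with period [2 pi / w] is zero, through
    its Fourier coefficients alone. *)
Definition trig_null (f : R -> R[i]) := cintegrable mu f /\
  forall k : int, cintegral mu (fun t => f t * cis (k%:~R * w * t)) = 0.

Let mcis k : measurable_fun setT (fun t : R => cis (k * w * t)).
Proof. by apply: measurable_fun_cis; exact: measurable_funM. Qed.

Let icis f k : cintegrable mu f -> cintegrable mu (fun t => f t * cis (k * w * t)).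
Proof.
move=> fi; apply: (@cintegrableMl _ _ _ _ _ _ 1) => //; first exact: mcis.
by move=> t; rewrite normc_cis.
Qed.

Let mcos : measurable_fun setT (fun t : R => cos (w * t)).
Proof. apply: (measurableT_comp _ (mulrl_measurable w)).
by apply: continuous_measurable_fun; exact: continuous_cos. Qed.

Let msin : measurable_fun setT (fun t : R => sin (w * t)).
Proof. apply: (measurableT_comp _ (mulrl_measurable w)).
by apply: continuous_measurable_fun; exact: continuous_sin. Qed.

Lemma cosE_cis (x : R) : (cos x)%:C%C = (cis x + cis (- x)) / 2%:R :> R[i].
Proof.
rewrite (_ : cis x + _ = (cos x)%:C%C * 2%:R) ?mulfK ?pnatr_eq0//.
rewrite mulr_natr; apply: complex_eqP; rewrite !(ReD, ImD)/= ?cosN ?sinN ?subrr ?addr0//.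
Qed.

Lemma sinE_cis (x : R) : (sin x)%:C%C = (cis x - cis (- x)) * (0 +i* - 2^-1)%C :> R[i].
Proof.
apply: complex_eqP; rewrite ?ReM ?ImM !(ReD, ImD, ReN, ImN)/= cosN sinN; lra.
Qed.

(** Multiplication by [cis (w * t)] or its inverse shifts the index of the vanishing Fourier
    coefficients by one. *)
Let trig_null_cis2 (a b : R[i]) f : trig_null f ->
  trig_null (fun t => f t * (a * cis (w * t) + b * cis (- (w * t)))).
Proof.
move=> [fi f0].
have E (k : R) t : f t * (a * cis (w * t) + b * cis (- (w * t))) * cis (k * w * t) =
    a * (f t * cis ((k + 1) * w * t)) + b * (f t * cis ((k - 1) * w * t)).
  by rewrite !mulrDl !cisD mul1r mulN1r mulNr; ring.
have i1 k : cintegrable mu (fun t => a * (f t * cis (k * w * t))).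
  by apply: cintegrableZl; exact: icis.
have i2 k : cintegrable mu (fun t => b * (f t * cis (k * w * t))).
  by apply: cintegrableZl; exact: icis.
split.
  have := cintegrableD (i1 1) (i2 (- 1)); congr cintegrable; apply/funext => t.
  by rewrite mulrDr mul1r mulN1r mulNr; ring.
move=> k; under eq_fun do rewrite E.
rewrite cintegralD// !cintegralZl; [|exact: icis|exact: icis].
have -> : (k%:~R + 1 : R) = (k + 1)%:~R by rewrite intrD.
have -> : (k%:~R - 1 : R) = (k - 1)%:~R by rewrite intrB.
by rewrite !f0 !mulr0 addr0.
Qed.

Lemma trig_null_cos f : trig_null f -> trig_null (fun t => f t * (cos (w * t))%:C%C).
Proof.
move=> /(trig_null_cis2 2%:R^-1 2%:R^-1); congr trig_null; apply/funext => t.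
by rewrite cosE_cis; congr (_ * _); ring.
Qed.

Lemma trig_null_sin f : trig_null f -> trig_null (fun t => f t * (sin (w * t))%:C%C).
Proof.
move=> /(trig_null_cis2 (0 +i* - 2^-1)%C (- (0 +i* - 2^-1))%C); congr trig_null; apply/funext => t.
by rewrite sinE_cis; congr (_ * _); ring.
Qed.

Lemma cintegral_trig_null f : trig_null f -> cintegral mu f = 0.
Proof.
move=> [_ /(_ 0)]; under eq_fun do rewrite mul0r mul0r cis0 mulr1; exact.
Qed.

Let indic_null f (Y : R -> R) (A : set R) : cintegrable mu f ->
  measurable_fun setT Y -> (forall t, `|Y t| <= 1) ->
  (forall j, cintegral mu (fun t => f t * ((Y t) ^+ j)%:C%C) = 0) -> measurable A ->
  cintegral mu (fun t => f t * (\1_A (Y t))%:C%C) = 0.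
Proof.
move=> [fr fi] mY Y1 Y0 mA; apply: complex_eqP => /=.
  under eq_Rintegral do rewrite ReM/= mulr0 subr0.
  apply: (@bounded_moments_indic _ _ _ _ _ _ 1) => // j.
  have /(congr1 (@complex.Re R)) /= := Y0 j.
  by under eq_Rintegral do rewrite ReM/= mulr0 subr0.
under eq_Rintegral do rewrite ImM/= mulr0 add0r.
apply: (@bounded_moments_indic _ _ _ _ _ _ 1) => // j.
have /(congr1 (@complex.Im R)) /= := Y0 j.
by under eq_Rintegral do rewrite ImM/= mulr0 add0r.
Qed.

Lemma trig_null_pow f i j : trig_null f ->
  trig_null (fun t => f t * (sin (w * t) ^+ j)%:C%C * (cos (w * t) ^+ i)%:C%C).
Proof.
move=> f0; elim: i => [|i IHi].
  elim: j => [|j IHj].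
    by under eq_fun do rewrite !expr0 !mulr1.
  have := trig_null_sin IHj; congr trig_null; apply/funext => t.
  by rewrite !expr0 !mulr1 exprSr rmorphM/= mulrA.
have := trig_null_cos IHi; congr trig_null; apply/funext => t.
by rewrite [in RHS]exprSr rmorphM/= mulrA.
Qed.

(** One variable at a time: for each power of the sine, all cosine moments vanish, which yields the
    indicator of [A]; the integrals so obtained are the sine moments of [f] times that indicator. *)
Lemma trig_null_indic f (A B : set R) : trig_null f ->
  measurable A -> measurable B ->
  cintegral mu (fun t => f t * (\1_A (cos (w * t)) * \1_B (sin (w * t)))%:C%C) = 0.
Proof.
move=> f0 mA mB; have [fi _] := f0.
have indic1 (C : set R) (x : R) : Normc.normc ((\1_C x : R)%:C%C : R[i]) <= 1.
  by rewrite normcR indicE; case: (_ \in _); rewrite ?normr1 ?normr0.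
have fA : cintegrable mu (fun t => f t * (\1_A (cos (w * t)))%:C%C).
  apply: (@cintegrableMl _ _ _ _ _ _ 1) => //.
  by apply: measurable_funC_real; apply: measurableT_comp => //; exact: measurable_indic.
under eq_fun do rewrite rmorphM/= mulrA.
apply: indic_null => //; first by move=> t; exact: sin_max.
move=> j; under eq_fun do rewrite mulrAC.
apply: indic_null => //; last 2 first.
- by move=> t; exact: cos_max.
- by move=> i; apply: cintegral_trig_null; exact: trig_null_pow.
apply: (@cintegrableMl _ _ _ _ _ _ 1) => //.
  by apply: measurable_funC_real; exact: measurable_funX.
by move=> t; rewrite normcR normrX exprn_ile1// sin_max.
Qed.

End trigonometric_moments.

Section periodic_sets.
Context (R : realType).
Local Notation mu := (@lebesgue_measure R).
Variables (w T : R).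
Hypotheses (w0 : 0 < w) (wT : w * T = pi *+ 2).

Lemma cos_periodic_int (x : R) (k : int) : cos (x + (pi *+ 2) * k%:~R) = cos x.
Proof.
case: k => n; first by rewrite -pmulrn mulr_natr (periodicn (@cosD2pi R)).
rewrite NegzE mulrNz mulrN -pmulrn mulr_natr.
by rewrite -(periodicn (@cosD2pi R) n.+1 (x - _)) subrK.
Qed.

Lemma sin_periodic_int (x : R) (k : int) : sin (x + (pi *+ 2) * k%:~R) = sin x.
Proof.
case: k => n; first by rewrite -pmulrn mulr_natr (periodicn (@sinD2pi R)).
rewrite NegzE mulrNz mulrN -pmulrn mulr_natr.
by rewrite -(periodicn (@sinD2pi R) n.+1 (x - _)) subrK.
Qed.

Lemma cis_periodic_int (x : R) (k : int) : cis (x + (pi *+ 2) * k%:~R) = cis x.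
Proof. by rewrite /cis cos_periodic_int sin_periodic_int. Qed.

(* [acos] is only meaningful on [-1, 1]; clipping makes it monotone on the line. *)
Let acosc (y : R) : R := acos (Num.max (-1) (Num.min y 1)).

Let clip_itv (y : R) : -1 <= Num.max (-1) (Num.min y 1) <= 1.
Proof. by rewrite le_max lexx/= ge_max ge_min lexx orbT andbT; lra. Qed.

Let acosc_nonincreasing : {homo acosc : x y /~ x <= y}.
Proof.
move=> x y xy; rewrite /acosc.
set a := Num.max _ (Num.min x _); set b := Num.max _ (Num.min y _).
have ab : b <= a.
  rewrite /a /b ge_max !le_max lexx/=; apply/orP; right.
  by rewrite le_min !ge_min xy lexx orbT.
have hI c : -1 <= c <= 1 -> acos c \in `[0, pi].
  by move=> h; rewrite in_itv/= acos_ge0// acos_lepi.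
have ha := clip_itv x; have hb := clip_itv y.
rewrite leNgt; apply/negP => lt.
have : cos (acos a) < cos (acos b) by rewrite ltr_cos// hI.
by rewrite !acosK ?in_itv//= ltNge ab.
Qed.

Let measurable_acosc : measurable_fun setT acosc.
Proof. by apply: nonincreasing_measurable => // x y; exact: acosc_nonincreasing. Qed.

Let acosc_cos (x : R) : -1 <= cos x <= 1 -> acosc (cos x) = acos (cos x).
Proof. by move=> /andP[h1 h2]; rewrite /acosc min_l// max_r. Qed.

(** Modulo [2 pi] the angle [w * t] is plus or minus the arc cosine of its cosine, the sign being
    that of its sine. *)
Let periodic_fold (t : R) : exists2 k : int, w * t = w * ((-1) ^+ (sin (w * t) < 0)%R * (acosc (cos (w * t)) / w)) + (pi *+ 2) * k%:~R & True.
Proof.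
pose p2 : R := pi *+ 2.
have p20 : 0 < p2 by rewrite pmulrn_lgt0// pi_gt0.
pose k := Num.floor ((w * t + pi) / p2).
pose y := w * t - p2 * k%:~R.
have yE : w * t = y + p2 * k%:~R by rewrite /y subrK.
have hk : k%:~R <= (w * t + pi) / p2 < (k + 1)%:~R by apply: floor_itv; exact: num_real.
have /andP[y1 y2] : - pi <= y < pi.
  move: hk; rewrite ler_pdivlMr// ltr_pdivrMr// intrD mulrDl mul1r /y /p2 mulr2n.
  by rewrite [k%:~R * _]mulrC => /andP[h1 h2]; apply/andP; split; lra.
have cE : cos (w * t) = cos y by rewrite yE cos_periodic_int.
have sE : sin (w * t) = sin y by rewrite yE sin_periodic_int.
have cI x : -1 <= cos x <= 1 by rewrite cos_geN1 cos_le1.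
rewrite cE sE acosc_cos//.
have [y0|y0] := leP 0 y.
  exists k => //; rewrite cosK ?in_itv/= ?y0 ?ltW//.
  rewrite ltNge sin_ge0_pi ?y0 ?ltW//= expr0 mul1r [w * (_ / _)]mulrC divfK ?gt_eqF//.
have y1' : 0 < - y by rewrite oppr_gt0.
have aE : acos (cos y) = - y by apply: cosKN; rewrite y1 ltW.
rewrite aE.
(* At [y = - pi] the sine is zero, so the sign is taken positive and the arc cosine gives [pi]: one
   turn more, hence [k - 1]. *)
have [ye|ypi] := eqVneq y (- pi).
  exists (k - 1) => //.
  rewrite ye sinN sinpi oppr0 ltxx expr0 mul1r opprK [w * (_ / _)]mulrC divfK ?gt_eqF//.
  by rewrite yE ye intrB mulrBr mulr1 /p2 mulr2n; ring.
have s0 : sin y < 0.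
  rewrite -oppr_gt0 -sinN sin_gt0_pi// y1'/= ltrNl lt_neqAle y1 andbT eq_sym//.
by exists k => //; rewrite s0 expr1 mulN1r -mulNr opprK [w * (_ / _)]mulrC divfK ?gt_eqF.
Qed.

(** By [periodic_fold], membership in a periodic set depends only on the cosine of [w * t] and the
    sign of its sine. The indicator splits over the two signs into products covered by
    [trig_null_indic]. *)
Lemma trig_null_periodic f (S : set R) : trig_null w f -> measurable S ->
  (forall t (k : int), S (t + T * k%:~R) <-> S t) ->
  cintegral mu (fun t => f t * (\1_S t)%:C%C) = 0.
Proof.
move=> f0 mS perS.
pose A (e : R) := (fun y => e * (acosc y / w)) @^-1` S.
have mA e : measurable (A e).
  rewrite -[X in measurable X]setTI; apply: (_ : measurable_fun setT _) => //.
  by apply: measurable_funM => //; apply: measurable_funM => //; exact: measurable_acosc.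
have SE t : (\1_S t : R) = \1_(A 1) (cos (w * t)) * \1_`[0, +oo[ (sin (w * t)) +
   \1_(A (-1)) (cos (w * t)) * \1_`]-oo, 0[ (sin (w * t)).
  have [k kE _] := periodic_fold t.
  have tE : t = (-1) ^+ (sin (w * t) < 0)%R * (acosc (cos (w * t)) / w) + T * k%:~R.
    by apply: (mulfI (lt0r_neq0 w0)); rewrite mulrDr [w * (T * _)]mulrA wT -kE.
  have -> : \1_S t = \1_(A ((-1) ^+ (sin (w * t) < 0)%R)) (cos (w * t)) :> R.
    rewrite !indicE; congr ((nat_of_bool _)%:R).
    by rewrite [in LHS]tE; apply/idP/idP; rewrite !inE /A/= => /perS.
  rewrite ![\1_`[0, +oo[ _]indicE ![\1_`]-oo, 0[ _]indicE.
  rewrite (_ : (sin (w * t) \in `]-oo, 0[%classic) = (sin (w * t) < 0)); last first.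
    by apply/idP/idP; rewrite inE/= in_itv/=.
  rewrite (_ : (sin (w * t) \in `[0, +oo[%classic) = ~~ (sin (w * t) < 0)); last first.
    by apply/idP/idP; rewrite inE/= in_itv/= andbT leNgt.
  by case: (sin (w * t) < 0); rewrite /= ?expr1 ?expr0 ?mulr0 ?mulr1 ?addr0 ?add0r.
have [fi _] := f0.
have i2 (C D : set R) : measurable C -> measurable D ->
    cintegrable mu (fun t => f t * (\1_C (cos (w * t)) * \1_D (sin (w * t)))%:C%C).
  move=> mC mD; apply: (@cintegrableMl _ _ _ _ _ _ 1) => //.
    apply: measurable_funC_real; apply: measurable_funM.
      apply: measurableT_comp; first exact: measurable_indic.
      by apply: measurableT_comp (mulrl_measurable w); apply: continuous_measurable_fun; exact: continuous_cos.
    apply: measurableT_comp; first exact: measurable_indic.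
    by apply: measurableT_comp (mulrl_measurable w); apply: continuous_measurable_fun; exact: continuous_sin.
  move=> t; rewrite normcR !indicE.
  by case: (_ \in _); case: (_ \in _); rewrite /= ?mulr0 ?mulr1 ?normr0 ?normr1.
under eq_fun do rewrite SE rmorphD/= mulrDr.
by rewrite cintegralD ?(trig_null_indic f0) ?addr0//; exact: i2.
Qed.

End periodic_sets.

(** * Orthogonality over a period and zeros of trigonometric polynomials *)

Section ftc_everywhere.
Context (R : realType).
Local Notation mu := (@lebesgue_measure R).

Lemma Rintegral_FTC2 (f F : R -> R) (a b : R) : a < b -> continuous f ->
  (forall x : R, is_derive x (1 : R) (F : R^o -> R^o) (f x)) ->
  \int[mu]_(x in `[a, b]) f x = F b - F a.
Proof.
move=> ab cf dF.
have cF : continuous (F : R^o -> R^o).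
  by move=> x; apply: differentiable_continuous; apply/derivable1_diffP; have [] := dF x.
rewrite /Rintegral (@continuous_FTC2 _ f F)//.
- exact: continuous_subspaceT.
- split.
  + by move=> x _; have [] := dF x.
  + exact: cvg_at_right_filter (cF a).
  + exact: cvg_at_left_filter (cF b).
- by move=> x _; rewrite derive1E; have [_ ->] := dF x.
Qed.

Lemma Rintegral_itv_indic (f : R -> R) (a b : R) : a < b -> continuous f ->
  \int[mu]_x (f x * \1_`[a, b[ x) = \int[mu]_(x in `[a, b]) f x.
Proof.
move=> ab cf; rewrite -(@Rintegral_itv_bndo_bndc _ (BLeft a) b); last first.
  apply: integrableS (continuous_compact_integrable (@segment_compact _ a b) _) => //.
    by apply: subset_itvl; rewrite bnd_simp.
  exact: continuous_subspaceT.
exact: RintegralM_indic_id.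
Qed.

End ftc_everywhere.

Section cis_period.
Context (R : realType).
Local Notation mu := (@lebesgue_measure R).
Variables (w T : R).
Hypotheses (T0 : 0 < T) (wT : w * T = pi *+ 2).

Let w0 : w != 0.
Proof.
apply/eqP => w0; move: wT; rewrite w0 mul0r => /esym/eqP.
by rewrite mulrn_eq0/= gt_eqF// pi_gt0.
Qed.

Lemma is_derive_sin_scaled (c x : R) : c != 0 ->
  is_derive x (1 : R) (fun t : R^o => c^-1 * sin (c * t) : R^o) (cos (c * x)).
Proof.
move=> c0; have h : is_derive x (1 : R) (fun t : R^o => c * t : R^o) c.
  by apply: is_derive_eq; rewrite /GRing.scale/= mulr1.
by apply: is_derive_eq; rewrite /GRing.scale/=; field.
Qed.

Lemma is_derive_cos_scaled (c x : R) : c != 0 ->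
  is_derive x (1 : R) (fun t : R^o => - (c^-1 * cos (c * t)) : R^o) (sin (c * x)).
Proof.
by move=> c0; apply: is_derive_eq; rewrite /GRing.scale/=; field.
Qed.

Lemma cintegral_cis_period (k : int) :
  cintegral mu (fun t => cis (k%:~R * w * t) * (\1_`[0, T[ t)%:C%C) =
  if k == 0 then (T%:C)%C else 0.
Proof.
have cc (c : R) : continuous (fun t : R => cos (c * t)).
  by move=> x; apply: continuous_comp; [exact: mulrl_continuous|exact: continuous_cos].
have cs (c : R) : continuous (fun t : R => sin (c * t)).
  by move=> x; apply: continuous_comp; [exact: mulrl_continuous|exact: continuous_sin].
case: eqP => [->|/eqP k0].
  under eq_fun do rewrite !mul0r cis0 mul1r.
  rewrite cintegral_real; congr (_%:C)%C.
  have mT : lebesgue_measure (`[0, T[%classic : set R) = T%:E.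
    by rewrite lebesgue_measure_itv/= lte_fin T0 -EFinB subr0.
  rewrite /Rintegral integral_indic// setIT.
  exact: (congr1 fine mT).
have kw0 : k%:~R * w != 0 by rewrite mulf_neq0// intr_eq0.
have kT : k%:~R * w * T = 0 + (pi *+ 2) * k%:~R by rewrite -mulrA wT add0r mulrC.
apply: complex_eqP => /=.
  under eq_Rintegral do rewrite mulr0 subr0.
  rewrite Rintegral_itv_indic// (@Rintegral_FTC2 _ _ _ _ _ T0 (cc _)
    (fun x => is_derive_sin_scaled x kw0)).
  by rewrite kT sin_periodic_int mulr0 sin0 mulr0 subr0.
under eq_Rintegral do rewrite mulr0 add0r.
rewrite Rintegral_itv_indic// (@Rintegral_FTC2 _ _ _ _ _ T0 (cs _)
  (fun x => is_derive_cos_scaled x kw0)).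
by rewrite kT cos_periodic_int mulr0 subrr.
Qed.

Lemma cis_pow (x : R) (n : nat) : cis x ^+ n = cis (n%:R * x).
Proof.
elim: n => [|n IHn]; first by rewrite mul0r cis0.
by rewrite exprS IHn -cisD -natr1 mulrDl mul1r addrC.
Qed.

Lemma cis_inj (t s : R) : t \in `[0, T[ -> s \in `[0, T[ ->
  cis (w * t) = cis (w * s) -> t = s.
Proof.
wlog ts : t s / t <= s.
  move=> H ht hs ets; have [ts|/ltW st] := leP t s; first exact: H.
  by apply/esym/H.
rewrite !in_itv/= => /andP[t0 tT] /andP[s0 sT] [ec es].
have w_gt0 : 0 < w by rewrite -(pmulr_lgt0 _ T0) wT pmulrn_lgt0// pi_gt0.
apply/eqP; rewrite eq_le ts/= leNgt; apply/negP => lts.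
have c1 : cos (w * (s - t)) = 1.
  by rewrite mulrBr cosB ec es -!expr2 cos2Dsin2.
(* The half angle lies strictly between 0 and [pi], where the sine is positive, while
   [cos (y *+ 2) = 1] forces the sine to vanish. *)
pose y := w * (s - t) / 2.
have : sin y ^+ 2 = 0.
  have : cos (y *+ 2) = 1 by rewrite -c1 /y -mulr_natr divfK.
  by rewrite cos_mulr2n cos2sin2 mulr2n => h; lra.
move/eqP; rewrite sqrf_eq0 => /eqP sy0.
have : 0 < sin y.
  apply: sin_gt0_pi; rewrite /y divr_gt0 ?mulr_gt0 ?subr_gt0//=.
  rewrite ltr_pdivrMr// mulr_natr -wT ltr_pM2l//.
  by rewrite ltrBlDr (lt_le_trans sT)// lerDl.
by rewrite sy0 ltxx.
Qed.

(** A nonzero polynomial has finitely many roots, and [cis (w * t)] takes each of them at most once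
    in a period, so it cannot vanish on a set of positive measure. *)
Lemma trig_poly_eq0 (N : nat) (a : nat -> R[i]) (E : set R) :
  measurable E -> E `<=` `[0, T[%classic -> (0 < mu E)%E ->
  {ae mu, forall t, E t -> \sum_(j < N) a j * cis (w * t) ^+ j = 0} ->
  forall j, (j < N)%N -> a j = 0.
Proof.
move=> mE ET E0 aeE.
pose p := \poly_(j < N) a j.
suff p0 : p = 0.
  by move=> j jN; have := coef_poly N a j; rewrite jN -/p p0 coef0 => <-.
apply/eqP/negPn/negP => p0.
have [rs prs] := closed_field_poly_normal p.
pose A i : set R := [set t : R | 0 <= t < T /\ cis (w * t) = nth 0 rs i].
have negA i : mu.-negligible (A i).
  have [[t0 At0]|noA] := pselect (exists t, A i t).
    apply: (@negligibleS _ _ _ _ [set t0 : measurableTypeR R]).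
      have [t0T t0E] := At0.
      by move=> t [tT tE] /=; apply: cis_inj; rewrite ?in_itv//= tE t0E.
    by apply/negligibleP => //; exact: lebesgue_measure_set1.
  apply: (@negligibleS _ _ _ _ (set0 : set (measurableTypeR R))); last exact: negligible_set0.
  by move=> t At; apply: noA; exists t.
have : mu.-negligible E.
  apply: negligibleS (negligibleU aeE (negligible_bigcup negA)).
  move=> t Et; have [pt0|pt0] := eqVneq (p.[cis (w * t)]) 0; last first.
    left => /= h; move/eqP: pt0; apply.
    by rewrite horner_poly; exact: h.
  right; have : root p (cis (w * t)) by apply/rootP.
  rewrite prs rootZ ?lead_coef_eq0// root_prod_XsubC => rst.
  exists (index (cis (w * t)) rs) => //; split; first exact: ET.
  by rewrite nth_index.
by move/negligibleP => /(_ mE) h; rewrite h ltxx in E0.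
Qed.

End cis_period.

(** * Functions of finite spectrum vanishing on a periodic set *)

Section benedicks_fiber.
Context (R : realType).
Local Notation mu := (@lebesgue_measure R).
Variables (w T : R).
Hypotheses (T0 : 0 < T) (wT : w * T = pi *+ 2).

Let w0 : 0 < w.
Proof. by rewrite -(pmulr_lgt0 _ T0) wT pmulrn_lgt0// pi_gt0. Qed.

Variables (H : R -> R[i]) (K : nat) (S : set R).
Hypotheses (iH : cintegrable mu H) (mS : measurable S)
  (perS : forall t (k : int), S (t + T * k%:~R) <-> S t)
  (S0 : (0 < mu (S `&` `[0%R, T[%classic))%E)
  (HS : forall t, S t -> H t = 0)
  (HK : forall k : int, (K < `|k|)%N ->
     cintegral mu (fun t => H t * cis (k%:~R * w * t)) = 0).

Let coef (k : int) := cintegral mu (fun t => H t * cis (k%:~R * w * t)).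

(* The periodization of [H], which has only finitely many nonzero Fourier
   coefficients, hence is this trigonometric polynomial almost everywhere. *)
Let P (t : R) : R[i] :=
  (T^-1)%:C%C * \sum_(j < (2 * K).+1) coef (K%:Z - j%:Z) * cis (- (K%:Z - j%:Z)%:~R * w * t).

Let mcis (c : R) : measurable_fun setT (fun t : R => cis (c * t)).
Proof. by apply: measurable_fun_cis; exact: mulrl_measurable. Qed.

Let icis f (k : R) : cintegrable mu f -> cintegrable mu (fun t => f t * cis (k * t)).
Proof.
move=> fi; apply: (@cintegrableMl _ _ _ _ _ _ 1) => //; first exact: mcis.
by move=> t; rewrite normc_cis.
Qed.

Let mP : measurable_fun setT P.
Proof.
rewrite /P; elim: (2 * K).+1 => [|n IHn].
  by under eq_fun do rewrite big_ord0 mulr0; exact: measurable_cst.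
under eq_fun do rewrite big_ord_recr/= mulrDr.
apply: measurable_funC_D => //; apply: measurable_funC_M => //.
by apply: measurable_funC_M => //; exact: mcis.
Qed.

Let iT : cintegrable mu (fun t => (\1_`[0, T[ t)%:C%C).
Proof.
by apply: cintegrable_real; exact: integrable_indic_itv.
Qed.

Let icT (c : R) : cintegrable mu (fun t => cis (c * t) * (\1_`[0, T[ t)%:C%C).
Proof. by have := icis c iT; congr cintegrable; apply/funext => t; rewrite mulrC. Qed.

Let PE (k : int) (t : R) : P t * (\1_`[0, T[ t)%:C%C * cis (k%:~R * w * t) =
  \sum_(j < (2 * K).+1) ((T^-1)%:C%C * coef (K%:Z - j%:Z)) *
    (cis ((k - (K%:Z - j%:Z))%:~R * w * t) * (\1_`[0, T[ t)%:C%C).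
Proof.
rewrite /P -!mulrA mulr_suml mulr_sumr; apply: eq_bigr => j _.
have -> : cis ((k - (K%:Z - j%:Z))%:~R * w * t) =
    cis (k%:~R * w * t) * cis (- (K%:Z - j%:Z)%:~R * w * t) :> R[i].
  by rewrite -cisD; congr cis; rewrite intrB; ring.
by rewrite -[k%:~R * w * t]mulrA; ring.
Qed.

Let iPT : cintegrable mu (fun t => P t * (\1_`[0, T[ t)%:C%C).
Proof.
have E : (fun t => P t * (\1_`[0, T[ t)%:C%C) =
    fun t => \sum_(j < (2 * K).+1) ((T^-1)%:C%C * coef (K%:Z - j%:Z)) *
    (cis ((0 - (K%:Z - j%:Z))%:~R * w * t) * (\1_`[0, T[ t)%:C%C).
  by apply/funext => t; rewrite -PE !mul0r cis0 mulr1.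
rewrite E; apply: cintegrable_sum => j; apply: cintegrableZl.
exact: icT.
Qed.

(** Orthogonality over a period keeps only the index [j = K - k]; it is in range when [|k| <= K],
    and otherwise both sides are zero by [HK]. *)
Let cP (k : int) : cintegral mu (fun t => P t * (\1_`[0, T[ t)%:C%C * cis (k%:~R * w * t)) =
  coef k.
Proof.
under eq_fun do rewrite PE.
rewrite cintegral_sum; last first.
  move=> j; apply: cintegrableZl.
  exact: icT.
under eq_bigr => j _.
  rewrite cintegralZl; last exact: icT.
  rewrite (cintegral_cis_period T0 wT).
  over.
have [Kk|kK] := ltnP K `|k|.
  rewrite [RHS]HK//; apply: big1 => j _; rewrite ifF ?mulr0//.
  apply/negP => /eqP kE; move: Kk (ltn_ord j); have -> : k = K%:Z - j%:Z by apply/eqP; rewrite -subr_eq0 kE.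
  by lia.
have jlt : (`|K%:Z - k| < (2 * K).+1)%N by lia.
rewrite (bigD1 (Ordinal jlt))//= big1 ?addr0.
  have -> : K%:Z - `|K%:Z - k|%N%:Z = k by lia.
  rewrite subrr eqxx mulrAC -rmorphM/= mulVf ?mul1r// gt_eqF//.
move=> j /eqP jk; rewrite ifF ?mulr0//; apply/negP => /eqP kE; apply: jk.
by apply: val_inj => /=; lia.
Qed.

Let nullH' : trig_null w (fun t => H t - P t * (\1_`[0, T[ t)%:C%C).
Proof.
split; first exact: cintegrableB.
move=> k; under eq_fun do rewrite mulrBl.
by rewrite cintegralB ?cP ?subrr//; exact: icis.
Qed.

Let perP t (k : int) : P (t + T * k%:~R) = P t.
Proof.
rewrite /P; congr (_ * _); apply: eq_bigr => j _; congr (_ * _).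
rewrite -[in LHS](@cis_periodic_int _ _ ((K%:Z - j%:Z) * k)).
by congr cis; rewrite -wT intrM; ring.
Qed.

(** Tests [nullH'] on the periodic set [D] where [S] holds and [u * P] has positive real part. [H]
    vanishes there, so [u * P] integrates to 0 over [D] within one period, although its real part is
    positive: that portion of [D] is null. *)
Let ae_le0 (u : R[i]) : {ae mu, forall t, (S `&` `[0, T[) t -> complex.Re (u * P t) <= 0}.
Proof.
pose D := S `&` [set t | 0 < complex.Re (u * P t)].
have mRe : measurable_fun setT (fun t => complex.Re (u * P t)).
  by apply: measurable_fun_Re; exact: measurable_funC_M.
have mD : measurable D.
  apply: measurableI => //.
  have := emeasurable_fun_o_infty measurableT ((measurable_EFinP _ _).2 mRe) 0%E.
  by rewrite setTI.
have perD t (k : int) : D (t + T * k%:~R) <-> D t.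
  by rewrite /D/=; split=> -[/perS ? h]; split => //; move: h; rewrite perP.
have := trig_null_periodic w0 wT nullH' mD perD.
have E t : (H t - P t * (\1_`[0, T[ t)%:C%C) * (\1_D t)%:C%C =
    - (P t * (\1_`[0, T[ t)%:C%C * (\1_D t)%:C%C).
  rewrite mulrBl [X in X - _](_ : _ = 0) ?sub0r// indicE.
  have [|_] := boolP (t \in D); last by rewrite mulr0.
  by rewrite inE => -[/HS ->]; rewrite mul0r.
under eq_fun do rewrite E.
have iPD : cintegrable mu (fun t => P t * (\1_`[0, T[ t)%:C%C * (\1_D t)%:C%C).
  apply: (@cintegrableMl _ _ _ _ _ _ 1) => //.
    by apply: measurable_funC_real; exact: measurable_indic.
  by move=> t; rewrite normcR indicE; case: (_ \in _); rewrite ?normr1 ?normr0.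
rewrite cintegralN// => /eqP; rewrite oppr_eq0 => /eqP I0.
have {I0} : cintegral mu (fun t => u * (P t * (\1_`[0, T[ t)%:C%C * (\1_D t)%:C%C)) = 0.
  by rewrite cintegralZl// I0 mulr0.
move/(congr1 (@complex.Re R)) => /=.
pose q t := complex.Re (u * P t) * (\1_`[0, T[ t * \1_D t).
have qE t : complex.Re (u * (P t * (\1_`[0, T[ t)%:C%C * (\1_D t)%:C%C)) = q t.
  by rewrite -mulrA -rmorphM/= mulrA ReM/= mulr0 subr0.
under eq_Rintegral do rewrite qE.
have [iq _] := cintegrableZl u iPD.
have {}iq : mu.-integrable setT (EFin \o q).
  by move: iq; congr (_.-integrable _ _); apply/funext => t /=; rewrite qE.
have q0 t : 0 <= q t.
  rewrite /q !indicE; case: (boolP (t \in D)) => [|_]; last by rewrite !mulr0.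
  by rewrite inE => -[_ /ltW h]; rewrite !mulr_ge0.
move=> Iq0; have : ae_eq mu setT (EFin \o q) (cst 0%E).
  apply/(ae_eq_integral_abs mu measurableT (measurable_int _ iq)).
  rewrite -[RHS](congr1 EFin Iq0) /Rintegral fineK; last exact: (integrable_fin_num measurableT iq).
  by apply: eq_integral => t _ /=; rewrite ger0_norm.
apply: filterS => t /(_ I) /= [qt0] [St tT]; rewrite leNgt; apply/negP => h.
move: qt0; rewrite /q !indicE mem_set// mem_set// !mulr1 => h0.
by rewrite h0 ltxx in h.
Qed.

(** Taking [1], [-1], [i] and [-i] for [u] in [ae_le0] gives [P = 0] almost everywhere on a set of
    positive measure. As a trigonometric polynomial [P] then has zero coefficients, and these are
    the Fourier coefficients of [H]. *)
Lemma trig_null_of_finite_spectrum : trig_null w H.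
Proof.
split=> // k; have [Kk|kK] := ltnP K `|k|; first exact: HK.
have P0 : {ae mu, forall t, (S `&` `[0, T[) t -> P t = 0}.
  have a12 : {ae mu, forall t, (S `&` `[0, T[) t -> complex.Re (P t) = 0}.
    apply: ae_S2 (ae_le0 1) (ae_le0 (-1)) => t h1 h2 St.
    by move: (h1 St) (h2 St); rewrite !ReM/=; lra.
  apply: ae_S3 a12 (ae_le0 (0 +i* 1)%C) (ae_le0 (0 +i* (-1))%C) => t h12 h3 h4 St.
  move: (h12 St) (h3 St) (h4 St); move: (P t) => [x y]; rewrite !ReM/= => -> a2 a3.
  by apply: complex_eqP => //=; lra.
pose a j := coef (K%:Z - j%:Z).
have mST : measurable (S `&` `[0, T[) by exact: measurableI.
have jlt : (`|K%:Z - k| < (2 * K).+1)%N by lia.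
have -> : cintegral mu (fun t => H t * cis (k%:~R * w * t)) = a `|K%:Z - k|%N.
  by rewrite /a /coef (_ : K%:Z - `|K%:Z - k|%N%:Z = k) //; lia.
apply: (trig_poly_eq0 T0 wT mST _ S0 _ jlt); first by move=> t [].
apply: ae_S P0 => t Pt St; have := Pt St.
(* The factor [cis (K * w * t)] clears the negative frequencies and [T] the normalization, leaving
   an ordinary polynomial in [cis (w * t)] with coefficients [a j]. *)
move/(congr1 (fun z => T%:C%C * cis (K%:R * w * t) * z)); rewrite mulr0 => h.
rewrite -[RHS]h /P.
have -> : T%:C%C * cis (K%:R * w * t) * ((T^-1)%:C%C *
    \sum_(j < (2 * K).+1) coef (K%:Z - j%:Z) * cis (- (K%:Z - j%:Z)%:~R * w * t)) =
    (T%:C%C * (T^-1)%:C%C) * (cis (K%:R * w * t) *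
    \sum_(j < (2 * K).+1) coef (K%:Z - j%:Z) * cis (- (K%:Z - j%:Z)%:~R * w * t)) by ring.
have -> : T%:C%C * (T^-1)%:C%C = 1 :> R[i] by rewrite -rmorphM/= divff// gt_eqF.
rewrite mul1r mulr_sumr; apply: eq_bigr => j _.
rewrite mulrCA -cisD cis_pow; congr (_ * cis _).
by rewrite intrB -!pmulrn; ring.
Qed.

End benedicks_fiber.

(** * Folding the line onto a period *)

Definition int_enum (n : nat) : int :=
  if (n %% 2 == 0)%N then (n %/ 2)%N%:Z else - (n %/ 2).+1%:Z.

Lemma int_enum_inj : injective int_enum.
Proof. by move=> m n; rewrite /int_enum; case: eqP; case: eqP => *; lia. Qed.

(** The bound makes a property of all indices from [N] on a property of all integers [k] with
    [|k| > N]. *)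
Lemma int_enum_surj (k : int) : exists2 n, int_enum n = k & (`|k| <= n.+1)%N.
Proof.
case: k => k.
  exists (2 * k)%N; last by lia.
  by rewrite /int_enum modnMr mulKn.
exists (2 * k + 1)%N; last by lia.
rewrite /int_enum ifF; last by apply/negP => /eqP; lia.
by rewrite NegzE; lia.
Qed.

Section wrapping.
Context (R : realType).
Local Notation mu := (@lebesgue_measure R).
Variables (a T : R) (B : set R).
Hypotheses (T0 : 0 < T) (mB : measurable B).

Let shift (i : nat) : R := T * (int_enum i)%:~R.

(* The sum over [i] of the indicators counts the points of [t + T Z] in [B]. *)
Definition wrapped (i : nat) : set R :=
  `[a, a + T[%classic `&` (fun t : R => t + shift i) @^-1` B.

Lemma measurable_shift_preimage (c : R) (D : set R) : measurable D ->
  measurable ((fun t : R => t + c) @^-1` D).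
Proof.
move=> mD; rewrite -[X in measurable X]setTI.
by apply: measurable_funD.
Qed.

Lemma measurable_wrapped i : measurable (wrapped i).
Proof. by apply: measurableI => //; exact: measurable_shift_preimage. Qed.

(** Translated back by the shifts, the sets [wrapped i] become the disjoint pieces [G i] into which
    [B] is cut by consecutive periods. *)
Lemma wrapped_measure : (\sum_(0 <= i <oo) mu (wrapped i) <= mu B)%E.
Proof.
pose G i : set R := `[a + shift i, a + shift i + T[%classic `&` B.
have mG i : measurable (G i) by exact: measurableI.
have GE i : mu (wrapped i) = mu (G i).
  rewrite -(lebesgue_measure_translation (shift i) (mG i)); congr mu.
  apply/seteqP; split => x; rewrite /wrapped /G/= !in_itv/= => -[/andP[h1 h2] Bx];
    split => //; apply/andP; split; lra.
under eq_eseriesr do rewrite GE.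
have tG : trivIset setT G.
  apply/trivIsetP => i j _ _ ij; apply/seteqP; split => // x.
  rewrite /G/= !in_itv/= => -[[/andP[i1 i2] _] [/andP[j1 j2] _]].
  have : int_enum i = int_enum j; last by move/int_enum_inj/eqP; exact/negP.
  have h1 : T * (int_enum i)%:~R < T * ((int_enum j) + 1)%:~R.
    by rewrite intrD mulrDr mulr1; move: i1 j2; rewrite /shift; lra.
  have h2 : T * (int_enum j)%:~R < T * ((int_enum i) + 1)%:~R.
    by rewrite intrD mulrDr mulr1; move: j1 i2; rewrite /shift; lra.
  move: h1 h2; rewrite !ltr_pM2l// !ltr_int; lia.
have mUG : measurable (\bigcup_i G i) by exact: bigcup_measurable.
rewrite -(@measure_semi_bigcup _ _ _ mu G)//.
by apply: le_measure; rewrite ?inE// => x [i _ []].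
Qed.

End wrapping.

(** * Uniqueness for the Fourier transform and Benedicks' theorem *)

Section fourier_transform.
Context (R : realType).
Local Notation mu := (@lebesgue_measure R).
Implicit Types (f h : R -> R[i]).

Definition fourier f (x : R) : R[i] := cintegral mu (fun t => f t * cis (- (x * t))).

Lemma measurable_cis_scaled (c : R) : measurable_fun setT (fun t : R => cis (c * t)).
Proof. by apply: measurable_fun_cis; exact: mulrl_measurable. Qed.

Lemma cintegrable_cis f (c : R) : cintegrable mu f ->
  cintegrable mu (fun t => f t * cis (c * t)).
Proof.
move=> fi; apply: (@cintegrableMl _ _ _ _ _ _ 1) => //.
  exact: measurable_cis_scaled.
by move=> t; rewrite normc_cis.
Qed.

Lemma fourier_modulation f (x c : R) :
  cintegral mu (fun t => f t * cis (- x * t) * cis (c * t)) = fourier f (x - c).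
Proof.
congr cintegral; apply/funext => t; rewrite -mulrA -cisD; congr (_ * cis _); ring.
Qed.

Lemma Rintegral_indic_eq0 (F : R -> R) : mu.-integrable setT (EFin \o F) ->
  (forall A, measurable A -> \int[mu]_x (F x * \1_A x) = 0) ->
  {ae mu, forall x, F x = 0}.
Proof.
move=> iF FA.
have : ae_eq mu setT (EFin \o F) (cst 0%E).
  apply: integral_ae_eq => // E _ mE.
  rewrite integral_cst// mul0e -[LHS]fineK.
    by have := FA _ mE; rewrite RintegralM_indic_id /Rintegral => ->.
  by apply: integrable_fin_num => //; exact: integrableS iF.
by apply: ae_S => x /(_ I) [].
Qed.

Lemma cvg_scaled_sin (t : R) : n.+1%:R * sin (t / n.+1%:R) @[n --> \oo] --> t.
Proof.
have [->|t0] := eqVneq t 0.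
  by under eq_fun do rewrite mul0r sin0 mulr0; exact: cvg_cst.
have [ds dv] := is_derive_sin (0 : R).
have cv : h^-1 *: ((sin \o shift 0) (h *: 1) - sin 0) @[h --> (0 : R)^'] --> (1 : R).
  have : h^-1 *: ((sin \o shift 0) (h *: 1) - sin 0) @[h --> (0 : R)^'] --> 'D_1 (@sin R) 0 by exact: ds.
  by rewrite dv cos0.
have tn0 n : t / n.+1%:R != 0 by rewrite mulf_neq0// invr_eq0.
have tn : t / n.+1%:R @[n --> \oo] --> (0 : R)^'.
  have tc : t / n.+1%:R @[n --> \oo] --> (0 : R).
    by rewrite -[X in _ --> X](mulr0 t); apply: cvgM; [exact: cvg_cst|exact: cvg_harmonic].
  move=> A /tc tA; have {}tA : \forall n \near \oo, t / n.+1%:R != 0 -> A (t / n.+1%:R) by exact: tA.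
  suff : \forall n \near \oo, A (t / n.+1%:R) by [].
  by apply: filterS tA => n; apply; exact: tn0.
have := cvg_comp _ _ tn cv => /(cvgM (cvg_cst t)); rewrite mulr1.
apply: cvg_trans; apply: near_eq_cvg; apply: nearW => n /=.
rewrite /GRing.scale/= mulr1 addr0 sin0 subr0 invfM invrK.
by rewrite -!mulrA mulVKf.
Qed.

(* A function whose transform vanishes on the lattice [Z / T] is orthogonal to
   the functions of [sin (t / T)], and [T sin (t / T)] tends to [t]. *)
Lemma fourier_lattice_eq0 f : cintegrable mu f ->
  (forall n : nat, trig_null (n.+1%:R^-1) f) ->
  {ae mu, forall t, f t = 0}.
Proof.
move=> fi f0.
have msin c : measurable_fun setT (fun t : R => sin (c * t)).
  apply: (measurableT_comp _ (mulrl_measurable c)).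
  by apply: continuous_measurable_fun; exact: continuous_sin.
(* [q] stands for the real or the imaginary part. *)
have key (q : R[i] -> R) : (forall z (r : R), q (z * r%:C%C) = q z * r) ->
    mu.-integrable setT (EFin \o (fun t => q (f t))) ->
    (forall g, cintegral mu g = 0 -> \int[mu]_t q (g t) = 0) ->
    {ae mu, forall t, q (f t) = 0}.
  move=> qM iq q0; have mq := measurable_integrable iq.
  have qpow n j : \int[mu]_t (q (f t) * sin (n.+1%:R^-1 * t) ^+ j) = 0.
    under eq_Rintegral do rewrite -qM.
    apply: q0; have := cintegral_trig_null (trig_null_pow 0 j (f0 n)).
    by move=> <-; congr cintegral; apply/funext => t; rewrite expr0 mulr1.
  have qge n c : \int[mu]_t (q (f t) * (c <= sin (n.+1%:R^-1 * t))%R%:R) = 0.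
    apply: (@bounded_moments_ge _ _ _ _ _ _ 1) => //; first exact: msin.
    by move=> t; exact: sin_max.
  apply: Rintegral_indic_eq0 => // A mA.
  have mle (Y : R -> R) (c : R) : measurable_fun setT Y ->
      measurable_fun setT (fun t => q (f t) * (c <= Y t)%R%:R).
    move=> mY; apply: measurable_funM => //.
    have -> : (fun t => (c <= Y t)%R%:R) = (fun t => if c <= Y t then 1 else 0 : R).
      by apply/funext => t; case: ifP.
    by apply: measurable_fun_ifT => //; exact: measurable_fun_ler.
  apply: (@Rintegral_ge_indic _ _ _ mu (fun t => q (f t)) id) => //.
    have := qge 0%N (-1); move=> <-; apply: eq_Rintegral => t _.
    by rewrite sin_geN1 mulr1.
  move=> c.
  apply: (@Rintegral_dominated_eq0 _ _ _ mu
    (fun n t => q (f t) * (c / n.+1%:R <= sin (n.+1%:R^-1 * t))%R%:R) _ (fun t => `|q (f t)|)) => //.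
  - by move=> n; apply: mle; exact: msin.
  - by apply: mle; exact: measurable_id.
  - exact: integrable_norm.
  (* At [t = c] the rescaled sines may stay on the wrong side of their limit [c]; this single point
     is discarded. *)
  - have : {ae mu, forall t, t <> c}.
      apply: (@negligibleS _ _ _ _ [set c : measurableTypeR R]).
        by move=> t /= /contrapT.
      by apply/negligibleP => //; exact: lebesgue_measure_set1.
    apply: ae_S => t tc; apply: cvgM; first exact: cvg_cst.
    have cvt := @cvg_scaled_sin t.
    have E n : (c / n.+1%:R <= sin (n.+1%:R^-1 * t)) = (c <= n.+1%:R * sin (t / n.+1%:R)).
      by rewrite ler_pdivrMr// mulrC [_^-1 * t]mulrC.
    under eq_fun do rewrite E.
    apply: cvg_near_cst; have [ct|tc'] := leP c t.
      have ct' : c < t by rewrite lt_neqAle ct andbT; apply/eqP => /esym.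
      by apply: filterS (cvgr_gt _ cvt _ ct') => n /ltW ->.
    by apply: filterS (cvgr_lt _ cvt _ tc') => n; rewrite ltNge => /negbTE ->.
  - by move=> n t; rewrite normrM ler_piMr// normr_nat lern1 leq_b1.
have [fr fim] := fi.
have hr : {ae mu, forall t, complex.Re (f t) = 0}.
  apply: key => //; first by move=> z r; rewrite ReM/= mulr0 subr0.
  by move=> g /(congr1 (@complex.Re R)).
have hi : {ae mu, forall t, complex.Im (f t) = 0}.
  apply: key => //; first by move=> z r; rewrite ImM/= mulr0 add0r.
  by move=> g /(congr1 (@complex.Im R)).
by apply: (ae_S2 _ hr hi) => t hr0 hi0; apply: complex_eqP; rewrite ?hr0 ?hi0.
Qed.

Lemma ae_forall_int (P : R -> int -> Prop) :
  (forall k, {ae mu, forall x, P x k}) -> {ae mu, forall x, forall k, P x k}.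
Proof.
move=> aeP; have := @ae_foralln _ _ _ mu (fun n x => P x (int_enum n)) (fun n => aeP _).
by apply: ae_S => x Px k; have [n <- _] := int_enum_surj k; exact: Px.
Qed.

Section benedicks.
Variables (h : R -> R[i]) (L : set R).
Hypotheses (ih : cintegrable mu h)
  (hfin : (mu [set t | h t != 0%R] < +oo)%E)
  (mL : measurable L) (Lfin : (mu L < +oo)%E)
  (Lh : {ae mu, forall x, ~ L x -> fourier h x = 0}).

Let A : set R := [set t | h t != 0].

Let mA : measurable A.
Proof.
have mh := measurable_fun_normc (cintegrable_measurable ih).
have -> : A = [set t | (0 < (Normc.normc (h t))%:E)%E].
  apply/seteqP; split => t; rewrite /A/= lte_fin lt_neqAle normc_ge0 andbT [0 == _]eq_sym.
    by apply: contraNN => /eqP/Normc.eq0_normc ->.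
  by apply: contraNN => /eqP ->; rewrite Normc.normc0.
by have := emeasurable_fun_o_infty measurableT ((measurable_EFinP _ _).2 mh) 0%E; rewrite setTI.
Qed.

Let T : R := (Num.truncn (fine (mu A))).+1%:R.

Let AT : (mu A < T%:E)%E.
Proof.
rewrite -[mu A]fineK ?ge0_fin_numE// lte_fin.
exact: truncnS_gt.
Qed.

Let T0 : 0 < T. Proof. by rewrite ltr0n. Qed.

Let w : R := (pi *+ 2) / T.

Let wT : w * T = pi *+ 2. Proof. by rewrite divfK// gt_eqF. Qed.

Let w0 : 0 < w. Proof. by rewrite divr_gt0// pmulrn_lgt0// pi_gt0. Qed.

(* The orbits missing the support of [h] have positive measure since that of
   the support is smaller than the period [T]. *)
Let S : set R := [set t | forall k : int, ~ A (t + T * k%:~R)].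

Let SE : S = ~` \bigcup_i ((fun t : R => t + T * (int_enum i)%:~R) @^-1` A).
Proof.
apply/seteqP; split => t /=.
  by move=> St [i _ /= /St].
by move=> nt k Ak; apply: nt; have [i ik _] := int_enum_surj k; exists i => //=; rewrite ik.
Qed.

Let mS : measurable S.
Proof.
rewrite SE; apply: measurableC; apply: bigcup_measurable => i _.
exact: measurable_shift_preimage.
Qed.

Let perS t (k : int) : S (t + T * k%:~R) <-> S t.
Proof.
split=> St l.
  have := St (l - k); rewrite intrB.
  by rewrite (_ : t + T * k%:~R + T * (l%:~R - k%:~R) = t + T * l%:~R)//; ring.
have := St (k + l); rewrite intrD.
by rewrite (_ : t + T * k%:~R + T * l%:~R = t + T * (k%:~R + l%:~R))//; ring.
Qed.

Let Spos : (0 < mu (S `&` `[0%R, T[%classic))%E.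
Proof.
rewrite lt_neqAle measure_ge0 andbT eq_sym; apply/eqP => S0.
have := AT; rewrite ltNge => /negP; apply.
have mT : lebesgue_measure (`[0, T[%classic : set R) = T%:E.
  by rewrite lebesgue_measure_itv/= lte_fin T0 -EFinB subr0.
have mW i : measurable (wrapped 0 T A i) by exact: measurable_wrapped.
have mU : measurable (\bigcup_i wrapped 0 T A i) by exact: bigcup_measurable.
have sub : `[0, T[%classic `<=` (S `&` `[0, T[%classic) `|` \bigcup_i wrapped 0 T A i.
  move=> t tT; have [St|nSt] := pselect (S t); [by left|right].
  move: nSt; rewrite SE/= => /contrapT [i _ Ai]; exists i => //; split => //=.
  by rewrite add0r.
have mST : measurable (S `&` `[0, T[%classic) by exact: measurableI.
rewrite -mT; apply: (le_trans (le_measure mu _ _ sub)); rewrite ?inE//.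
  exact: measurableU.
apply: (le_trans (measureU2 mu mST mU)).
rewrite [X in (X + _)%E]S0 add0e.
apply: (@le_trans _ _ (\sum_(0 <= i <oo) mu (wrapped 0 T A i))%E).
  exact: (measure_sigma_subadditive mu mW mU).
exact: wrapped_measure.
Qed.

(* Borel-Cantelli, [L] being of finite measure. *)
Let ae_finite : {ae mu, forall x, exists N, forall i, (N <= i)%N ->
  ~ L (x + w * (int_enum i)%:~R)}.
Proof.
have H (j : int) : {ae mu, forall x, x \in `[w * j%:~R, w * j%:~R + w[%classic ->
    exists N, forall i, (N <= i)%N -> ~ L (x + w * (int_enum i)%:~R)}.
  have mW i : measurable (wrapped (w * j%:~R) w L i) by exact: measurable_wrapped.
  have : mu (lim_sup_set (wrapped (w * j%:~R) w L)) = 0%E.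
    apply: lim_sup_set_cvg0 => //.
    by apply: le_lt_trans Lfin; exact: wrapped_measure.
  move=> l0; exists (lim_sup_set (wrapped (w * j%:~R) w L)); split => //.
    by apply: bigcapT_measurable => n; apply: bigcup_measurable => k _; exact: mW.
  move=> x /= /not_implyP[]; rewrite inE => xj nex n _ /=.
  apply: contrapT => nW; apply: nex; exists n => i ni Lx.
  by apply: nW; exists i.
have := ae_forall_int H; apply: ae_S => x Hx.
apply: (Hx (Num.floor (x / w))); rewrite inE/= in_itv/=.
have := floor_itv (x / w); rewrite ler_pdivlMr// ltr_pdivrMr// intrD.
by move=> /andP[h1 h2]; apply/andP; split; lra.
Qed.

(** For almost every [x] only finitely many points of [x + w Z], counted by index, lie in [L]. The
    values of the transform on this lattice are the Fourier coefficients of [h] modulated by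
    [cis (- x * t)], which vanishes on [S]; all of them are therefore zero, and the one of index 0
    is [fourier h x]. *)
Let ae_fourier0 : {ae mu, forall x, fourier h x = 0}.
Proof.
have Lh' : {ae mu, forall x, forall k : int, ~ L (x + w * k%:~R) -> fourier h (x + w * k%:~R) = 0}.
  apply: ae_forall_int => k; exact: (ae_translation (w * k%:~R) Lh).
apply: (ae_S2 _ ae_finite Lh') => x [N HN] Hx.
pose H t := h t * cis (- x * t).
have iH : cintegrable mu H by exact: cintegrable_cis.
have HE (k : int) : cintegral mu (fun t => H t * cis (k%:~R * w * t)) = fourier h (x + w * (- k)%:~R).
  by rewrite fourier_modulation mulrNz; congr fourier; ring.
have HS t : S t -> H t = 0.
  move=> /(_ 0); rewrite mulr0 addr0 /A/= => /negP/negPn/eqP.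
  by rewrite /H => ->; rewrite mul0r.
have HK (k : int) : (N < `|k|)%N -> cintegral mu (fun t => H t * cis (k%:~R * w * t)) = 0.
  move=> Nk; rewrite HE; apply: Hx; have [i ik ki] := int_enum_surj (- k).
  by rewrite -ik; apply: HN; lia.
have [_ /(_ 0)] := trig_null_of_finite_spectrum T0 wT iH mS perS Spos HS HK.
by rewrite HE oppr0 mulr0 addr0.
Qed.

(** The transform being zero almost everywhere, some single [x] makes it vanish on all the lattices
    [x + Z / n.+1] at once. Modulating by [cis (- x * t)] moves [x] to 0, where
    [fourier_lattice_eq0] applies. *)
Theorem benedicks : {ae mu, forall t, h t = 0}.
Proof.
have : {ae mu, forall x, forall n (k : int), fourier h (x + n.+1%:R^-1 * k%:~R) = 0}.
  apply: (@ae_foralln _ _ _ mu (fun n x => forall k : int, fourier h (x + n.+1%:R^-1 * k%:~R) = 0)) => n.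
  apply: ae_forall_int => k; exact: (ae_translation (n.+1%:R^-1 * k%:~R) ae_fourier0).
move=> aeh; have [x Hx] : exists x : R, forall n (k : int), fourier h (x + n.+1%:R^-1 * k%:~R) = 0.
  apply: contrapT => nex; move: aeh => [D [mD D0 TD]].
  have : (mu setT <= mu D)%E.
    by apply: le_measure; rewrite ?inE// => x _; apply: TD => /= Hx; apply: nex; exists x.
  rewrite D0 leNgt => /negP; apply.
  have := lebesgue_measure_itv `[(0:R), 1[; rewrite /= lte_fin ltr01 -EFinB subr0 => m1.
  apply: (@lt_le_trans _ _ (mu (`[0%R, 1%R[%classic : set R))); first by rewrite m1.
  by apply: le_measure; rewrite ?inE.
pose H t := h t * cis (- x * t).
have iH : cintegrable mu H by exact: cintegrable_cis.
have H0 : {ae mu, forall t, H t = 0}.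
  apply: fourier_lattice_eq0 => // n; split => // k.
  rewrite fourier_modulation; have := Hx n (- k).
  by rewrite mulrNz => <-; congr fourier; ring.
apply: ae_S H0 => t /(congr1 (@Normc.normc R)).
by rewrite Normc.normcM normc_cis mulr1 Normc.normc0 => /Normc.eq0_normc.
Qed.

End benedicks.

End fourier_transform.
(** * Separating families on C^n *)

Lemma ae_forall_count d (T : measurableType d) (R : realType)
    (mu : {measure set T -> \bar R}) (K : countType) (P : K -> T -> Prop) :
  (forall k, {ae mu, forall x, P k x}) -> {ae mu, forall x, forall k, P k x}.
Proof.
move=> aeP.
have : {ae mu, forall x, forall n : nat, if @unpickle K n is Some k then P k x else True}.
  apply: (@ae_foralln _ _ _ mu (fun n x => if @unpickle K n is Some k then P k x else True)) => n.
  by case: unpickle => [k|]; [exact: aeP|exact: aeW].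
by apply: ae_S => x Hx k; have := Hx (pickle k); rewrite pickleK.
Qed.

Section separating_families.

(** The bound by 1 is what lets test functions in several variables be multiplied together. *)
Definition separating d (T : measurableType d) (R : realType)
    (mu : {measure set T -> \bar R}) (K : Type) (h : K -> T -> R) :=
  [/\ forall k, measurable_fun setT (h k), forall k x, `|h k x| <= 1 &
    forall F : T -> R, mu.-integrable setT (EFin \o F) ->
      (forall k, \int[mu]_x (F x * h k x) = 0) -> {ae mu, forall x, F x = 0}].

Section product.
Context d1 d2 (T1 : measurableType d1) (T2 : measurableType d2) (R : realType).
Variables (m1 : {sigma_finite_measure set T1 -> \bar R})
          (m2 : {sigma_finite_measure set T2 -> \bar R}).
Variables (K1 : Type) (K2 : countType) (h1 : K1 -> T1 -> R) (h2 : K2 -> T2 -> R).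

Lemma measurable_neq0 d (T : measurableType d) (F : T -> R) :
  measurable_fun setT F -> measurable [set x | F x = 0].
Proof.
move=> mF; have := measurable_fun_eqr mF (@measurable_cst _ _ _ _ setT (0 : R)).
move=> /(_ measurableT [set true]) /(_ I); rewrite setTI.
by congr measurable; apply/seteqP; split => x /=; [move/eqP|move/eqP ->].
Qed.

(** Integrating against [h2 k] in the second variable gives a function of the first one that [h1]
    kills. Countability of [K2] merges the null sets over all [k], after which [h2] separates each
    remaining section. *)
Lemma separating_prod : separating m1 h1 -> separating m2 h2 ->
  separating (m1 \x m2)%E (fun (k : K1 * K2) p => h1 k.1 p.1 * h2 k.2 p.2).
Proof.
move=> [mh1 h11 sep1] [mh2 h21 sep2]; split.
- move=> k; apply: measurable_funM.
    exact: (measurableT_comp (mh1 _) measurable_fst).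
  exact: (measurableT_comp (mh2 _) measurable_snd).
- by move=> k x; rewrite normrM mulr_ile1.
move=> F iF F0; have mF := measurable_integrable iF.
have iFh k : (m1 \x m2)%E.-integrable setT (EFin \o (fun p => F p * h2 k p.2)).
  apply: (@integrable_bounded_mul _ _ _ _ _ _ 1) => //.
  exact: (measurableT_comp (mh2 _) measurable_snd).
suff : {ae (m1 \x m2)%E, forall p, F (p.1, p.2) = 0} by apply: ae_S => -[].
apply: (@ae_prod _ _ _ _ _ m1 m2 (fun x y => F (x, y) = 0) _).2.
  rewrite (_ : [set p | _] = [set p | F p = 0]); first exact: measurable_neq0.
  by apply/seteqP; split => -[].
have aeF2 : {ae m1, forall x, forall k, \int[m2]_y (F (x, y) * h2 k y) = 0}.
  apply: ae_forall_count => k; apply: sep1.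
    exact: (integrable_Rintegral1 (iFh k)).
  move=> k1; rewrite -[RHS](F0 (k1, k)).
  have iFhh : (m1 \x m2)%E.-integrable setT (EFin \o (fun p => F p * (h1 k1 p.1 * h2 k p.2))).
    apply: (@integrable_bounded_mul _ _ _ _ _ _ 1) => //.
      apply: measurable_funM.
        exact: (measurableT_comp (mh1 _) measurable_fst).
      exact: (measurableT_comp (mh2 _) measurable_snd).
    by move=> p; rewrite normrM mulr_ile1.
  rewrite (Rintegral_fubini1 iFhh).
  have ae_h1 := ae_integrable_section1 (iFh k).
  rewrite /Rintegral; congr fine; apply: ae_eq_integral => //.
  - apply/measurable_EFinP; apply: measurable_funM => //.
    exact: (measurable_Rintegral1 (iFh k)).
  - by apply/measurable_EFinP; exact: (measurable_Rintegral1 iFhh).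
  - apply: ae_S ae_h1 => x ix _; congr EFin.
    rewrite -/(Rintegral _ _ _) mulrC -RintegralZl//.
    by apply: eq_Rintegral => y _; rewrite /=; ring.
apply: (ae_S2 _ (ae_integrable_section1 iF) aeF2) => x ix Fx0.
exact: sep2.
Qed.

End product.

(** * Transport along a measurable isomorphism *)

Section transport.
Context d1 d2 (T1 : measurableType d1) (T2 : measurableType d2) (R : realType).
Variables (m1 : {measure set T1 -> \bar R}) (m2 : {measure set T2 -> \bar R}).
Variables (f : T1 -> T2) (g : T2 -> T1).
Hypotheses (mf : measurable_fun setT f) (mg : measurable_fun setT g)
  (fK : cancel f g) (gK : cancel g f)
  (m2E : forall A, measurable A -> m2 A = m1 (f @^-1` A)).

Let preimage_f_measurable A : measurable A -> measurable (f @^-1` A).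
Proof. by move=> mA; rewrite -[X in measurable X]setTI; exact: mf. Qed.

Lemma ge0_integral_transport (F : T2 -> \bar R) : measurable_fun setT F ->
  (forall y, 0 <= F y)%E -> (\int[m2]_y F y = \int[m1]_x F (f x))%E.
Proof.
move=> mF F0; rewrite (eq_measure_integral (pushforward_measure m1 mf)).
  by rewrite ge0_integral_pushforward.
by move=> A mA _; exact: m2E.
Qed.

Lemma integrable_transport (F : T2 -> R) : measurable_fun setT F ->
  m2.-integrable setT (EFin \o F) <-> m1.-integrable setT (EFin \o (F \o f)).
Proof.
move=> mF; have mFf : measurable_fun setT (F \o f) by exact: measurableT_comp.
have E := ge0_integral_transport (F := abse \o (EFin \o F)).
have mE : measurable_fun setT (abse \o (EFin \o F)).
  by apply: measurableT_comp => //; exact/measurable_EFinP.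
have {}E := E mE (fun=> abse_ge0 _).
split => /integrableP[_ h]; apply/integrableP; split => //; try exact/measurable_EFinP.
  by move: h; rewrite [X in (X < _)%E -> _]E.
by rewrite [X in (X < _)%E]E.
Qed.

Lemma Rintegral_transport (F : T2 -> R) : m2.-integrable setT (EFin \o F) ->
  \int[m2]_y F y = \int[m1]_x F (f x).
Proof.
move=> iF; have mF := measurable_integrable iF.
rewrite /Rintegral (eq_measure_integral (pushforward_measure m1 mf)).
  rewrite integral_pushforward//; first exact: measurable_int iF.
  exact: (integrable_transport mF).1.
by move=> A mA _; exact: m2E.
Qed.

Lemma cintegrable_transport (F : T2 -> R[i]) : measurable_fun setT F ->
  cintegrable m2 F <-> cintegrable m1 (F \o f).
Proof.
move=> /measurable_fun_complexP[mr mi]; split => -[ir ii]; split.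
- exact: (integrable_transport mr).1.
- exact: (integrable_transport mi).1.
- exact: (integrable_transport mr).2.
- exact: (integrable_transport mi).2.
Qed.

Lemma cintegral_transport (F : T2 -> R[i]) : cintegrable m2 F ->
  cintegral m2 F = cintegral m1 (F \o f).
Proof.
by move=> [ir ii]; apply: complex_eqP => /=; rewrite Rintegral_transport.
Qed.

Lemma ae_transport (P : T2 -> Prop) :
  {ae m1, forall x, P (f x)} -> {ae m2, forall y, P y}.
Proof.
move=> [A [mA A0 PA]]; exists (g @^-1` A); split.
- by rewrite -[X in measurable X]setTI; exact: mg.
- rewrite m2E; last by rewrite -[X in measurable X]setTI; exact: mg.
  by rewrite -[RHS]A0; congr (m1 _); apply/seteqP; split => x /=; rewrite fK.
- by move=> y Py /=; apply: PA; rewrite /= gK.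
Qed.

Lemma separating_transport (K : Type) (h : K -> T1 -> R) :
  separating m1 h -> separating m2 (fun k y => h k (g y)).
Proof.
move=> [mh h1 sep]; split.
- by move=> k; exact: measurableT_comp.
- by move=> k y.
move=> F iF F0; have mF := measurable_integrable iF.
apply: ae_transport; apply: (sep (F \o f)); first exact: (integrable_transport mF).1.
move=> k; rewrite -[RHS](F0 k) Rintegral_transport.
  by apply: eq_Rintegral => x _; rewrite /= fK.
apply: (@integrable_bounded_mul _ _ _ _ _ _ 1) => //.
exact: measurableT_comp.
Qed.

End transport.

End separating_families.

(** * Countably many intervals determine an integrable function *)

Section separating_intervals.
Context (R : realType).
Local Notation mu := (@lebesgue_measure R).

Definition box1 := (int * nat * nat)%type.
Definition box1_itv (k : box1) : interval R :=
  `[k.1.1%:~R / k.1.2.+1%:R, k.2%:R[%R.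

(** Sending the right end to infinity gives half-lines with rational end. Sending this end to minus
    infinity gives the whole line, and letting it approach a real number gives every closed
    half-line. *)
Lemma separating_box1 : separating mu (fun (k : box1) => \1_[set` box1_itv k] : R -> R).
Proof.
have ind (A : set R) x : `|\1_A x : R| <= 1.
  by rewrite indicE; case: (_ \in _); rewrite ?normr1 ?normr0.
split=> [k|//|F iF F0]; first by apply: measurable_indic.
have mF := measurable_integrable iF.
have mle (c : R) : measurable_fun setT (fun t : R => (c <= t)%R%:R : R).
  have -> : (fun t => (c <= t)%R%:R) = (fun t => if c <= t then 1 else 0 : R).
    by apply/funext => t; case: ifP.
  by apply: measurable_fun_ifT => //; exact: measurable_fun_ler.
have le1 (b : bool) : `|b%:R : R| <= 1 by rewrite normr_nat lern1 leq_b1.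
have mdom (h : R -> R) : measurable_fun setT h -> measurable_fun setT (fun x => F x * h x).
  by move=> mh; exact: measurable_funM.
have dom (h : R -> R) x : `|h x| <= 1 -> `|F x * h x| <= `|F x|.
  by move=> h1; rewrite normrM ler_piMr.
have itvE (k : box1) x : \1_[set` box1_itv k] x = (k.1.1%:~R / k.1.2.+1%:R <= x < k.2%:R)%R%:R :> R.
  by rewrite indicE; congr ((nat_of_bool _)%:R); apply/idP/idP; rewrite inE/= in_itv.
have ray0 (l : int) (n : nat) : \int[mu]_x (F x * (l%:~R / n.+1%:R <= x)%R%:R) = 0.
  apply: (@Rintegral_dominated_eq0 _ _ _ mu
    (fun m x => F x * \1_[set` box1_itv (l, n, m)] x) _ (fun x => `|F x|)) => //.
  - by move=> m; apply: mdom; exact: measurable_indic.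
  - exact: mdom.
  - exact: integrable_norm.
  - apply: aeW => x; apply: cvgM; first exact: cvg_cst.
    apply: cvg_near_cst; exists (Num.truncn `|x|).+1 => // m /= xm.
    rewrite itvE/= (_ : x < m%:R) ?andbT//.
    rewrite (le_lt_trans (ler_norm _))// (lt_le_trans (truncnS_gt _))// ler_nat.
    by [].
  - by move=> m x; exact: dom.
apply: Rintegral_indic_eq0 => // A mA.
apply: (@Rintegral_ge_indic _ _ _ mu F id) => //.
  apply: (@Rintegral_dominated_eq0 _ _ _ mu
    (fun m x => F x * ((- m%:Z)%:~R / 1%:R <= x)%R%:R) _ (fun x => `|F x|)) => //.
  - by move=> m; exact: mdom.
  - exact: integrable_norm.
  - apply: aeW => x; rewrite -[X in _ --> X]mulr1; apply: cvgM; first exact: cvg_cst.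
    apply: cvg_near_cst; exists (Num.truncn `|x|).+1 => // m /= xm.
    rewrite divr1 mulrNz (_ : _ <= x)// lerNl ltW//.
    rewrite (le_lt_trans (ler_norm _))// normrN (lt_le_trans (truncnS_gt _))// ler_nat.
    by [].
  - by move=> m x; exact: (dom (fun x => _)).
move=> c.
(* Rational approximation of [c] from below, so that the limit of the half-lines contains [c]. *)
pose cn n : R := (Num.floor (c * n.+1%:R))%:~R / n.+1%:R.
have cnE n : c - n.+1%:R^-1 <= cn n <= c.
  have /andP[h1 h2] := floor_itv (c * n.+1%:R); rewrite /cn; apply/andP; split.
    rewrite ler_pdivlMr// mulrBl mulVf//; rewrite intrD in h2; lra.
  by rewrite ler_pdivrMr.
have cvc : cn n @[n --> \oo] --> c.
  apply: (@squeeze_cvgr _ _ _ _ (fun n => c - n.+1%:R^-1) (fun=> c)).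
  - exact: nearW.
  - by rewrite -[X in _ --> X]subr0; apply: cvgB; [exact: cvg_cst|exact: cvg_harmonic].
  - exact: cvg_cst.
apply: (@Rintegral_dominated_eq0 _ _ _ mu
  (fun n x => F x * (cn n <= x)%R%:R) _ (fun x => `|F x|)) => //.
- by move=> n; exact: mdom.
- exact: mdom.
- exact: integrable_norm.
- apply: aeW => x; apply: cvgM; first exact: cvg_cst.
  have [cx|xc] := leP c x.
    apply: cvg_near_cst; apply: nearW => n.
    by have /andP[_ h] := cnE n; rewrite (le_trans h cx).
  by apply: cvg_near_cst; apply: filterS (cvgr_gt _ cvc _ xc) => n; rewrite ltNge => /negbTE ->.
- by move=> m x; exact: (dom (fun x => _)).
- by move=> n; exact: ray0.
Qed.

End separating_intervals.

(** * Boxes and product measures on [C^n] *)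

Section complex_tuples.
Context (R : realType).

Lemma complex_of_partsK' : cancel (@complex_of_parts R) (@complex_parts R).
Proof. by case. Qed.

Lemma complex_partsK : cancel (@complex_parts R) (@complex_of_parts R).
Proof. by case. Qed.

Lemma lebesgue_C_pushforward (A : set R[i]) : measurable A ->
  @lebesgue_C R A = (@lebesgue_measure R \x @lebesgue_measure R)%E ((@complex_of_parts R) @^-1` A).
Proof. by []. Qed.

Definition boxC := (box1 * box1)%type.
Definition boxC_indic (k : boxC) (z : R[i]) : R :=
  \1_[set` box1_itv R k.1] (complex.Re z) * \1_[set` box1_itv R k.2] (complex.Im z).

Lemma separating_boxC : separating (@lebesgue_C R) boxC_indic.
Proof.
have := separating_prod (separating_box1 R) (separating_box1 R).
by move=> /(separating_transport (@measurable_complex_of_parts R)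
  (@measurable_complex_parts R) complex_of_partsK' complex_partsK lebesgue_C_pushforward).
Qed.

Lemma tuple_unconsS d (T : measurableType d) n (s : n.+1.-tuple T) (j : 'I_n) :
  tnth (tuple_uncons s).2 j = tnth s (lift ord0 j).
Proof. by rewrite tnth_behead; congr tnth; apply: val_inj; rewrite /= inordK// ltnS. Qed.

Lemma tuple_unconsK d (T : measurableType d) n :
  cancel (@tuple_uncons _ T n) (@tuple_cons _ T n).
Proof. by move=> s; apply: val_inj => /=; case/tupleP: s => x t. Qed.

Section tuple_measure_succ.
Context d (T : measurableType d) (mu : {sigma_finite_measure set T -> \bar R}) (n : nat).

Lemma tuple_measureS (A : set (n.+1.-tuple T)) : measurable A ->
  tuple_measure mu n.+1 A = (mu \x tuple_measure mu n)%E ((@tuple_cons _ _ n) @^-1` A).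
Proof. by []. Qed.

Lemma cintegrable_tupleS (F : n.+1.-tuple T -> R[i]) : measurable_fun setT F ->
  cintegrable (tuple_measure mu n.+1) F <->
  cintegrable (mu \x tuple_measure mu n)%E (fun p => F (tuple_cons p)).
Proof.
exact: (cintegrable_transport (@measurable_tuple_cons _ T n) tuple_measureS).
Qed.

Lemma cintegral_tupleS (F : n.+1.-tuple T -> R[i]) :
  cintegrable (tuple_measure mu n.+1) F ->
  cintegral (tuple_measure mu n.+1) F =
  cintegral (mu \x tuple_measure mu n)%E (fun p => F (tuple_cons p)).
Proof.
exact: (cintegral_transport (@measurable_tuple_cons _ T n) tuple_measureS).
Qed.

Lemma ae_tupleS (P : n.+1.-tuple T -> Prop) :
  {ae (mu \x tuple_measure mu n)%E, forall p, P (tuple_cons p)} ->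
  {ae (tuple_measure mu n.+1), forall s, P s}.
Proof.
exact: (ae_transport (@measurable_tuple_uncons _ T n) (@tuple_consK _ T n)
  (@tuple_unconsK _ T n) tuple_measureS).
Qed.

End tuple_measure_succ.

Lemma tnth_tuple_consS d (T : measurableType d) n (p : T * n.-tuple T) (j : 'I_n) :
  tnth (tuple_cons p) (lift ord0 j) = tnth p.2 j.
Proof. by rewrite -tuple_unconsS tuple_consK. Qed.

Section tuple_products.
Context d (T : measurableType d) (mu : {sigma_finite_measure set T -> \bar R}).

Lemma measurable_prod_tnth n (g : 'I_n -> T -> R[i]) :
  (forall j, measurable_fun setT (g j)) ->
  measurable_fun setT (fun s : n.-tuple T => \prod_(j < n) g j (tnth s j)).
Proof.
move=> mg.
suff H (r : seq 'I_n) : measurable_fun setT (fun s : n.-tuple T => \prod_(j <- r) g j (tnth s j)).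
  exact: H.
elim: r => [|j r IHr]; first by under eq_fun do rewrite big_nil; exact: measurable_cst.
under eq_fun do rewrite big_cons; apply: measurable_funC_M => //.
exact: (measurableT_comp (mg j) (measurable_tnth j)).
Qed.

(** Fubini by induction on the length, starting from the Dirac mass at the empty tuple, whose total
    mass is 1. *)
Lemma tuple_prod n (g : 'I_n -> T -> R[i]) : (forall j, cintegrable mu (g j)) ->
  cintegrable (tuple_measure mu n) (fun s => \prod_(j < n) g j (tnth s j)) /\
  cintegral (tuple_measure mu n) (fun s => \prod_(j < n) g j (tnth s j)) =
    \prod_(j < n) cintegral mu (g j).
Proof.
elim: n g => [|n IHn] g ig.
  have E : (fun s : 0.-tuple T => \prod_(j < 0) g j (tnth s j)) = cst 1.
    by apply/funext => s; rewrite big_ord0.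
  have f0 : (tuple_measure mu 0 setT < +oo)%E.
    by rewrite /= diracT ltry.
  split.
    rewrite E; split => /=.
      apply: measurable_bounded_integrable => //.
      by exists 1; split => // M M1 x _; rewrite /= normr1 ltW.
    apply: measurable_bounded_integrable => //.
    by exists 1; split => // M M1 x _; rewrite /= normr0 (le_trans _ (ltW M1)).
  rewrite big_ord0 E; apply: complex_eqP => /=.
    have := Rintegral_cst (tuple_measure mu 0) (@measurableT _ (0.-tuple T)) 1.
    have h1 : tuple_measure mu 0 [set: 0.-tuple T] = 1%E by exact: diracT.
    by move=> E1; apply: (etrans E1); rewrite mul1r; exact: (congr1 fine h1).
  have := Rintegral_cst (tuple_measure mu 0) (@measurableT _ (0.-tuple T)) 0.
  by rewrite /= => ->; rewrite mul0r.
have [iS eS] := IHn (fun j => g (lift ord0 j)) (fun j => ig _).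
have E : (fun p => \prod_(j < n.+1) g j (tnth (tuple_cons p) j)) =
    (fun p : T * n.-tuple T => g ord0 p.1 * \prod_(j < n) g (lift ord0 j) (tnth p.2 j)).
  apply/funext => p; rewrite big_ord_recl; congr (_ * _).
  by apply: eq_bigr => j _; rewrite tnth_tuple_consS.
have mg : measurable_fun setT (fun s : n.+1.-tuple T => \prod_(j < n.+1) g j (tnth s j)).
  by apply: measurable_prod_tnth => j; exact: cintegrable_measurable.
have iSS : cintegrable (tuple_measure mu n.+1) (fun s => \prod_(j < n.+1) g j (tnth s j)).
  apply/(cintegrable_tupleS _ mg); rewrite E.
  exact: (cintegrable_prodM (ig ord0) iS).
split => //; rewrite cintegral_tupleS// E.
rewrite (cintegral_prodM (ig ord0) iS) eS.
by rewrite big_ord_recl.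
Qed.

Lemma ae_tuple n (P : 'I_n -> T -> Prop) : (forall j, measurable [set x | P j x]) ->
  (forall j, {ae mu, forall x, P j x}) ->
  {ae (tuple_measure mu n), forall s, forall j, P j (tnth s j)}.
Proof.
elim: n P => [|n IHn] P mP aeP; first by apply: aeW => s [].
apply: ae_tupleS.
pose Q (x : T) (s : n.-tuple T) := P ord0 x /\ forall j, P (lift ord0 j) (tnth s j).
have mQ : measurable [set p | Q p.1 p.2].
  rewrite (_ : [set p | _] = [set x | P ord0 x] `*`
      \bigcap_(j : 'I_n) ((fun s : n.-tuple T => tnth s j) @^-1` [set x | P (lift ord0 j) x])).
    apply: measurableX => //; apply: fin_bigcap_measurable => // j _.
    by rewrite -[X in measurable X]setTI; exact: measurable_tnth.
  apply/seteqP; split => -[x s] /= [h1 h2]; split => //= j; last exact: h2.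
  by move=> _; exact: h2.
suff : {ae (mu \x tuple_measure mu n)%E, forall p, Q p.1 p.2}.
  apply: ae_S => p [h0 hS] j; case: (unliftP ord0 j) => [k ->|->//].
  by rewrite tnth_tuple_consS.
apply/(ae_prod mu (tuple_measure mu n) mQ).
apply: (ae_S _ (aeP ord0)) => x Px.
by apply: (ae_S _ (IHn _ (fun j => mP _) (fun j => aeP _))).
Qed.

(** Induction with [separating_prod], to which [K] countable supplies countable index sets; on the
    one-point space of empty tuples the constant 1 separates. *)
Lemma separating_tuple (K : countType) (h : K -> T -> R) n : separating mu h ->
  separating (tuple_measure mu n)
    (fun (k : n.-tuple K) s => \prod_(j < n) h (tnth k j) (tnth s j)).
Proof.
move=> sh; elim: n => [|n IHn].
  split.
  - by move=> k; under eq_fun do rewrite big_ord0; exact: measurable_cst.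
  - by move=> k x; rewrite big_ord0 normr1.
  move=> F iF F0; have := F0 [tuple].
  under eq_Rintegral do rewrite big_ord0 mulr1.
  have mF := measurable_integrable iF.
  rewrite /Rintegral /= integral_dirac//; last exact/measurable_EFinP.
  rewrite diracT mul1e/= => h0; apply: aeW => x; rewrite -[RHS]h0.
  by congr F; exact: tuple0.
have := separating_transport (@measurable_tuple_cons _ T n) (@measurable_tuple_uncons _ T n)
  (@tuple_consK _ T n) (@tuple_unconsK _ T n) (@tuple_measureS _ _ mu n) (separating_prod sh IHn).
move=> [m1 l1 sep].
have E (k : n.+1.-tuple K) (s : n.+1.-tuple T) :
    \prod_(j < n.+1) h (tnth k j) (tnth s j) =
    h (thead k) (tuple_uncons s).1 *
    \prod_(j < n) h (tnth [tuple of behead k] j) (tnth (tuple_uncons s).2 j).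
  rewrite big_ord_recl; congr (_ * _); apply: eq_bigr => j _.
  rewrite tuple_unconsS tnth_behead; congr (h (tnth _ _) _).
  by apply: val_inj; rewrite /= inordK// ltnS.
split.
- by move=> k; under eq_fun do rewrite E; exact: (m1 (thead k, [tuple of behead k])).
- by move=> k x; rewrite E; exact: (l1 (thead k, [tuple of behead k])).
move=> F iF F0; apply: sep => // -[k ks].
rewrite -[RHS](F0 [tuple of k :: ks]); apply: eq_Rintegral => s _.
by rewrite E theadE (_ : [tuple of behead [tuple of k :: ks]] = ks)//; exact: val_inj.
Qed.

End tuple_products.

End complex_tuples.
(** * Completeness of the twisted Laguerre functions *)

Section parametric_measurability.
Context d1 d2 (T1 : measurableType d1) (T2 : measurableType d2) (R : realType).
Variable m2 : {sigma_finite_measure set T2 -> \bar R}.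

(** Integrable sections or not, Tonelli applies to the positive and negative parts, and the extended
    difference and [fine] are measurable together with their default values. *)
Lemma measurable_param_Rintegral (h : T1 * T2 -> R) : measurable_fun setT h ->
  measurable_fun setT (fun x => \int[m2]_y h (x, y)).
Proof.
move=> mh; apply: (measurableT_comp (@fine_measurable R setT measurableT)).
have mE : measurable_fun setT (EFin \o h) by exact/measurable_EFinP.
rewrite (_ : (fun x => _) = (fubini_F m2 (EFin \o h)^\+ \- fubini_F m2 (EFin \o h)^\-)%E).
  apply: emeasurable_funB.
    by apply: measurable_fun_fubini_tonelli_F => //; exact: measurable_funepos.
  by apply: measurable_fun_fubini_tonelli_F => //; exact: measurable_funeneg.
by apply/funext => x; rewrite [LHS]integralE /fubini_F; congr (_ - _)%E; apply: eq_integral => y _;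
  rewrite ?funeposE ?funenegE.
Qed.

Lemma measurable_param_cintegral (h : T1 * T2 -> R[i]) : measurable_fun setT h ->
  measurable_fun setT (fun x => cintegral m2 (fun y => h (x, y))).
Proof.
move=> /measurable_fun_complexP[hr hi]; apply/measurable_fun_complexP.
by split; [exact: (measurable_param_Rintegral hr)|exact: (measurable_param_Rintegral hi)].
Qed.

End parametric_measurability.

(** * Gaussian approximate identities carrying a phase *)

Section gaussian_smoothing.
Context (R : realType).
Local Notation mu := (@lebesgue_measure R).

Lemma cintegrable_affine (s c : R) (f : R -> R[i]) : 0 < s -> cintegrable mu f ->
  cintegrable mu (fun y => f (s * y + c)).
Proof. by move=> s0 [fr fi]; split; [exact: (integrable_affine c s0 fr)|exact: (integrable_affine c s0 fi)]. Qed.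

Lemma cintegral_affine (s c : R) (f : R -> R[i]) : 0 < s -> cintegrable mu f ->
  cintegral mu f = s%:C%C * cintegral mu (fun y => f (s * y + c)).
Proof.
move=> s0 [fr fi]; apply: complex_eqP; rewrite ?ReM ?ImM/= mul0r ?subr0 ?addr0.
  exact: (Rintegral_affine c s0 fr).
exact: (Rintegral_affine c s0 fi).
Qed.

Definition gauss (y : R) : R := (Num.sqrt pi)^-1 * gauss_fun y.

Let sqrtpi_gt0 : 0 < Num.sqrt (pi : R).
Proof. by rewrite sqrtr_gt0 pi_gt0. Qed.

Lemma gauss_ge0 y : 0 <= gauss y.
Proof. by rewrite /gauss mulr_ge0// ?invr_ge0 ?(ltW sqrtpi_gt0)// gauss_fun_ge0. Qed.

Lemma measurable_gauss : measurable_fun setT gauss.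
Proof. by apply: measurable_funM => //; exact: measurable_gauss_fun. Qed.

Lemma integrable_gauss : mu.-integrable setT (EFin \o gauss).
Proof.
have := integrableZl measurableT (Num.sqrt (pi : R))^-1 (@integrableT_gauss R).
exact: eq_integrable.
Qed.

Lemma Rintegral_gauss : \int[mu]_y gauss y = 1.
Proof.
rewrite (RintegralZl _ measurableT (@integrableT_gauss R)).
by rewrite /Rintegral integralT_gauss/= mulVf// gt_eqF.
Qed.

Lemma gauss_le y : gauss y <= (Num.sqrt pi)^-1.
Proof. by rewrite /gauss ler_piMr ?invr_ge0 ?(ltW sqrtpi_gt0)// gauss_fun_le1. Qed.

Section smoothing.
Variables (t a b : R).

(** One real coordinate of a twisted Gaussian: a Gaussian of mass 1 that concentrates at [x] as [s]
    grows, times a phase of frequency [t]. *)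
Definition smooth_kernel (s x u : R) : R[i] := cis (t * u) * (s * gauss (s * (u - x)))%:C%C.

Definition smooth (s x : R) : R[i] :=
  cintegral mu (fun u => smooth_kernel s x u * (\1_`[a, b[ u)%:C%C).

Lemma indic_le1 T (A : set T) x : `|\1_A x : R| <= 1.
Proof. by rewrite indicE; case: (_ \in _); rewrite ?normr1 ?normr0. Qed.

Lemma measurable_gauss_scaled (s x : R) : measurable_fun setT (fun u : R => gauss (s * (u - x))).
Proof.
apply: (measurableT_comp measurable_gauss); apply: measurable_funM => //.
exact: measurable_funB.
Qed.

Lemma measurable_smooth_kernel s x : measurable_fun setT (smooth_kernel s x).
Proof.
apply: measurable_funC_M; first exact: measurable_cis_scaled.
by apply: measurable_funC_real; apply: measurable_funM => //; exact: measurable_gauss_scaled.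
Qed.

Lemma normc_smooth_kernel s x u : 0 < s ->
  Normc.normc (smooth_kernel s x u) = s * gauss (s * (u - x)).
Proof.
by move=> s0; rewrite Normc.normcM normc_cis mul1r normcR ger0_norm// mulr_ge0 ?gauss_ge0// ltW.
Qed.

Lemma cintegrable_smooth_kernel s x : 0 < s ->
  cintegrable mu (fun u => smooth_kernel s x u * (\1_`[a, b[ u)%:C%C).
Proof.
move=> s0.
have ig : mu.-integrable setT (EFin \o (fun u => s * gauss (s * (u - x)))).
  have := integrableZl measurableT s (integrable_affine (- (s * x)) s0 integrable_gauss).
  by apply: eq_integrable => // u _; rewrite /= mulrBr.
apply: (@cintegrableMl _ _ _ _ _ _ 1).
- apply: (cintegrable_dominated _ ig); first exact: measurable_smooth_kernel.
  by move=> u; rewrite normc_smooth_kernel.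
- by apply: measurable_funC_real; exact: measurable_indic.
- by move=> u; rewrite normcR indic_le1.
Qed.

(** The integrand of [smooth] after the substitution [u = s^-1 * y + x], which makes [gauss] a bound
    common to all [s]. *)
Let body s x y : R[i] := cis (t * (s^-1 * y + x)) * (gauss y)%:C%C * (\1_`[a, b[ (s^-1 * y + x))%:C%C.

Let smoothE s x : 0 < s -> smooth s x = cintegral mu (body s x).
Proof.
move=> s0; have s1 : 0 < s^-1 by rewrite invr_gt0.
have i1 := cintegrable_smooth_kernel x s0.
rewrite /smooth (cintegral_affine x s1 i1) -cintegralZl; last exact: (cintegrable_affine x s1 i1).
congr cintegral; apply/funext => y; rewrite /smooth_kernel /body addrK mulVKf ?gt_eqF//.
rewrite rmorphM/=.
have -> : (s^-1)%:C%C * (cis (t * (s^-1 * y + x)) * (s%:C%C * (gauss y)%:C%C) * (\1_`[a, b[ (s^-1 * y + x))%:C%C) =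
  ((s^-1)%:C%C * s%:C%C) * (cis (t * (s^-1 * y + x)) * (gauss y)%:C%C * (\1_`[a, b[ (s^-1 * y + x))%:C%C) :> R[i].
  by ring.
by rewrite -rmorphM/= mulVf ?mul1r// gt_eqF.
Qed.

Let measurable_body s x : measurable_fun setT (body s x).
Proof.
have ma : measurable_fun setT (fun y : R => s^-1 * y + x).
  by apply: measurable_funD => //; exact: mulrl_measurable.
apply: measurable_funC_M; last first.
  apply: measurable_funC_real; apply: (measurableT_comp _ ma); exact: measurable_indic.
apply: measurable_funC_M; last by apply: measurable_funC_real; exact: measurable_gauss.
by apply: measurable_fun_cis; exact: measurable_funM.
Qed.

Let body_le s x y : Normc.normc (body s x y) <= gauss y.
Proof.
rewrite !Normc.normcM normc_cis mul1r !normcR (ger0_norm (gauss_ge0 _)).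
by rewrite ler_piMr ?gauss_ge0// indic_le1.
Qed.

Lemma normc_smooth s x : 0 < s -> Normc.normc (smooth s x) <= 1.
Proof.
move=> s0; rewrite smoothE// -Rintegral_gauss.
have ib : cintegrable mu (body s x).
  apply: (cintegrable_dominated _ integrable_gauss (body_le s x)).
  exact: measurable_body.
apply: (le_trans (normc_cintegral ib)); apply: le_Rintegral => //.
- exact: cintegrable_normc.
- exact: integrable_gauss.
Qed.

(** At an end of the interval only half of the mass falls inside, so [a] and [b] are excluded. *)
Lemma ccvg_smooth (s : nat -> R) x : (forall n, 0 < s n) ->
  (s n)^-1 @[n --> \oo] --> (0 : R) -> x != a -> x != b ->
  ccvg (fun n => smooth (s n) x) (cis (t * x) * (\1_`[a, b[ x)%:C%C).
Proof.
move=> s0 sc xa xb.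
have -> : cis (t * x) * (\1_`[a, b[ x)%:C%C =
    cintegral mu (fun y => cis (t * x) * (\1_`[a, b[ x)%:C%C * (gauss y)%:C%C).
  rewrite cintegralZl; last by apply: cintegrable_real; exact: integrable_gauss.
  by rewrite cintegral_real Rintegral_gauss mulr1.
under eq_fun do rewrite smoothE//.
apply: (@cintegral_dominated _ _ _ mu (fun n => body (s n) x) _ gauss) => //.
- by move=> n; exact: measurable_body.
- apply: measurable_funC_M; first exact: measurable_cst.
  by apply: measurable_funC_real; exact: measurable_gauss.
- exact: integrable_gauss.
- apply: aeW => y.
  have cvx : (s n)^-1 * y + x @[n --> \oo] --> x.
    rewrite -[X in _ --> X]add0r; apply: cvgD; last exact: cvg_cst.
    by rewrite -(mul0r y); apply: cvgM => //; exact: cvg_cst.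
  have cvt : t * ((s n)^-1 * y + x) @[n --> \oo] --> t * x.
    by apply: cvgM => //; exact: cvg_cst.
  rewrite mulrAC; apply: ccvgM.
    apply: ccvgM; last exact: ccvg_cst.
    split; rewrite /cis/=.
      exact: (cvg_comp _ _ cvt (@continuous_cos R _)).
    exact: (cvg_comp _ _ cvt (@continuous_sin R _)).
  have ev : \forall n \near \oo, \1_`[a, b[ ((s n)^-1 * y + x) = \1_`[a, b[ x :> R.
    have E u : \1_`[a, b[ u = (a <= u < b)%R%:R :> R.
      by rewrite indicE; congr ((nat_of_bool _)%:R); apply/idP/idP; rewrite inE/= in_itv.
    have [ax|ax] := leP a x; last first.
      apply: filterS (cvgr_lt _ cvx _ ax) => n h.
      by rewrite !E !leNgt h ax.
    have ax' : a < x by rewrite lt_neqAle eq_sym xa.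
    have [xb'|xb'] := ltP x b.
      apply: filterS2 (cvgr_gt _ cvx _ ax') (cvgr_lt _ cvx _ xb') => n h1 h2.
      by rewrite !E (ltW h1) h2 ax xb'.
    have bx : b < x by rewrite lt_neqAle eq_sym xb.
    apply: filterS (cvgr_gt _ cvx _ bx) => n h.
    by rewrite !E !ltNge (ltW h) xb'/= !andbF.
  split => /=; last exact: cvg_cst.
  by apply: cvg_near_cst.
Qed.

End smoothing.

End gaussian_smoothing.

(** * Twisted Gaussians as an approximate identity *)

Section twisted_gauss.
Context (R : realType).
Variables (n : nat) (l : R).
Local Notation mun := (@lebesgue_Cn R n).

(** The kernel, in one complex variable, of twisted convolution with a Gaussian. *)
Definition twisted_gauss (s : R) (z w : R[i]) : R[i] :=
  cis (- (l / 2) * complex.Im (z * conjc w)) *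
  (expR (- (s ^+ 2 * Normc.normc (w - z) ^+ 2)))%:C%C.

Let kappa (s : R) (z w : R[i]) : R[i] :=
  smooth_kernel (- (l / 2) * complex.Im z) s (complex.Re z) (complex.Re w) *
  smooth_kernel (l / 2 * complex.Re z) s (complex.Im z) (complex.Im w).

(* The kernel splits over the real coordinates of [w]. *)
Let kappaE s z w : kappa s z w = (s ^+ 2 / pi)%:C%C * twisted_gauss s z w.
Proof.
case: z w => x y [u v]; rewrite /kappa /smooth_kernel /twisted_gauss /gauss /gauss_fun /=.
have -> : cis (- (l / 2) * (x * - v + y * u)) =
    cis (- (l / 2) * y * u) * cis (l / 2 * x * v) :> R[i].
  by rewrite -cisD; congr cis; ring.
rewrite sqr_sqrtr; last by rewrite addr_ge0// sqr_ge0.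
have -> : expR (- (s ^+ 2 * ((u - x) ^+ 2 + (v - y) ^+ 2))) =
    expR (- (s * (u - x)) ^+ 2) * expR (- (s * (v - y)) ^+ 2).
  by rewrite -expRD; congr expR; ring.
have -> : s ^+ 2 / pi = (s * (Num.sqrt pi)^-1) * (s * (Num.sqrt pi)^-1).
  by rewrite -!expr2 exprMn exprVn sqr_sqrtr// pi_ge0.
by rewrite !rmorphM/=; ring.
Qed.

Let smooth_box (s : R) (k : boxC) (z : R[i]) : R[i] :=
  smooth (- (l / 2) * complex.Im z) (k.1.1.1%:~R / k.1.1.2.+1%:R) k.1.2%:R s (complex.Re z) *
  smooth (l / 2 * complex.Re z) (k.2.1.1%:~R / k.2.1.2.+1%:R) k.2.2%:R s (complex.Im z).

Let kappa_box s (k : boxC) z w := kappa s z w * (boxC_indic k w)%:C%C.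

Let measurable_cplx1 : measurable_fun setT (fun p : R[i] * R[i] => complex.Re p.1).
Proof. exact: (measurableT_comp (@measurable_Re R) measurable_fst). Qed.
Let measurable_cplx2 : measurable_fun setT (fun p : R[i] * R[i] => complex.Im p.1).
Proof. exact: (measurableT_comp (@measurable_Im R) measurable_fst). Qed.
Let measurable_cplx3 : measurable_fun setT (fun p : R[i] * R[i] => complex.Re p.2).
Proof. exact: (measurableT_comp (@measurable_Re R) measurable_snd). Qed.
Let measurable_cplx4 : measurable_fun setT (fun p : R[i] * R[i] => complex.Im p.2).
Proof. exact: (measurableT_comp (@measurable_Im R) measurable_snd). Qed.

Lemma measurable_smooth_kernel_comp d (T : measurableType d) (t x u : T -> R) (s : R) :
  measurable_fun setT t -> measurable_fun setT x -> measurable_fun setT u ->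
  measurable_fun setT (fun p => smooth_kernel (t p) s (x p) (u p)).
Proof.
move=> mt mx mu; apply: measurable_funC_M.
  by apply: measurable_fun_cis; exact: measurable_funM.
apply: measurable_funC_real; apply: measurable_funM => //.
apply: (measurableT_comp (@measurable_gauss R)); apply: measurable_funM => //.
exact: measurable_funB.
Qed.

Let measurable_kappa s : measurable_fun setT (fun p => kappa s p.1 p.2).
Proof.
apply: measurable_funC_M; apply: measurable_smooth_kernel_comp => //.
  by apply: measurable_funM.
by apply: measurable_funM.
Qed.

Let kappa_le s z w : 0 < s -> Normc.normc (kappa s z w) <= s ^+ 2 / pi.
Proof.
move=> s0; rewrite Normc.normcM !normc_smooth_kernel//.
rewrite -[X in _ <= _ / X](@sqr_sqrtr R) ?pi_ge0// -exprVn -exprMn expr2.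
have h y : s * gauss y <= s / Num.sqrt pi by rewrite ler_wpM2l ?(ltW s0)// gauss_le.
by apply: ler_pM => //; rewrite mulr_ge0 ?gauss_ge0// ltW.
Qed.

Lemma measurable_boxC_indic k : measurable_fun setT (@boxC_indic R k).
Proof. by have [mk _ _] := separating_boxC R; exact: mk. Qed.

Lemma cintegrable_boxC_indic k : cintegrable (@lebesgue_C R) (fun w => (boxC_indic k w)%:C%C).
Proof.
apply: cintegrable_real.
apply/(integrable_transport (@measurable_complex_of_parts R) (@lebesgue_C_pushforward R)).
  exact: measurable_boxC_indic.
exact: (integrable_prodM (@integrable_indic_itv R _ _ _ _) (@integrable_indic_itv R _ _ _ _)).
Qed.

Let cintegral_kappa_box s k z : 0 < s ->
  cintegrable (@lebesgue_C R) (kappa_box s k z) /\ cintegral (@lebesgue_C R) (kappa_box s k z) = smooth_box s k z.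
Proof.
move=> s0.
have mk : measurable_fun setT (kappa_box s k z).
  apply: measurable_funC_M; last by apply: measurable_funC_real; exact: measurable_boxC_indic.
  exact: (measurableT_comp (measurable_kappa s) (measurable_pair1 z)).
have ik : cintegrable (@lebesgue_C R) (kappa_box s k z).
  under [X in cintegrable _ X]funext do rewrite /kappa_box mulrC.
  apply: (@cintegrableMl _ _ _ _ _ _ (s ^+ 2 / pi)).
  - exact: cintegrable_boxC_indic.
  - exact: (measurableT_comp (measurable_kappa s) (measurable_pair1 z)).
  - by move=> w; exact: kappa_le.
split => //.
rewrite (cintegral_transport (@measurable_complex_of_parts R) (@lebesgue_C_pushforward R) ik).
rewrite /smooth_box /smooth -cintegral_prodM; last 2 first.
  exact: cintegrable_smooth_kernel.
  exact: cintegrable_smooth_kernel.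
congr cintegral; apply/funext => -[u v].
by rewrite /= /kappa_box /kappa /boxC_indic /= rmorphM/=; ring.
Qed.

Let normc_smooth_box s k z : 0 < s -> Normc.normc (smooth_box s k z) <= 1.
Proof.
by move=> s0; rewrite Normc.normcM mulr_ile1 ?normc_ge0// normc_smooth.
Qed.

Lemma normc_prod (r : seq 'I_n) (f : 'I_n -> R[i]) :
  Normc.normc (\prod_(j <- r) f j) = \prod_(j <- r) Normc.normc (f j).
Proof.
by elim: r => [|j r IHr]; rewrite ?big_nil ?Normc.normc1// !big_cons Normc.normcM IHr.
Qed.

Lemma normc_twisted_gauss s z w : Normc.normc (twisted_gauss s z w) <= 1.
Proof.
rewrite Normc.normcM normc_cis mul1r normcR ger0_norm ?expR_ge0// -expR0 ler_expR.
by rewrite oppr_le0 mulr_ge0 ?sqr_ge0.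
Qed.

Lemma measurable_twisted_gauss s : measurable_fun setT (fun p => twisted_gauss s p.1 p.2).
Proof.
apply: measurable_funC_M.
  apply: measurable_fun_cis; apply: measurable_funM => //.
  apply: (measurableT_comp (@measurable_Im R)); apply: measurable_funC_M => //.
  exact: measurable_fun_conjc.
apply: measurable_funC_real; apply: (measurableT_comp (@measurable_expR R)).
apply: (measurableT_comp (@oppr_measurable R setT)); apply: measurable_funM => //.
apply: measurable_funX; apply: measurable_fun_normc; exact: measurable_funC_B.
Qed.

Let measurable_smooth_box s k : 0 < s -> measurable_fun setT (smooth_box s k).
Proof.
move=> s0.
rewrite (_ : smooth_box s k = fun z => cintegral (@lebesgue_C R) (kappa_box s k z)); last first.
  by apply/funext => z; rewrite (cintegral_kappa_box k z s0).2.
apply: (@measurable_param_cintegral _ _ _ _ _ _ (fun p => kappa_box s k p.1 p.2)).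
apply: measurable_funC_M; first exact: measurable_kappa.
apply: measurable_funC_real; exact: (measurableT_comp (measurable_boxC_indic k) measurable_snd).
Qed.

Let good (k : boxC) (z : R[i]) : Prop :=
  [/\ complex.Re z != k.1.1.1%:~R / k.1.1.2.+1%:R, complex.Re z != k.1.2%:R,
      complex.Im z != k.2.1.1%:~R / k.2.1.2.+1%:R & complex.Im z != k.2.2%:R].

Let ccvg_smooth_box (s : nat -> R) k z : (forall n, 0 < s n) ->
  (s n)^-1 @[n --> \oo] --> (0 : R) -> good k z ->
  ccvg (fun n => smooth_box (s n) k z) (boxC_indic k z)%:C%C.
Proof.
move=> s0 sc [r1 r2 i1 i2].
have := ccvgM (ccvg_smooth (- (l / 2) * complex.Im z) s0 sc r1 r2)
  (ccvg_smooth (l / 2 * complex.Re z) s0 sc i1 i2).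
congr ccvg; rewrite /boxC_indic rmorphM/= mulrACA -cisD.
rewrite (_ : _ + _ = 0) ?cis0 ?mul1r//; ring.
Qed.

Let measurable_neq_cst (h : R[i] -> R) (c : R) : measurable_fun setT h ->
  measurable [set z | h z != c].
Proof.
move=> mh; rewrite (_ : [set z | _] = ~` [set z | h z - c = 0]).
  by apply: measurableC; apply: measurable_neq0; exact: measurable_funB.
apply/seteqP; split => z /=; first by move=> /eqP hz /subr0_eq.
by move=> hz; apply/eqP => hz'; apply: hz; rewrite hz' subrr.
Qed.

Let measurable_good k : measurable [set z | good k z].
Proof.
rewrite (_ : [set z | _] = ([set z | complex.Re z != k.1.1.1%:~R / k.1.1.2.+1%:R] `&`
   [set z | complex.Re z != k.1.2%:R]) `&` ([set z | complex.Im z != k.2.1.1%:~R / k.2.1.2.+1%:R] `&`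
   [set z | complex.Im z != k.2.2%:R])).
  by apply: measurableI; apply: measurableI; apply: measurable_neq_cst;
    [exact: measurable_Re|exact: measurable_Re|exact: measurable_Im|exact: measurable_Im].
by apply/seteqP; split => z /=; [move=> []|move=> [[? ?] [? ?]]].
Qed.

Let ae_good k : {ae (@lebesgue_C R), forall z, good k z}.
Proof.
apply: (ae_transport (@measurable_complex_parts R) (@complex_of_partsK' R)
  (@complex_partsK R) (@lebesgue_C_pushforward R)).
have neq (c : R) : {ae (@lebesgue_measure R), forall x, x != c}.
  apply: (@negligibleS _ _ _ _ [set c : measurableTypeR R]).
    by move=> x /= /negP/negPn/eqP.
  by apply/negligibleP => //; exact: lebesgue_measure_set1.
suff : {ae (@lebesgue_measure R \x @lebesgue_measure R)%E, forall p, good k (p.1 +i* p.2)%C}.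
  by apply: ae_S => p.
apply: (@ae_prod _ _ _ _ _ (@lebesgue_measure R) (@lebesgue_measure R) (fun x y => good k (x +i* y)%C) _).2.
  have := measurable_good k => mg.
  rewrite -[X in measurable X]setTI.
  exact: (@measurable_complex_of_parts R measurableT _ mg).
apply: (ae_S2 _ (neq (k.1.1.1%:~R / k.1.1.2.+1%:R)) (neq k.1.2%:R)) => x x1 x2.
by apply: (ae_S2 _ (neq (k.2.1.1%:~R / k.2.1.2.+1%:R)) (neq k.2.2%:R)) => y y1 y2.
Qed.


(* The phase of the kernel is 1 on the diagonal, so that integrating it in [w]
   over a box and letting [s] tend to infinity gives the indicator of the box. *)
Lemma twisted_gauss_complete (F : Cn R n -> R[i]) (s : nat -> R) :
  cintegrable mun F -> (forall i, 0 < s i) -> (s i)^-1 @[i --> \oo] --> (0 : R) ->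
  {ae mun, forall w, forall i,
    cintegral mun (fun z => F z * \prod_(j < n) twisted_gauss (s i) (tnth z j) (tnth w j)) = 0} ->
  {ae mun, forall z, F z = 0}.
Proof.
move=> iF s0 sc F0; have mF := cintegrable_measurable iF.
have Fbox (k : n.-tuple boxC) :
    cintegral mun (fun z => F z * (\prod_(j < n) boxC_indic (tnth k j) (tnth z j))%:C%C) = 0.
  have step i : cintegral mun (fun z => F z * \prod_(j < n) smooth_box (s i) (tnth k j) (tnth z j)) = 0.
    pose Psi (p : Cn R n * Cn R n) := F p.1 *
      \prod_(j < n) kappa_box (s i) (tnth k j) (tnth p.1 j) (tnth p.2 j).
    have mPsi : measurable_fun setT Psi.
      apply: measurable_funC_M; first exact: measurableT_comp.
      suff H (r : seq 'I_n) : measurable_fun setT (fun p : Cn R n * Cn R n =>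
          \prod_(j <- r) kappa_box (s i) (tnth k j) (tnth p.1 j) (tnth p.2 j)) by exact: H.
      elim: r => [|j r IHr]; first by under eq_fun do rewrite big_nil; exact: measurable_cst.
      under eq_fun do rewrite big_cons; apply: measurable_funC_M => //.
      have m1 : measurable_fun setT (fun p : Cn R n * Cn R n => tnth p.1 j).
        exact: (measurableT_comp (measurable_tnth j) measurable_fst).
      have m2 : measurable_fun setT (fun p : Cn R n * Cn R n => tnth p.2 j).
        exact: (measurableT_comp (measurable_tnth j) measurable_snd).
      apply: measurable_funC_M.
        exact: (measurableT_comp (measurable_kappa (s i)) (measurable_fun_pair m1 m2)).
      by apply: measurable_funC_real; exact: (measurableT_comp (measurable_boxC_indic _) m2).
    have [iH _] := tuple_prod (fun j => cintegrable_boxC_indic (tnth k j)).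
    have iPsi : cintegrable (mun \x mun)%E Psi.
      have iH' := cintegrable_normc (cintegrableZl (((s i) ^+ 2 / pi) ^+ n)%:C%C iH).
      apply: (cintegrable_dominated mPsi (integrable_prodM (cintegrable_normc iF) iH')).
      move=> p; rewrite !Normc.normcM ler_wpM2l ?normc_ge0// normcR.
      rewrite !normc_prod ger0_norm; last by rewrite exprn_ge0// divr_ge0 ?sqr_ge0// pi_ge0.
      rewrite -[X in _ ^+ X](card_ord n) -prodr_const -big_split.
      apply: ler_prod => j _; rewrite normc_ge0 Normc.normcM.
      by rewrite ler_wpM2r ?normc_ge0// kappa_le.
    have -> : cintegral mun (fun z => F z * \prod_(j < n) smooth_box (s i) (tnth k j) (tnth z j)) =
        cintegral mun (fun z => cintegral mun (fun w => Psi (z, w))).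
      congr cintegral; apply/funext => z; rewrite /Psi/=.
      have [ip ep] := tuple_prod (fun j => (cintegral_kappa_box (tnth k j) (tnth z j) (s0 i)).1).
      rewrite cintegralZl//; congr (_ * _).
      by rewrite [RHS]ep; apply: eq_bigr => j _; rewrite (cintegral_kappa_box _ _ (s0 i)).2.
    (* Exchanging the order puts the integral in [z] inside, where it is zero for almost every [w]
       by [F0]. *)
    rewrite -(cintegral_fubini1 iPsi) (cintegral_fubini2 iPsi).
    rewrite -[RHS](cintegral0 mun); apply: eq_cintegral_ae.
    - exact: (cintegrable_measurable (cintegrable_cintegral2 iPsi)).
    - exact: measurable_cst.
    have H w z : Psi (z, w) = (F z * \prod_(j < n) twisted_gauss (s i) (tnth z j) (tnth w j)) *
        ((((s i) ^+ 2 / pi) ^+ n)%:C%C * (\prod_(j < n) boxC_indic (tnth k j) (tnth w j))%:C%C).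
      rewrite /Psi /kappa_box/= big_split/=.
      under eq_bigr do rewrite kappaE.
      rewrite big_split/= prodr_const card_ord rmorphXn/= rmorph_prod/=; ring.
    apply: (ae_S _ F0) => w Fw0.
    under eq_fun do rewrite H.
    rewrite cintegralZr ?Fw0 ?mul0r//.
    apply: (@cintegrableMl _ _ _ _ _ _ 1) => //.
      apply: (@measurable_prod_tnth _ _ _ _ (fun j z => twisted_gauss (s i) z (tnth w j))) => j.
      exact: (measurableT_comp (measurable_twisted_gauss (s i)) (measurable_pair2 (tnth w j))).
    move=> z; rewrite normc_prod; apply: prodr_ile1 => j _.
    by rewrite normc_ge0 normc_twisted_gauss.
  (* The smoothed integrals are all 0, and by dominated convergence they tend to the integral of [F]
     over the box. *)
  apply: (ccvg_unique (u := fun=> 0)); last exact: ccvg_cst.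
  rewrite (_ : (fun=> 0) = fun i => cintegral mun
      (fun z => F z * \prod_(j < n) smooth_box (s i) (tnth k j) (tnth z j))); last first.
    by apply/funext => i; rewrite step.
  apply: (@cintegral_dominated _ _ _ mun _ _ (fun z => Normc.normc (F z))).
  - move=> i; apply: measurable_funC_M => //.
    apply: (@measurable_prod_tnth _ _ _ _ (fun j z => smooth_box (s i) (tnth k j) z)) => j.
    exact: measurable_smooth_box.
  - apply: measurable_funC_M => //; apply: measurable_funC_real.
    by have [mk _ _] := separating_tuple n (separating_boxC R); exact: mk.
  - exact: cintegrable_normc.
  - apply: (ae_S _ (ae_tuple (fun j => measurable_good (tnth k j)) (fun j => ae_good (tnth k j)))) => z gz.
    apply: ccvgM; first exact: ccvg_cst.
    rewrite rmorph_prod; apply: ccvg_prod => j.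
    by apply: ccvg_smooth_box.
  - move=> i z; rewrite Normc.normcM ler_piMr ?normc_ge0// normc_prod.
    by apply: prodr_ile1 => j _; rewrite normc_ge0 normc_smooth_box.
have [_ mk sep] := separating_tuple n (separating_boxC R).
have [iR iI] := iF.
have eR : {ae mun, forall z, complex.Re (F z) = 0}.
  apply: sep => // k; have := congr1 (@complex.Re R) (Fbox k); rewrite /=.
  by under eq_Rintegral do rewrite ReM/= mulr0 subr0.
have eI : {ae mun, forall z, complex.Im (F z) = 0}.
  apply: sep => // k; have := congr1 (@complex.Im R) (Fbox k); rewrite /=.
  by under eq_Rintegral do rewrite ImM/= mulr0 add0r.
by apply: (ae_S2 _ eR eI) => z zr zi; apply: complex_eqP.
Qed.

End twisted_gauss.

(** * From Laguerre polynomials to narrow Gaussians *)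

Section laguerre_moments.
Context d (T : measurableType d) (R : realType) (mu : {measure set T -> \bar R}).
Variables (Phi X : T -> R).
Hypothesis iP : mu.-integrable setT (EFin \o Phi).
Hypothesis mX : measurable_fun setT X.
Hypothesis X0 : forall x, 0 <= X x.

Lemma expR_ge_exp (x : R) j : 0 <= x -> x ^+ j / j`!%:R <= expR x.
Proof.
move=> x0; case: j => [|j].
  by rewrite expr0 fact0 divr1 -expR0 ler_expR.
apply: le_trans (expR_ge1Dxn j x0); rewrite lerDr//.
Qed.

(** A single term of the exponential series of [a * x] is at most its sum. *)
Lemma expr_expR_le (a x : R) j : 0 < a -> 0 <= x ->
  x ^+ j * expR (- (a * x)) <= j`!%:R / a ^+ j.
Proof.
move=> a0 x0; rewrite expRN ler_pdivrMr ?expR_gt0//.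
have := expR_ge_exp j (mulr_ge0 (ltW a0) x0).
rewrite exprMn ler_pdivrMr ?ltr0n ?fact_gt0// => h.
rewrite mulrAC ler_pdivlMr ?exprn_gt0//.
by rewrite mulrC (le_trans h)// mulrC.
Qed.

Let w (a : R) j x := X x ^+ j * expR (- (a * X x)).

Let mw a j : measurable_fun setT (w a j).
Proof.
apply: measurable_funM; first exact: measurable_funX.
apply: (measurableT_comp (@measurable_expR R)).
by apply: (measurableT_comp (@oppr_measurable R setT)); exact: measurable_funM.
Qed.

Let w_ge0 a j x : 0 <= w a j x.
Proof. by rewrite mulr_ge0 ?exprn_ge0 ?expR_ge0. Qed.

Let w_le a j x : 0 < a -> `|w a j x| <= j`!%:R / a ^+ j.
Proof. by move=> a0; rewrite ger0_norm ?w_ge0// expr_expR_le. Qed.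

Let iw a j : 0 < a -> mu.-integrable setT (EFin \o (fun x => Phi x * w a j x)).
Proof. by move=> a0; apply: (integrable_bounded_mul iP) => // x; exact: w_le. Qed.

(* The exponential series is only dominated for factors [< a], hence the steps. *)
Let moments_step a : 0 < a -> (forall j, \int[mu]_x (Phi x * w a j x) = 0) ->
  forall j, \int[mu]_x (Phi x * w (3 / 2 * a) j x) = 0.
Proof.
move=> a0 ha j; have a20 : 0 < a / 2 by rewrite divr_gt0.
have <- : \int[mu]_x (Phi x * w a j x * expR (- (a / 2) * X x)) =
    \int[mu]_x (Phi x * w (3 / 2 * a) j x).
  apply: eq_Rintegral => x _; rewrite /w -!mulrA -expRD.
  by congr (_ * (_ * expR _)); field.
have E i x : Phi x * w a j x * X x ^+ i = Phi x * w a (j + i) x.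
  by rewrite /w exprD; ring.
(* The factor [expR (- (a / 2) * X)] raises the rate to [3 / 2 * a]. Its series is dominated by
   [expR (a / 2 * X)], so a decay of rate [a / 2] survives to bound the power of [X]. *)
apply: (@moments_expR _ _ _ _ _ _ (fun x => `|Phi x| * (j`!%:R / (a / 2) ^+ j))) => //.
- by apply: measurable_funM => //; exact: measurable_integrable iP.
- apply: (@integrable_bounded_mul _ _ _ _ _ _ `|j`!%:R / (a / 2) ^+ j|) => //.
  exact: integrable_norm iP.
- move=> x; rewrite normrM -mulrA ler_wpM2l// ger0_norm ?w_ge0//.
  rewrite normrM normrN !ger0_norm ?(ltW a20)// /w -mulrA -expRD.
  rewrite (_ : - (a * X x) + a / 2 * X x = - (a / 2 * X x)) ?expr_expR_le//; by field.
- by move=> i; apply: eq_integrable (iw (j + i) a0) => // x _; rewrite /= E.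
- by move=> i; rewrite -[RHS](ha (j + i)%N); apply: eq_Rintegral => x _; rewrite E.
Qed.

(** Triangular inversion: the Laguerre polynomial of index [j] has degree [j], with leading
    coefficient [(-1) ^+ j / j!], so strong induction isolates the [j]-th moment. *)
Lemma laguerre_moments (b : nat) :
  (forall k, \int[mu]_x (Phi x * ((laguerre R b k).[X x] * expR (- (2^-1 * X x)))) = 0) ->
  forall j, \int[mu]_x (Phi x * (X x ^+ j * expR (- (2^-1 * X x)))) = 0.
Proof.
move=> L0; have h0 : 0 < 2^-1 :> R by rewrite invr_gt0.
elim/ltn_ind => j IHj.
have := L0 j.
pose c i := (-1) ^+ i * 'C(j + b, j - i)%:R / i`!%:R :> R.
have -> : \int[mu]_x (Phi x * ((laguerre R b j).[X x] * expR (- (2^-1 * X x)))) =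
    \int[mu]_x (\sum_(0 <= i < j.+1) c i * (Phi x * w 2^-1 i x)).
  apply: eq_Rintegral => x _; rewrite horner_poly big_mkord mulr_suml mulr_sumr.
  by apply: eq_bigr => i _; rewrite /w /c; ring.
rewrite Rintegral_sum_seq; last by move=> i; exact: (integrableZl measurableT _ (iw i h0)).
under eq_bigr do rewrite (RintegralZl _ measurableT (iw _ h0)).
rewrite big_nat_recr//= big_nat big1 ?add0r; last first.
  by move=> i /andP[_ ij]; rewrite IHj// mulr0.
move/eqP; rewrite mulf_eq0 => /orP[|/eqP//].
rewrite /c subnn bin0 mulr1 mulf_eq0 signr_eq0 invr_eq0 pnatr_eq0.
by move=> /orP[//|/eqP]; have := fact_gt0 j; lia.
Qed.

Lemma laguerre_expR (b : nat) :
  (forall k, \int[mu]_x (Phi x * ((laguerre R b k).[X x] * expR (- (2^-1 * X x)))) = 0) ->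
  forall i, \int[mu]_x (Phi x * expR (- (2^-1 * (3 / 2) ^+ i * X x))) = 0.
Proof.
move=> L0 i.
suff H j : \int[mu]_x (Phi x * w (2^-1 * (3 / 2) ^+ i) j x) = 0.
  by have := H 0%N; rewrite /w; under eq_Rintegral do rewrite mul1r.
elim: i j => [|i IHi] j.
  by rewrite expr0 mulr1; exact: laguerre_moments.
by rewrite exprS mulrCA; apply: moments_step => //; rewrite mulr_gt0 ?exprn_gt0 ?divr_gt0.
Qed.

End laguerre_moments.

(** * Twisted Laguerre kernels *)

Section twisted_laguerre.
Context (R : realType) (n : nat).
Local Notation mun := (@lebesgue_Cn R n).

Definition twisted_kernel (k : nat) (l : R) (z w : Cn R n) : R[i] :=
  cis (- (l / 2) * complex.Im (Defs.hermitian z w)) *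
  (phi k l [tuple - tnth z j + tnth w j | j < n])%:C%C.

Lemma cis_sum (I : Type) (r : seq I) (f : I -> R) :
  cis (\sum_(i <- r) f i) = \prod_(i <- r) cis (f i).
Proof. by elim: r => [|i r IHr]; rewrite ?big_nil ?cis0// !big_cons cisD IHr. Qed.

(** Isolates the central variable [t]: integrating it against the first factor produces the Fourier
    transform of a slice at [l]. *)
Lemma e_kl_twisted k l (z w : Cn R n) t :
  e_kl k l (hmul (hinv (z, t)) (w, 0)) = cis (- (l * t)) * twisted_kernel k l z w.
Proof.
rewrite /e_kl /twisted_kernel mulrA -cisD; congr (_ * _); [congr cis|congr (_%:C%C); congr phi].
  rewrite /= (_ : Defs.hermitian _ _ = - Defs.hermitian z w).
    by rewrite addr0 ImN; field.
  rewrite /Defs.hermitian -sumrN; apply: eq_bigr => j _.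
  by rewrite tnth_mktuple mulNr.
by apply: eq_from_tnth => j; rewrite !tnth_mktuple.
Qed.

Lemma prod_twisted_gauss (l s : R) (z w : Cn R n) :
  \prod_(j < n) twisted_gauss l s (tnth z j) (tnth w j) =
  cis (- (l / 2) * complex.Im (Defs.hermitian z w)) *
  (expR (- (s ^+ 2 * sqnorm [tuple - tnth z j + tnth w j | j < n])))%:C%C.
Proof.
rewrite big_split/=; congr (_ * _).
  rewrite -cis_sum -mulr_sumr; congr (cis (_ * _)).
  by rewrite raddf_sum.
rewrite -rmorph_prod/= -expR_sum /sqnorm mulr_sumr -sumrN; congr (expR _)%:C%C.
by apply: eq_bigr => j _; rewrite tnth_mktuple addrC.
Qed.

Lemma measurable_sqnorm : measurable_fun setT (@sqnorm R n).
Proof.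
suff H (r : seq 'I_n) : measurable_fun setT (fun z : Cn R n => \sum_(j <- r) Normc.normc (tnth z j) ^+ 2).
  exact: H.
elim: r => [|j r IHr]; first by under eq_fun do rewrite big_nil; exact: measurable_cst.
under eq_fun do rewrite big_cons; apply: measurable_funD => //.
apply: measurable_funX; apply: measurable_fun_normc; exact: measurable_tnth.
Qed.

Lemma measurable_tuple_sub d (T : measurableType d) (z w : T -> Cn R n) :
  measurable_fun setT z -> measurable_fun setT w ->
  measurable_fun setT (fun x => [tuple - tnth (z x) j + tnth (w x) j | j < n]).
Proof.
move=> mz mw; apply/measurable_fun_tnthP => j.
rewrite (_ : _ \o _ = fun x => - tnth (z x) j + tnth (w x) j).
  apply: measurable_funC_D; first apply: measurable_funC_N.
    exact: (measurableT_comp (measurable_tnth j) mz).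
  exact: (measurableT_comp (measurable_tnth j) mw).
by apply/funext => x; rewrite /= tnth_mktuple.
Qed.

Lemma measurable_hermitian d (T : measurableType d) (z w : T -> Cn R n) :
  measurable_fun setT z -> measurable_fun setT w ->
  measurable_fun setT (fun x => Defs.hermitian (z x) (w x)).
Proof.
move=> mz mw.
suff H (r : seq 'I_n) : measurable_fun setT (fun x => \sum_(j <- r) tnth (z x) j * conjc (tnth (w x) j)).
  exact: H.
elim: r => [|j r IHr]; first by under eq_fun do rewrite big_nil; exact: measurable_cst.
under eq_fun do rewrite big_cons; apply: measurable_funC_D => //.
apply: measurable_funC_M; first exact: (measurableT_comp (measurable_tnth j) mz).
apply: measurable_fun_conjc; exact: (measurableT_comp (measurable_tnth j) mw).
Qed.

(** For fixed [w] the phase is absorbed into [G], the same for Laguerre and Gaussian kernels. What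
    remains is a function of the single variable [X], to which [laguerre_expR] applies on the real
    and imaginary parts. *)
Lemma twisted_laguerre_complete (l : R) (F : Cn R n -> R[i]) : l != 0 -> cintegrable mun F ->
  {ae mun, forall w, forall k, cintegral mun (fun z => F z * twisted_kernel k l z w) = 0} ->
  {ae mun, forall z, F z = 0}.
Proof.
move=> l0 iF F0.
(* Chosen so that [s i ^+ 2] times the squared distance is [2^-1 * (3 / 2) ^+ (2 * i) * X], the rate
   reached by [laguerre_expR] after [2 * i] steps. *)
pose s i : R := Num.sqrt `|l| / 2 * (3 / 2) ^+ i.
have sl0 : 0 < Num.sqrt `|l| / 2 by rewrite divr_gt0// sqrtr_gt0 normr_gt0.
have s0 i : 0 < s i by rewrite mulr_gt0// exprn_gt0// divr_gt0.
have s2 i : s i ^+ 2 = 2^-1 * (3 / 2) ^+ (2 * i) * (2^-1 * `|l|).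
  rewrite /s exprMn expr_div_n sqr_sqrtr// -exprM mulnC; by field.
have sc : (s i)^-1 @[i --> \oo] --> (0 : R).
  rewrite (_ : (fun i => _) = (fun i => (Num.sqrt `|l| / 2)^-1 * (2 / 3) ^+ i)).
    rewrite -[X in _ --> X](mulr0 ((Num.sqrt `|l| / 2)^-1)).
    apply: cvgM; first exact: cvg_cst.
    apply: cvg_expr; rewrite ger0_norm; last by rewrite divr_ge0.
    by rewrite ltr_pdivrMr// mul1r ltr_nat.
  by apply/funext => m; rewrite /s invfM -exprVn -[in RHS](invf_div 3).
refine (twisted_gauss_complete (l := l) iF s0 sc _).
apply: (ae_S _ F0) => w Fw i.
pose G z := F z * cis (- (l / 2) * complex.Im (Defs.hermitian z w)).
pose X z : R := 2^-1 * `|l| * sqnorm [tuple - tnth z j + tnth w j | j < n].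
have mX : measurable_fun setT X.
  apply: measurable_funM => //; apply: (measurableT_comp measurable_sqnorm).
  by apply: measurable_tuple_sub => //; exact: measurable_cst.
have X0 z : 0 <= X z.
  by rewrite mulr_ge0 ?mulr_ge0 ?invr_ge0// sumr_ge0// => j _; exact: sqr_ge0.
have iG : cintegrable mun G.
  apply: (@cintegrableMl _ _ _ _ _ _ 1 iF); last by move=> z; rewrite normc_cis.
  apply: measurable_fun_cis; apply: measurable_funM => //.
  apply: (measurableT_comp (@measurable_Im R)); exact: measurable_hermitian.
have EL k : (fun z => F z * twisted_kernel k l z w) =
    (fun z => G z * ((laguerre R (n - 1) k).[X z] * expR (- (2^-1 * X z)))%:C%C).
  apply/funext => z; rewrite /twisted_kernel /phi mulrA; congr (_ * (_ * expR _)%:C%C).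
  by rewrite /X; field.
have EG : (fun z => F z * \prod_(j < n) twisted_gauss l (s i) (tnth z j) (tnth w j)) =
    (fun z => G z * (expR (- (2^-1 * (3 / 2) ^+ (2 * i) * X z)))%:C%C).
  apply/funext => z; rewrite prod_twisted_gauss mulrA s2 /X.
  by congr (_ * (expR _)%:C%C); ring.
rewrite EG; apply: complex_eqP; rewrite /=.
  under eq_Rintegral do rewrite ReM/= mulr0 subr0.
  apply: (laguerre_expR iG.1 mX X0 (b := (n - 1)%N)) => k.
  have := congr1 (@complex.Re R) (Fw k); rewrite EL/=.
  by under eq_Rintegral do rewrite ReM/= mulr0 subr0.
under eq_Rintegral do rewrite ImM/= mulr0 add0r.
apply: (laguerre_expR iG.2 mX X0 (b := (n - 1)%N)) => k.
have := congr1 (@complex.Im R) (Fw k); rewrite EL/=.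
by under eq_Rintegral do rewrite ImM/= mulr0 add0r.
Qed.

End twisted_laguerre.
(** * The Strichartz transform along the rays of the fan *)

Section integral_comparison.
Import HBNNSimple.
Context d (T : measurableType d) (R : realType).
Variables (m1 m2 : {measure set T -> \bar R}).

(** Holds also for functions that are not measurable: the integral of [h1] is a supremum over simple
    functions below it, whose level sets for nonzero values lie in [D], where the two measures are
    compared. *)
Lemma ge0_integral_le_measure (D : set T) (C : R) (h1 h2 : T -> \bar R) : 0 <= C ->
  (forall S, measurable S -> S `<=` D -> (m1 S <= C%:E * m2 S)%E) ->
  (forall x, 0 <= h1 x)%E -> (forall x, 0 <= h2 x)%E -> (forall x, D x -> h1 x <= h2 x)%E ->
  (\int[m1]_(x in D) h1 x <= C%:E * \int[m2]_x h2 x)%E.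
Proof.
move=> C0 m12 h10 h20 h12; rewrite ge0_integralE//.
apply: ge_ereal_sup => _ [h hD <-].
have gD x : (h x)%:E != 0%E -> D x.
  move=> hx; apply: contrapT => Dx; have := hD x.
  rewrite /patch; case: ifPn => [|_]; first by rewrite inE.
  by rewrite lee_fin => h0; move: hx; rewrite eqe eq_le h0 fun_ge0.
apply: (@le_trans _ _ (C%:E * sintegral m2 h)%E).
  rewrite !sintegralE ge0_mule_fsumr; last first.
    move=> r; have [r0|r0] := leP 0 r; first by rewrite mule_ge0.
    by rewrite preimage_nnfun0// measure0 mule0.
  apply: lee_fsum => // r [x _ <-].
  have [hx|hx] := eqVneq (h x) 0; first by rewrite hx !mul0e mule0.
  rewrite muleCA lee_wpmul2l//; first by rewrite lee_fin.
  by apply: m12 => // y/= hy; apply: gD; rewrite eqe hy.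
rewrite lee_wpmul2l ?lee_fin//.
rewrite ge0_integralTE//; apply: ereal_sup_ubound; exists h => // x.
have := hD x; rewrite /patch; case: ifPn => [|_].
  by rewrite inE => Dx /le_trans; apply; exact: h12.
by move=> /le_trans; apply; exact: h20.
Qed.

End integral_comparison.

Lemma measurable_normr_gt d (T : measurableType d) (R : realType) (M : R) (h : T -> R) :
  measurable_fun setT h -> measurable [set x | M < `|h x|].
Proof.
move=> mh; have := measurable_fun_ltr (@measurable_cst _ _ _ _ setT M)
  (measurableT_comp (@normr_measurable R setT) mh).
by move=> /(_ measurableT [set true] I); rewrite setTI.
Qed.

(** * Comparison of Lebesgue measure along a ray with [nu2] *)

Section fan_rays.
Context (R : realType) (n : nat).
Hypothesis n_gt0 : (0 < n)%N.
Local Notation mu := (@lebesgue_measure R).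

Lemma measurable_ray_point k :
  measurable_fun setT (@ray_point R n k : measurableTypeR R -> plane R).
Proof.
apply/measurable_fun_pairP; split; first exact: measurable_id.
by apply: (@measurable_funM _ (measurableTypeR R)) => //; exact: normr_measurable.
Qed.

Lemma c_nk_gt0 k : 0 < c_nk R n k.
Proof. by rewrite divr_gt0// ltr0n ?muln_gt0 !fact_gt0. Qed.

(** The inverse of [c_nk] is the binomial coefficient of [k + n - 1] over [k]. *)
Lemma c_nk_le1 k : c_nk R n k <= 1.
Proof.
rewrite /c_nk ler_pdivrMr ?ltr0n ?fact_gt0// mul1r ler_nat.
have kn : (k <= k + n - 1)%N by rewrite -addnBA// leq_addr.
rewrite -(bin_fact kn) (_ : (k + n - 1 - k = n - 1)%N); last by rewrite -addnBA// addnC addnK.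
by rewrite leq_pmull// bin_gt0.
Qed.

Let nu2_term_ge0 (A : set (plane R)) l k :
  (0 <= ((c_nk R n k) ^- 2)%:E * (\1_A (ray_point n k l))%:E)%E.
Proof. by rewrite mule_ge0 ?lee_fin ?invr_ge0 ?sqr_ge0. Qed.

Lemma measurable_nu2_density (A : set (plane R)) : measurable A ->
  measurable_fun setT (nu2_density n A : measurableTypeR R -> \bar R).
Proof.
move=> mA; apply: emeasurable_funM; last first.
  by apply/measurable_EFinP/measurable_funX; exact: normr_measurable.
apply: ge0_emeasurable_sum => [k l _ _|k _]; first exact: nu2_term_ge0.
apply: measurable_funeM; apply/measurable_EFinP.
apply: measurableT_comp; last exact: measurable_ray_point.
exact: measurable_indic.
Qed.

Lemma nu2_density_ge0 (A : set (plane R)) l : (0 <= nu2_density n A l)%E.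
Proof.
apply: mule_ge0; last by rewrite lee_fin exprn_ge0.
by apply: nneseries_ge0 => k _ _; exact: nu2_term_ge0.
Qed.

Variables (M : R).
Hypothesis M0 : 0 < M.

(** Only the term of index [k] is kept; its weight [c_nk ^- 2] is at least 1. *)
Lemma nu2_density_ge (A : set (plane R)) l k : M < `|l| -> A (ray_point n k l) ->
  ((M ^+ (2 * n))%:E <= nu2_density n A l)%E.
Proof.
move=> Ml Al; rewrite -[leLHS]mul1e; apply: lee_pmul => //.
- by rewrite lee_fin exprn_ge0// ltW.
- apply: (@le_trans _ _ ((c_nk R n k) ^- 2 * \1_A (ray_point n k l))%:E).
    rewrite indicE mem_set// mulr1 lee_fin invf_ge1; last by rewrite exprn_gt0// c_nk_gt0.
    by rewrite expr_le1// ?c_nk_le1// ltW// c_nk_gt0.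
  rewrite (nneseriesD1 (n := k))//.
  by rewrite EFinM leeDl//; apply: nneseries_ge0 => i _ _; exact: nu2_term_ge0.
- rewrite lee_fin lerXn2r ?nnegrE ?normr_ge0//; exact: ltW.
Qed.

(** The inverse of the lower bound for the density of [nu2] over [|l| > M], its constant factor
    [(2 * pi) ^- (2 * n + 1)] included. *)
Definition ray_const : R := (2 * pi) ^+ (2 * n + 1) * M ^- (2 * n).

Lemma ray_const_ge0 : 0 <= ray_const.
Proof. by rewrite mulr_ge0 ?invr_ge0 ?exprn_ge0 ?mulr_ge0 ?pi_ge0// ltW. Qed.

(* The sum over the rays costs nothing because the weights of [nu2] are at
   least [M ^ 2n]. *)
Lemma measure_union_rays_le (A : set (plane R)) (B : set (measurableTypeR R)) :
  measurable A -> measurable B ->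
  (forall l, B l -> M < `|l| /\ exists k, A (ray_point n k l)) ->
  (mu B <= ray_const%:E * nu2 n A)%E.
Proof.
move=> mA mB BA.
have M2 : 0 < M ^+ (2 * n) by rewrite exprn_gt0.
have p2 : 0 < (2 * pi) ^+ (2 * n + 1) :> R by rewrite exprn_gt0// mulr_gt0// pi_gt0.
rewrite /ray_const /nu2 muleA -EFinM mulrAC divff ?gt_eqF// mul1r.
rewrite -ge0_integralZl//; last 3 first.
- exact: measurable_nu2_density.
- by move=> l _; exact: nu2_density_ge0.
- by rewrite lee_fin invr_ge0 ltW.
rewrite -[mu B]mul1e -integral_cst//=.
rewrite integral_mkcond; apply: ge0_le_integral => //.
- by move=> l _; rewrite erestrict_ge0.
- by apply/(measurable_restrictT _ _).1 => //; exact: measurable_cst.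
- by apply: measurable_funeM; exact: measurable_nu2_density.
move=> l _; rewrite /patch; case: ifPn; rewrite ?inE => Bl.
  have [Ml [k Ak]] := BA _ Bl.
  rewrite -lee_pdivrMl ?invr_gt0// invrK mule1; exact: nu2_density_ge Ml Ak.
change (0 <= (M ^- (2 * n))%:E * nu2_density n A l)%E; by rewrite mule_ge0 ?nu2_density_ge0// lee_fin invr_ge0 ltW.
Qed.

Variable k : nat.

Definition ray_prod (p : measurableTypeR R * Cn R n) : plane R * Cn R n :=
  (ray_point n k p.1, p.2).

Lemma measurable_ray_prod : measurable_fun setT ray_prod.
Proof.
apply: measurable_fun_pair; last exact: measurable_snd.
exact: (measurableT_comp (measurable_ray_point k) measurable_fst).
Qed.

(* A measurable minorant of [h], which itself is only measurable along the ray. *)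
Let lift (h : plane R * Cn R n -> \bar R) (x : plane R * Cn R n) : \bar R :=
  if (x.1.2 : R) == (2 * k + n)%:R * `|x.1.1| then h (ray_prod (x.1.1, x.2)) else 0%E.

Let lift_le h x : (forall x, 0 <= h x)%E -> (lift h x <= h x)%E.
Proof.
move=> h0; rewrite /lift; case: ifPn => // /eqP x2.
by case: x x2 => -[a b] w /= x2; rewrite /ray_prod /ray_point /= -x2.
Qed.

Let lift_ray_prod h p : lift h (ray_prod p) = h (ray_prod p).
Proof. by rewrite /lift /= eqxx; case: p. Qed.

Let measurable_lift h : measurable_fun setT (h \o ray_prod) -> measurable_fun setT (lift h).
Proof.
move=> mh.
have m1 : measurable_fun setT (fun x : plane R * Cn R n => (x.1.1 : R)).
  exact: (measurableT_comp measurable_fst measurable_fst).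
have m2 : measurable_fun setT (fun x : plane R * Cn R n => (x.1.2 : R)).
  exact: (measurableT_comp measurable_snd measurable_fst).
apply: measurable_fun_ifT.
- apply: measurable_fun_eqr => //; apply: measurable_funM => //.
  exact: (measurableT_comp (@normr_measurable R setT) m1).
- apply: (measurableT_comp mh); apply: measurable_fun_pair => //.
- exact: measurable_cst.
Qed.

(** Over [|l| > M] the image of Lebesgue measure under [ray_prod] is at most [ray_const] times
    [fan_measure]. Measurability along the ray is all that is assumed of [h], as it will be built
    from [strichartz u]; passing to the minorant [lift] makes the image measure usable. *)
Lemma ge0_integral_ray_le (h : plane R * Cn R n -> \bar R) : (forall x, 0 <= h x)%E ->
  measurable_fun setT (h \o ray_prod) ->
  (\int[mu \x @lebesgue_Cn R n]_(p in [set p | (M < `|p.1|)%R]) h (ray_prod p)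
    <= ray_const%:E * \int[@fan_measure R n]_x h x)%E.
Proof.
move=> h0 mh.
pose D (x : plane R) := M < `|x.1|.
have mD : measurable [set x : plane R | D x].
  exact: (measurable_normr_gt M (@measurable_fst _ _ (measurableTypeR R) (measurableTypeR R))).
have lift0 x : (0 <= lift h x)%E by rewrite /lift; case: ifP.
rewrite (_ : (\int[_]_(p in _) _)%E =
    (\int[pushforward_measure (mu \x @lebesgue_Cn R n)%E measurable_ray_prod]_(x in [set x | D x.1]) lift h x)%E); last first.
  rewrite (ge0_integral_pushforward measurable_ray_prod)//; last 2 first.
  - rewrite -[X in measurable X]setTI; exact: (measurable_fst measurableT _ mD).
  - by apply: measurable_funTS; exact: measurable_lift.
  by apply: eq_integral => p _; rewrite /= lift_ray_prod.
apply: ge0_integral_le_measure => //; first exact: ray_const_ge0; last first.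
  by move=> x _; exact: lift_le.
move=> S mS SD.
(* To compare the measures of [S], both are written as integrals of its section measure [H] over the
   plane, where the same comparison lemma applies again. *)
pose H (a : plane R) := @lebesgue_Cn R n (xsection S a).
have mH : measurable_fun setT H by exact: measurable_fun_xsection.
have H0 a : (0 <= H a)%E by exact: measure_ge0.
have HD a : ~ D a -> H a = 0%E.
  move=> Da; rewrite /H (_ : xsection S a = set0) ?measure0//.
  by rewrite -subset0 => w; rewrite /xsection/= inE => /SD.
apply: (@le_trans _ _ (\int[pushforward_measure mu (measurable_ray_point k)]_(a in [set a | D a]) H a)%E).
  rewrite [leRHS](ge0_integral_pushforward (measurable_ray_point k) mu mD); [|exact: measurable_funTS|by []].
  rewrite integral_mkcond le_eqVlt; apply/orP; left; apply/eqP; apply: eq_integral => l _.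
  have xE : xsection (ray_prod @^-1` S) l = xsection S (ray_point n k l).
    by apply/seteqP; split => w; rewrite /xsection/= !inE.
  rewrite /patch; case: ifPn => hl; rewrite /= xE//.
  by apply: HD => Dl; move: hl; rewrite notin_setE.
apply: ge0_integral_le_measure => //; first exact: ray_const_ge0.
move=> A mA AD; apply: measure_union_rays_le => //.
  by rewrite -[X in measurable X]setTI; exact: measurable_ray_point.
by move=> l Al; split; [exact: AD Al|exists k].
Qed.

End fan_rays.

(** * A Plancherel inequality on bounded frequencies *)

Section bounded_trigo.
Context (R : realType).

Lemma cos_norm_le1 (x : R) : `|cos x| <= 1.
Proof. by rewrite ler_norml cos_geN1 cos_le1. Qed.

Lemma sin_norm_le1 (x : R) : `|sin x| <= 1.
Proof. by rewrite ler_norml sin_geN1 sin_le1. Qed.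

Lemma measurable_cos : measurable_fun setT (@cos R).
Proof. by apply: continuous_measurable_fun; exact: continuous_cos. Qed.

Lemma measurable_sin : measurable_fun setT (@sin R).
Proof. by apply: continuous_measurable_fun; exact: continuous_sin. Qed.

End bounded_trigo.

Section band_limited_plancherel.
Context (R : realType).
Local Notation mu := (@lebesgue_measure R).
Variable B : R.
Hypothesis B0 : 0 < B.

(* Continuous at both ends, so that its cosine transform decays like [x ^- 2]. *)
Definition band_weight (l : R) : R := (B ^+ 2 - l ^+ 2) * \1_`[- B, B[ l.
Local Notation T := band_weight.

Lemma band_weight_ge0 l : 0 <= T l.
Proof.
rewrite /band_weight indicE; have [|_] := boolP (l \in _); rewrite ?mulr0// mulr1 inE/= in_itv/= => /andP[lB Bl].
have := mulr_ge0 (_ : 0 <= B - l) (_ : 0 <= l + B); rewrite subr_ge0 -lerBlDr sub0r (ltW Bl) lB.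
by move=> /(_ isT isT); congr (_ <= _); ring.
Qed.

Let NB : - B < B.
Proof. by rewrite gtrN. Qed.

Let continuous_cos_scaled (x : R) : continuous (fun t : R => cos (t * x)).
Proof. by move=> y; apply: continuous_comp; [exact: mulrr_continuous|exact: continuous_cos]. Qed.

Let continuous_weight : continuous (fun l : R => B ^+ 2 - l ^+ 2).
Proof.
by move=> y; apply: cvgB; [exact: cvg_cst|exact: exprn_continuous].
Qed.

Let integrable_T : mu.-integrable setT (EFin \o T).
Proof.
have iB : mu.-integrable setT (EFin \o (fun l => B ^+ 2 * \1_`[- B, B[ l)).
  exact: (integrableZl measurableT _ (@integrable_indic_itv R _ _ _ _)).
apply: (integrable_dominated _ iB) => [|l].
  by apply: measurable_funM; [exact: continuous_measurable_fun|exact: measurable_indic].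
by rewrite (ger0_norm (band_weight_ge0 l)) ler_wpM2r// gerBl sqr_ge0.
Qed.

Let sqr_norm (x : R) : `|x| ^+ 2 = x ^+ 2.
Proof. exact: real_normK (num_real x). Qed.

Let That (x : R) : R := \int[mu]_l (T l * cos (l * x)).

Let integrable_That x : mu.-integrable setT (EFin \o (fun l => T l * cos (l * x))).
Proof.
apply: (@integrable_bounded_mul _ _ _ _ _ _ 1 integrable_T) => [|l].
  exact: continuous_measurable_fun.
by rewrite cos_norm_le1.
Qed.

(** [F] is the antiderivative obtained by repeated integration by parts. As the weight vanishes at
    both ends, the boundary term in [x^-1] drops out and the decay is of order [x ^- 2]. *)
Let That_le x : x != 0 -> `|That x| <= (4 * B + 4 / `|x|) / x ^+ 2.
Proof.
move=> x0.
pose F (l : R) := (B ^+ 2 - l ^+ 2) * (x^-1 * sin (x * l)) - 2 * l * (x ^- 2 * cos (x * l)) + 2 * (x ^- 3 * sin (x * l)).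
have -> : That x = F B - F (- B).
  have <- : \int[mu]_(l in `[- B, B]) ((B ^+ 2 - l ^+ 2) * cos (l * x)) = F B - F (- B).
  apply: Rintegral_FTC2 => //.
  - by move=> l; apply: cvgM; [exact: continuous_weight|exact: continuous_cos_scaled].
  - move=> l.
    have h : is_derive l (1 : R) (fun t : R^o => x * t : R^o) x.
      by apply: is_derive_eq; rewrite /GRing.scale/= mulr1.
    apply: is_derive_eq; rewrite /GRing.scale/= !mulr1 [l * x]mulrC.
    field.
    by [].
  rewrite -Rintegral_itv_indic//; last first.
    by move=> l; apply: cvgM; [exact: continuous_weight|exact: continuous_cos_scaled].
  by apply: eq_Rintegral => l _; rewrite /band_weight; ring.
have -> : F B - F (- B) = - (4 * B) * x ^- 2 * cos (x * B) + 4 * x ^- 3 * sin (x * B).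
  by rewrite /F !mulrN cosN sinN sqrrN; ring.
apply: (le_trans (ler_normD _ _)); rewrite [leRHS]mulrDl; apply: lerD.
  rewrite normrM normrM normrN (ger0_norm (mulr_ge0 _ (ltW B0)))// normfV normrX sqr_norm.
  by rewrite ler_piMr ?cos_norm_le1// divr_ge0 ?sqr_ge0// mulr_ge0// ltW.
rewrite normrM normrM (ger0_norm (_ : 0 <= 4))// normfV normrX.
rewrite (_ : 4 / `|x| / x ^+ 2 = 4 / `|x| ^+ 3); last first.
  by rewrite -(sqr_norm x); field; rewrite normr_eq0.
by rewrite ler_piMr ?sin_norm_le1// divr_ge0 ?exprn_ge0.
Qed.

Let J := \int[mu]_l T l.

(** Serves both ranges of the bound by [K / (1 + x ^+ 2)]: for [|x| <= 1] the transform is at most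
    [J] and [1 + x ^+ 2 <= 2]; beyond, [x ^+ 2] times it is at most [4 * B + 4] and
    [1 + x ^+ 2 <= 2 * x ^+ 2]. *)
Definition band_const : R := 2 * J + 8 * B + 8.
Local Notation K := band_const.

Let J0 : 0 <= J.
Proof. by apply: Rintegral_ge0 => l _; exact: band_weight_ge0. Qed.

Lemma band_const_gt0 : 0 < K.
Proof. by have := J0; have := B0; rewrite /band_const; lra. Qed.

Let That_oneDsqr x : `|That x| <= K / oneDsqr x.
Proof.
have x1 : 0 < oneDsqr x by rewrite (lt_le_trans _ (oneDsqr_ge1 x)).
rewrite ler_pdivlMr// /oneDsqr.
have [xl|xl] := leP `|x| 1.
  have h1 : `|That x| <= J.
    apply: (le_trans (le_normr_Rintegral measurableT (integrable_That x))).
    apply: le_Rintegral => //.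
    - exact: integrable_norm (integrable_That x).
    - move=> l _; rewrite normrM (ger0_norm (band_weight_ge0 l)) ler_piMr ?band_weight_ge0//.
      by rewrite cos_norm_le1.
  have h2 : x ^+ 2 <= 1 by rewrite -sqr_norm expr_le1.
  have := B0; rewrite /band_const => BB.
  have h3 : 0 <= `|That x| by [].
  have := J0; nra.
have x0 : x != 0 by rewrite -normr_gt0 (lt_trans _ xl).
have x2 : 1 < x ^+ 2 by rewrite -sqr_norm exprn_egt1.
have h : `|That x| * x ^+ 2 <= 4 * B + 4.
  rewrite -ler_pdivlMr ?(lt_trans _ x2)//; apply: (le_trans (That_le x0)).
  rewrite ler_wpM2r ?invr_ge0 ?sqr_ge0// lerD2l ler_pdivrMr ?(lt_trans _ xl)//.
  by rewrite ler_peMr// ltW.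
have h3 : 0 <= `|That x| by [].
have := J0; have := B0; rewrite /band_const; nra.
Qed.

Let mK : measurable_fun setT (fun x : R => (oneDsqr x)^-1).
Proof. by apply: continuous_measurable_fun; exact: continuous_oneDsqrV. Qed.

Lemma integral_oneDsqr : (\int[mu]_t ((oneDsqr t)^-1)%:E = pi%:E)%E.
Proof.
rewrite (@ge0_symfun_integralT _ (fun t => (oneDsqr t)^-1)).
- by rewrite -set_itvcy integral0y_oneDsqr -EFinM; congr EFin; field.
- by move=> x; rewrite invr_ge0 (le_trans _ (oneDsqr_ge1 x)).
- exact: continuous_oneDsqrV.
- by move=> x; rewrite /= /oneDsqr sqrrN.
Qed.

Lemma integral_oneDsqr_sub (s : R) : (\int[mu]_t ((oneDsqr (t - s))^-1)%:E = pi%:E)%E.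
Proof.
rewrite -integral_oneDsqr (ge0_integral_affine (- s) ltr01 (g := fun x => ((oneDsqr x)^-1)%:E)).
- by rewrite mul1e; apply: eq_integral => t _; rewrite mul1r.
- exact/measurable_EFinP.
- by move=> x; rewrite lee_fin invr_ge0 (le_trans _ (oneDsqr_ge1 x)).
Qed.

Section one_function.
Variable a : R -> R.
Hypothesis ia : mu.-integrable setT (EFin \o a).
Hypothesis ia2 : mu.-integrable setT (EFin \o (fun s => a s ^+ 2)).

Let C (l : R) : R := \int[mu]_s (a s * cos (l * s)).
Let S (l : R) : R := \int[mu]_s (a s * sin (l * s)).

Let ma := measurable_integrable ia.

Let mcos (x : R) : measurable_fun setT (fun t : R => cos (x * t)).
Proof. by apply: (measurableT_comp (@measurable_cos R)); exact: mulrl_measurable. Qed.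
Let msin (x : R) : measurable_fun setT (fun t : R => sin (x * t)).
Proof. by apply: (measurableT_comp (@measurable_sin R)); exact: mulrl_measurable. Qed.

Let integrable_acos x : mu.-integrable setT (EFin \o (fun s => a s * cos (x * s))).
Proof.
apply: (@integrable_bounded_mul _ _ _ _ _ _ 1) => // [|s].
  exact: mcos.
by rewrite cos_norm_le1.
Qed.

Let integrable_asin x : mu.-integrable setT (EFin \o (fun s => a s * sin (x * s))).
Proof.
apply: (@integrable_bounded_mul _ _ _ _ _ _ 1) => // [|s].
  exact: msin.
by rewrite sin_norm_le1.
Qed.

Let N1 := \int[mu]_s `|a s|.

Let C_le l : `|C l| <= N1.
Proof.
apply: (le_trans (le_normr_Rintegral measurableT (integrable_acos l))).
apply: le_Rintegral => //.
- exact: integrable_norm (integrable_acos l).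
- exact: integrable_norm ia.
- by move=> s _; rewrite normrM ler_piMr// cos_norm_le1.
Qed.

Let S_le l : `|S l| <= N1.
Proof.
apply: (le_trans (le_normr_Rintegral measurableT (integrable_asin l))).
apply: le_Rintegral => //.
- exact: integrable_norm (integrable_asin l).
- exact: integrable_norm ia.
- by move=> s _; rewrite normrM ler_piMr// sin_norm_le1.
Qed.

Let mprod (f : R -> R) : measurable_fun setT f -> measurable_fun setT (fun p : measurableTypeR R * measurableTypeR R => f (p.1 * p.2)).
Proof.
move=> mf; apply: (measurableT_comp mf); apply: measurable_funM.
  exact: measurable_fst.
exact: measurable_snd.
Qed.

Let mC : measurable_fun setT (C : measurableTypeR R -> R).
Proof.
apply: (@measurable_param_Rintegral _ _ (measurableTypeR R) _ _ mu (fun p => a p.2 * cos (p.1 * p.2))).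
apply: measurable_funM; first exact: (measurableT_comp ma measurable_snd).
by apply: (mprod (f := cos)); exact: measurable_cos.
Qed.

Let mS : measurable_fun setT (S : measurableTypeR R -> R).
Proof.
apply: (@measurable_param_Rintegral _ _ (measurableTypeR R) _ _ mu (fun p => a p.2 * sin (p.1 * p.2))).
apply: measurable_funM; first exact: (measurableT_comp ma measurable_snd).
by apply: (mprod (f := sin)); exact: measurable_sin.
Qed.

(* Integrand of [T (C^2 + S^2)], with one factor of each square expanded. *)
Let G (p : R * R) : R := T p.1 * (C p.1 * cos (p.1 * p.2) + S p.1 * sin (p.1 * p.2)) * a p.2.

Let integrable_G : (mu \x mu)%E.-integrable setT (EFin \o G).
Proof.
have i1 := integrable_prodM integrable_T ia.
have -> : EFin \o G = EFin \o (fun p => T p.1 * a p.2 * (C p.1 * cos (p.1 * p.2) + S p.1 * sin (p.1 * p.2))).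
  by apply/funext => p; rewrite /G/=; congr EFin; ring.
apply: (@integrable_bounded_mul _ _ _ _ _ _ (N1 + N1) i1).
  apply: measurable_funD; apply: measurable_funM.
  - exact: (measurableT_comp mC measurable_fst).
  - by apply: (mprod (f := cos)); exact: measurable_cos.
  - exact: (measurableT_comp mS measurable_fst).
  - by apply: (mprod (f := sin)); exact: measurable_sin.
move=> p; apply: (le_trans (ler_normD _ _)); apply: lerD; rewrite normrM -[leRHS]mulr1; apply: ler_pM => //.
  by rewrite cos_norm_le1.
by rewrite sin_norm_le1.
Qed.

Let H (p : R * R) : R := a p.1 * a p.2 * That (p.1 - p.2).

(** Fubini and the addition formula for the cosine turn the weighted energy into a quadratic form in
    [a] with kernel [That (s - t)]. *)
Let TCS : \int[mu]_l (T l * (C l ^+ 2 + S l ^+ 2)) = \int[mu]_s \int[mu]_t H (s, t).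
Proof.
transitivity (\int[mu]_l \int[mu]_s G (l, s)).
  apply: eq_Rintegral => l _.
  have -> : (fun s => G (l, s)) = (fun s => T l * C l * (a s * cos (l * s)) + T l * S l * (a s * sin (l * s))).
    by apply/funext => s; rewrite /G/=; ring.
  rewrite RintegralD//; last 2 first.
  - exact: (integrableZl measurableT _ (integrable_acos l)).
  - exact: (integrableZl measurableT _ (integrable_asin l)).
  rewrite (RintegralZl _ measurableT (integrable_acos l)) (RintegralZl _ measurableT (integrable_asin l)).
  by rewrite -/(C l) -/(S l); ring.
rewrite -(Rintegral_fubini1 integrable_G) (Rintegral_fubini2 integrable_G).
apply: eq_Rintegral => s _.
have i2 : (mu \x mu)%E.-integrable setT (EFin \o (fun p : R * R => T p.1 * a p.2 * cos (p.1 * (s - p.2)))).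
  apply: (@integrable_bounded_mul _ _ _ _ _ _ 1 (integrable_prodM integrable_T ia)).
    apply: (measurableT_comp (@measurable_cos R)); apply: measurable_funM; first exact: measurable_fst.
    by apply: measurable_funB; [exact: measurable_cst|exact: measurable_snd].
  by move=> p; rewrite cos_norm_le1.
transitivity (a s * \int[mu]_l \int[mu]_t (T l * a t * cos (l * (s - t)))).
  rewrite -(RintegralZl _ measurableT (integrable_Rintegral1 i2)).
  apply: eq_Rintegral => l _.
  have -> : (fun t => T l * a t * cos (l * (s - t))) = (fun t => T l * cos (l * s) * (a t * cos (l * t)) + T l * sin (l * s) * (a t * sin (l * t))).
    by apply/funext => t; rewrite mulrBr cosB; ring.
  rewrite RintegralD//; last 2 first.
  - exact: (integrableZl measurableT _ (integrable_acos l)).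
  - exact: (integrableZl measurableT _ (integrable_asin l)).
  rewrite (RintegralZl _ measurableT (integrable_acos l)) (RintegralZl _ measurableT (integrable_asin l)).
  rewrite -/(C l) -/(S l) /G/=; ring.
rewrite -(Rintegral_fubini1 i2) (Rintegral_fubini2 i2) /H/=.
rewrite -(RintegralZl _ measurableT (integrable_Rintegral2 i2)).
apply: eq_Rintegral => t _ /=; rewrite -mulrA; congr (_ * _).
by rewrite -(RintegralZl _ measurableT (integrable_That _)); apply: eq_Rintegral => l _; ring.
Qed.

Let mThat : measurable_fun setT (That : measurableTypeR R -> R).
Proof.
apply: (@measurable_param_Rintegral _ _ (measurableTypeR R) _ _ mu (fun p => T p.2 * cos (p.2 * p.1))).
apply: measurable_funM; first exact: (measurableT_comp (measurable_integrable integrable_T) measurable_snd).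
apply: (measurableT_comp (@measurable_cos R)); apply: measurable_funM.
  exact: measurable_snd.
exact: measurable_fst.
Qed.

Let integrable_H : (mu \x mu)%E.-integrable setT (EFin \o H).
Proof.
apply: (@integrable_bounded_mul _ _ _ _ _ _ K (integrable_prodM ia ia)).
  apply: (measurableT_comp mThat); apply: measurable_funB.
    exact: measurable_fst.
  exact: measurable_snd.
move=> p; apply: (le_trans (That_oneDsqr _)); rewrite ler_piMr// ?oneDsqrV_le1//.
exact: ltW band_const_gt0.
Qed.

Let A2 := \int[mu]_s (a s ^+ 2).

Let ma2 := measurable_integrable ia2.

Let A2E : (\int[mu]_s (a s ^+ 2)%:E = A2%:E)%E.
Proof. by rewrite /A2 /Rintegral fineK//; exact: (integrable_fin_num measurableT ia2). Qed.

Let Q1 (p : R * R) : R := a p.1 ^+ 2 * (oneDsqr (p.2 - p.1))^-1.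
Let Q2 (p : R * R) : R := a p.2 ^+ 2 * (oneDsqr (p.1 - p.2))^-1.

Let mQ1 : measurable_fun setT (Q1 : measurableTypeR R * measurableTypeR R -> R).
Proof.
apply: measurable_funM; first exact: (measurableT_comp ma2 measurable_fst).
by apply: (measurableT_comp mK); apply: measurable_funB; [exact: measurable_snd|exact: measurable_fst].
Qed.

Let mQ2 : measurable_fun setT (Q2 : measurableTypeR R * measurableTypeR R -> R).
Proof.
apply: measurable_funM; first exact: (measurableT_comp ma2 measurable_snd).
by apply: (measurableT_comp mK); apply: measurable_funB; [exact: measurable_fst|exact: measurable_snd].
Qed.

Let oneDsqrV_ge0 (x : R) : 0 <= (oneDsqr x)^-1.
Proof. by rewrite invr_ge0 (le_trans _ (oneDsqr_ge1 x)). Qed.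

Let section_Q (s : R) : (\int[mu]_t (a s ^+ 2 * (oneDsqr (t - s))^-1)%:E = pi%:E * (a s ^+ 2)%:E)%E.
Proof.
under eq_integral do rewrite EFinM.
rewrite ge0_integralZl//.
- by rewrite integral_oneDsqr_sub muleC.
- apply/measurable_EFinP; apply: (measurableT_comp mK).
  by apply: measurable_funB => //; exact: measurable_cst.
- by rewrite lee_fin sqr_ge0.
Qed.

Let integral_section_Q : (\int[mu]_s (pi%:E * (a s ^+ 2)%:E) = (pi * A2)%:E)%E.
Proof.
rewrite ge0_integralZl//; first by rewrite A2E.
- exact/measurable_EFinP.
- by move=> s _; rewrite lee_fin sqr_ge0.
- by rewrite lee_fin pi_ge0.
Qed.

Let Q1_ge0 p : 0 <= Q1 p. Proof. by rewrite mulr_ge0 ?sqr_ge0. Qed.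
Let Q2_ge0 p : 0 <= Q2 p. Proof. by rewrite mulr_ge0 ?sqr_ge0. Qed.

Let integral_Q1 : (\int[mu \x mu]_p (Q1 p)%:E = (pi * A2)%:E)%E.
Proof.
rewrite (fubini_tonelli1 (fun p : measurableTypeR R * measurableTypeR R => (Q1 p)%:E)); last 2 first.
- exact/measurable_EFinP.
- by move=> p; rewrite lee_fin.
by rewrite -integral_section_Q; apply: eq_integral => s _; exact: section_Q.
Qed.

Let integral_Q2 : (\int[mu \x mu]_p (Q2 p)%:E = (pi * A2)%:E)%E.
Proof.
rewrite (fubini_tonelli2 (fun p : measurableTypeR R * measurableTypeR R => (Q2 p)%:E)); last 2 first.
- exact/measurable_EFinP.
- by move=> p; rewrite lee_fin.
by rewrite -integral_section_Q; apply: eq_integral => s _; exact: section_Q.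
Qed.

Let integrable_Q (Q : measurableTypeR R * measurableTypeR R -> R) : measurable_fun setT Q -> (forall p, 0 <= Q p) ->
  (\int[mu \x mu]_p (Q p)%:E = (pi * A2)%:E)%E -> (mu \x mu)%E.-integrable setT (EFin \o Q).
Proof.
move=> mQ Q0 iQ; apply/integrableP; split; first exact/measurable_EFinP.
under eq_integral do rewrite /= ger0_norm//.
by rewrite iQ ltry.
Qed.

Let K_ge0 : 0 <= K. Proof. exact: ltW band_const_gt0. Qed.

Let integrable_TCS : mu.-integrable setT (EFin \o (fun l => T l * (C l ^+ 2 + S l ^+ 2))).
Proof.
apply: (@integrable_bounded_mul _ _ _ _ _ _ (N1 ^+ 2 + N1 ^+ 2) integrable_T).
  by apply: measurable_funD; apply: measurable_funX; [exact: mC|exact: mS].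
have N0 : 0 <= N1 by exact: Rintegral_ge0.
move=> l; rewrite ger0_norm ?addr_ge0 ?sqr_ge0//.
by rewrite -(sqr_norm (C l)) -(sqr_norm (S l)); apply: lerD; rewrite lerXn2r ?nnegrE.
Qed.

(** Schur's test: the product of two values of [a] is at most half the sum of their squares, and the
    kernel bound [K / oneDsqr (s - t)] has integral [K * pi] in either variable. *)
Let weighted_plancherel_R :
  \int[mu]_l (T l * (C l ^+ 2 + S l ^+ 2)) <= K * pi * \int[mu]_s (a s ^+ 2).
Proof.
rewrite TCS -(Rintegral_fubini1 integrable_H).
have i1 := integrable_Q mQ1 Q1_ge0 integral_Q1.
have i2 := integrable_Q mQ2 Q2_ge0 integral_Q2.
have i12 : (mu \x mu)%E.-integrable setT (EFin \o (fun p => Q1 p + Q2 p)).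
  exact: (integrableD measurableT i1 i2).
apply: (@le_trans _ _ (\int[(mu \x mu)%E]_p (K / 2 * (Q1 p + Q2 p)))).
  apply: (le_Rintegral measurableT integrable_H (integrableZl measurableT (K / 2) i12)).
  move=> p _; apply: (le_trans (ler_norm _)).
  rewrite /H normrM /Q1 /Q2 (_ : oneDsqr (p.2 - p.1) = oneDsqr (p.1 - p.2)); last first.
    by rewrite /oneDsqr -sqrrN opprB.
  rewrite -mulrDl mulrCA mulrA.
  rewrite (_ : _ * (K / 2) / _ = ((a p.1 ^+ 2 + a p.2 ^+ 2) / 2) * (K / oneDsqr (p.1 - p.2))); last by ring.
  apply: ler_pM => //; rewrite normrM -(sqr_norm (a p.1)) -(sqr_norm (a p.2)).
  have := sqr_ge0 (`|a p.1| - `|a p.2|); nra.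
rewrite (RintegralZl _ measurableT i12) RintegralD//.
have -> : \int[(mu \x mu)%E]_p Q1 p = pi * A2 by rewrite /Rintegral integral_Q1.
have -> : \int[(mu \x mu)%E]_p Q2 p = pi * A2 by rewrite /Rintegral integral_Q2.
by rewrite le_eqVlt; apply/orP; left; apply/eqP; rewrite /A2; field.
Qed.

Lemma weighted_plancherel_le : (\int[mu]_l (band_weight l *
    ((\int[mu]_s (a s * cos (l * s))) ^+ 2 + (\int[mu]_s (a s * sin (l * s))) ^+ 2))%:E
  <= (band_const * pi)%:E * \int[mu]_s (a s ^+ 2)%:E)%E.
Proof.
have := weighted_plancherel_R; rewrite -lee_fin EFinM -A2E.
by rewrite /Rintegral fineK//; exact: (integrable_fin_num measurableT integrable_TCS).
Qed.

End one_function.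

End band_limited_plancherel.

Section band_fourier.
Context (R : realType).
Local Notation mu := (@lebesgue_measure R).

(** Instead of Cauchy-Schwarz, [N <= e / 2 + N ^+ 2 / (2 * e)] is used pointwise: the result is
    linear in the square integral, can be integrated over further variables, and is of order [e]
    once that integral is at most [e ^+ 2]. *)
Lemma fourier_band_L1 (A : R) : 0 < A -> exists2 K, 0 < K & forall (h : R -> R[i]) (e : R),
  cintegrable mu h -> 0 < e ->
  (\int[mu]_(l in `[(- A)%R, A]) (Normc.normc (fourier h l))%:E <=
   (e * A)%:E + (K / e)%:E * \int[mu]_t (Normc.normc (h t) ^+ 2)%:E)%E.
Proof.
(* The weight of the doubled band, [4 * A ^+ 2 - l ^+ 2], is at least [3 * A ^+ 2] on [[-A, A]]. *)
move=> A0; have B0 : 0 < 2 * A by rewrite mulr_gt0.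
exists (band_const (2 * A) * pi / (3 * A ^+ 2)) => [|h e ih e0].
  by rewrite divr_gt0 ?mulr_gt0 ?exprn_gt0 ?pi_gt0 ?band_const_gt0.
set K0 := band_const _ * _ / _; have mh := cintegrable_measurable ih.
have K00 : 0 < K0 by rewrite divr_gt0 ?mulr_gt0 ?exprn_gt0 ?pi_gt0 ?band_const_gt0.
have mh2 : measurable_fun setT (fun t => Normc.normc (h t) ^+ 2).
  by apply: measurable_funX; exact: measurable_fun_normc.
have [hoo|hfin] := eqVneq (\int[mu]_t (Normc.normc (h t) ^+ 2)%:E)%E +oo%E.
  have K0e : (0 < (K0 / e)%:E)%E by rewrite lte_fin divr_gt0.
  by rewrite hoo (gt0_muley K0e) addey// leey.
have ih2 : mu.-integrable setT (EFin \o (fun t => Normc.normc (h t) ^+ 2)).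
  apply/integrableP; split; first exact/measurable_EFinP.
  under eq_integral do rewrite /= ger0_norm ?sqr_ge0//.
  by rewrite ltey.
pose a t := complex.Re (h t); pose b t := complex.Im (h t).
have [ia ib] := ih.
have sqR (z : R[i]) : Normc.normc z ^+ 2 = complex.Re z ^+ 2 + complex.Im z ^+ 2 by exact: normc_sqr.
have ia2 : mu.-integrable setT (EFin \o (fun t => a t ^+ 2)).
  apply: (integrable_dominated _ ih2) => [|t].
    by apply: measurable_funX; exact: measurable_integrable ia.
  by rewrite ger0_norm ?sqr_ge0// sqR lerDl sqr_ge0.
have ib2 : mu.-integrable setT (EFin \o (fun t => b t ^+ 2)).
  apply: (integrable_dominated _ ih2) => [|t].
    by apply: measurable_funX; exact: measurable_integrable ib.
  by rewrite ger0_norm ?sqr_ge0// sqR lerDr sqr_ge0.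
have Pa := weighted_plancherel_le B0 ia ia2.
have Pb := weighted_plancherel_le B0 ib ib2.
pose Sa l := (\int[mu]_s (a s * cos (l * s))) ^+ 2 + (\int[mu]_s (a s * sin (l * s))) ^+ 2.
pose Sb l := (\int[mu]_s (b s * cos (l * s))) ^+ 2 + (\int[mu]_s (b s * sin (l * s))) ^+ 2.
have bound l : l \in `[- A, A]%classic ->
    Normc.normc (fourier h l) <= e / 2 + (3 * A ^+ 2 * e)^-1 * (band_weight (2 * A) l * Sa l + band_weight (2 * A) l * Sb l).
  rewrite inE/= in_itv/= => /andP[Al lA].
  have wl : 3 * A ^+ 2 <= band_weight (2 * A) l.
    rewrite /band_weight indicE mem_set/=; last by rewrite in_itv/=; apply/andP; split; lra.
    by rewrite mulr1; nra.
  have Sa0 : 0 <= Sa l by rewrite addr_ge0// sqr_ge0.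
  have Sb0 : 0 <= Sb l by rewrite addr_ge0// sqr_ge0.
  (* The parts of the transform are [ca + sb] and [cb - sa]; the factor 2 comes from squaring these
     sums. *)
  have N2 : Normc.normc (fourier h l) ^+ 2 <= 2 * (Sa l + Sb l).
    have icos (u : R -> R) : mu.-integrable setT (EFin \o u) ->
        mu.-integrable setT (EFin \o (fun t => u t * cos (l * t))).
      move=> iu; apply: (@integrable_bounded_mul _ _ _ _ _ _ 1) => // [|t]; last exact: cos_norm_le1.
      by apply: (measurableT_comp (@measurable_cos R)); exact: mulrl_measurable.
    have isin (u : R -> R) : mu.-integrable setT (EFin \o u) ->
        mu.-integrable setT (EFin \o (fun t => u t * sin (l * t))).
      move=> iu; apply: (@integrable_bounded_mul _ _ _ _ _ _ 1) => // [|t]; last exact: sin_norm_le1.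
      by apply: (measurableT_comp (@measurable_sin R)); exact: mulrl_measurable.
    rewrite sqR /fourier/=.
    have -> : \int[mu]_x complex.Re (h x * cis (- (l * x))) =
        \int[mu]_x (a x * cos (l * x)) + \int[mu]_x (b x * sin (l * x)).
      rewrite -(RintegralD measurableT (icos _ ia) (isin _ ib)); apply: eq_Rintegral => x _.
      by rewrite ReM/= cosN sinN; ring.
    have -> : \int[mu]_x complex.Im (h x * cis (- (l * x))) =
        \int[mu]_x (b x * cos (l * x)) - \int[mu]_x (a x * sin (l * x)).
      rewrite -(RintegralB measurableT (icos _ ib) (isin _ ia)); apply: eq_Rintegral => x _.
      by rewrite ImM/= cosN sinN; ring.
    rewrite /Sa /Sb.
    set ca := \int[mu]_x (a x * cos (l * x)); set sa := \int[mu]_x (a x * sin (l * x)).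
    set cb := \int[mu]_x (b x * cos (l * x)); set sb := \int[mu]_x (b x * sin (l * x)).
    have := sqr_ge0 (ca - sb); have := sqr_ge0 (cb + sa); nra.
  have N1 : Normc.normc (fourier h l) <= e / 2 + Normc.normc (fourier h l) ^+ 2 / (2 * e).
    set N := Normc.normc _; have := sqr_ge0 (N - e) => h1.
    rewrite (_ : e / 2 + N ^+ 2 / (2 * e) = (e ^+ 2 + N ^+ 2) / (2 * e)); last by field; rewrite gt_eqF.
    by rewrite ler_pdivlMr ?mulr_gt0//; nra.
  apply: (le_trans N1); rewrite lerD2l -mulrDr.
  rewrite ler_pdivrMr ?mulr_gt0//.
  rewrite (_ : _ * (2 * e) = 2 * (band_weight (2 * A) l * (Sa l + Sb l)) / (3 * A ^+ 2)); last first.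
    by field; rewrite !gt_eqF// exprn_gt0.
  rewrite ler_pdivlMr; last by rewrite mulr_gt0// exprn_gt0.
  have := ler_wpM2r (addr_ge0 Sa0 Sb0) wl.
  have : 0 <= 3 * A ^+ 2 by rewrite mulr_ge0// sqr_ge0.
  move=> A2 h1; apply: (le_trans (ler_wpM2r A2 N2)); nra.
have mcs (u v : R -> R) : measurable_fun setT u -> measurable_fun setT v ->
    measurable_fun setT (fun l : measurableTypeR R => \int[mu]_s (u s * v (l * s))).
  move=> mu' mv; apply: (@measurable_param_Rintegral _ _ (measurableTypeR R) _ _ mu (fun p => u p.2 * v (p.1 * p.2))).
  apply: measurable_funM; first exact: (measurableT_comp mu' measurable_snd).
  apply: (measurableT_comp mv); apply: measurable_funM; [exact: measurable_fst|exact: measurable_snd].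
have mw : measurable_fun setT (band_weight (2 * A)).
  apply: measurable_funM; last exact: measurable_indic.
  by apply: measurable_funB; [exact: measurable_cst|exact: measurable_funX].
have mSa : measurable_fun setT (fun l => band_weight (2 * A) l * Sa l).
  apply: measurable_funM => //; apply: measurable_funD; apply: measurable_funX.
    exact: (mcs _ _ (measurable_integrable ia) (@measurable_cos R)).
  exact: (mcs _ _ (measurable_integrable ia) (@measurable_sin R)).
have mSb : measurable_fun setT (fun l => band_weight (2 * A) l * Sb l).
  apply: measurable_funM => //; apply: measurable_funD; apply: measurable_funX.
    exact: (mcs _ _ (measurable_integrable ib) (@measurable_cos R)).
  exact: (mcs _ _ (measurable_integrable ib) (@measurable_sin R)).
have mN : measurable_fun setT (fun l : measurableTypeR R => Normc.normc (fourier h l)).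
  apply: measurable_fun_normc.
  apply: (@measurable_param_cintegral _ _ (measurableTypeR R) _ _ mu (fun p => h p.2 * cis (- (p.1 * p.2)))).
  apply: measurable_funC_M; first exact: (measurableT_comp mh measurable_snd).
  apply: measurable_fun_cis; apply: (measurableT_comp (@oppr_measurable R setT)).
  apply: measurable_funM; [exact: measurable_fst|exact: measurable_snd].
have w0 l : 0 <= band_weight (2 * A) l by exact: band_weight_ge0.
have Sa0 l : 0 <= band_weight (2 * A) l * Sa l by rewrite mulr_ge0// addr_ge0// sqr_ge0.
have Sb0 l : 0 <= band_weight (2 * A) l * Sb l by rewrite mulr_ge0// addr_ge0// sqr_ge0.
have c0 : 0 <= (3 * A ^+ 2 * e)^-1 by rewrite invr_ge0 !mulr_ge0// ?sqr_ge0// ltW.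
apply: (@le_trans _ _ (\int[mu]_(l in `[(- A)%R, A]) ((e / 2)%:E + ((3 * A ^+ 2 * e)^-1 * (band_weight (2 * A) l * Sa l + band_weight (2 * A) l * Sb l))%:E))%E).
  apply: ge0_le_integral => //.
  - by move=> l _; rewrite lee_fin normc_ge0.
  - by apply/measurable_EFinP; exact: measurable_funTS.
  - apply: emeasurable_funD; first exact: measurable_cst.
    apply/measurable_EFinP; apply: measurable_funTS; apply: measurable_funM; first exact: measurable_cst.
    exact: measurable_funD.
  - by move=> l Al; rewrite -EFinD lee_fin; apply: bound; rewrite inE.
rewrite ge0_integralD//; last 3 first.
- by move=> l _; rewrite lee_fin divr_ge0// ltW.
- by move=> l _; rewrite lee_fin mulr_ge0// addr_ge0.
- apply/measurable_EFinP; apply: measurable_funTS; apply: measurable_funM; first exact: measurable_cst.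
  exact: measurable_funD.
rewrite integral_cst//= lebesgue_measure_itv/= lte_fin gtrN//; apply: leeD.
  by rewrite -EFinB -EFinM lee_fin opprK; lra.
have mSS : measurable_fun setT (fun l => band_weight (2 * A) l * Sa l + band_weight (2 * A) l * Sb l).
  exact: measurable_funD.
apply: (@le_trans _ _ (\int[mu]_l ((3 * A ^+ 2 * e)^-1 * (band_weight (2 * A) l * Sa l + band_weight (2 * A) l * Sb l))%:E)%E).
  apply: ge0_subset_integral => //.
    by apply/measurable_EFinP; apply: measurable_funM => //; exact: measurable_cst.
  by move=> l _; rewrite lee_fin mulr_ge0// addr_ge0.
under eq_integral do rewrite EFinM.
rewrite ge0_integralZl//; last 2 first.
- exact/measurable_EFinP.
- by move=> l _; rewrite lee_fin addr_ge0.
under eq_integral do rewrite EFinD.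
rewrite ge0_integralD//; last 4 first.
- by move=> l _; rewrite lee_fin.
- exact/measurable_EFinP.
- by move=> l _; rewrite lee_fin.
- exact/measurable_EFinP.
have -> : (\int[mu]_t (Normc.normc (h t) ^+ 2)%:E = \int[mu]_t (a t ^+ 2)%:E + \int[mu]_t (b t ^+ 2)%:E)%E.
  rewrite -ge0_integralD//.
  - by apply: eq_integral => t _; rewrite sqR.
  - by move=> t _; rewrite lee_fin sqr_ge0.
  - exact: (measurable_int _ ia2).
  - by move=> t _; rewrite lee_fin sqr_ge0.
  - exact: (measurable_int _ ib2).
have -> : (K0 / e)%:E = ((3 * A ^+ 2 * e)^-1%:E * (band_const (2 * A) * pi)%:E)%E.
  by rewrite -EFinM; congr EFin; rewrite /K0; field; rewrite !gt_eqF.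
rewrite -muleA; apply: lee_wpmul2l; first by rewrite lee_fin.
rewrite ge0_muleDr; last 2 first.
- by apply: integral_ge0 => t _; rewrite lee_fin sqr_ge0.
- by apply: integral_ge0 => t _; rewrite lee_fin sqr_ge0.
exact: leeD.
Qed.

End band_fourier.

(** * Gaussian bounds for Laguerre functions *)

Section laguerre_gaussian_bound.
Context (R : realType) (n : nat).
Local Notation mun := (@lebesgue_Cn R n).

Lemma poly_expR_le (p : {poly R}) (a : R) : 0 < a ->
  exists2 C, 0 <= C & forall x, 0 <= x -> `|p.[x]| * expR (- (a * x)) <= C.
Proof.
move=> a0; exists (\sum_(i < size p) `|p`_i| * (i`!%:R / a ^+ i)) => [|x x0].
  by apply: sumr_ge0 => i _; rewrite mulr_ge0// divr_ge0// exprn_ge0// ltW.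
rewrite horner_coef; apply: (@le_trans _ _ ((\sum_(i < size p) `|p`_i * x ^+ i|) * expR (- (a * x)))).
  by rewrite ler_wpM2r ?expR_ge0// ler_norm_sum.
rewrite mulr_suml; apply: ler_sum => i _; rewrite normrM -mulrA ler_wpM2l//.
by rewrite ger0_norm ?exprn_ge0// expr_expR_le.
Qed.

Lemma sqnorm_ge0 (z : Cn R n) : 0 <= sqnorm z.
Proof. by apply: sumr_ge0 => j _; exact: sqr_ge0. Qed.

(** The Gaussian is split into two equal factors: one bounds the polynomial in [X] uniformly, the
    other decays at least at rate [M / 8]. Hence [C] depends on [k] but not on [l]. *)
Lemma phi_le_gauss k (M : R) : 0 < M -> exists2 C, 0 <= C &
  forall l (z : Cn R n), M <= `|l| -> `|phi k l z| <= C * expR (- (M / 8 * sqnorm z)).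
Proof.
move=> M0; have a0 : 0 < 4^-1 :> R by rewrite invr_gt0.
have [C C0 HC] := poly_expR_le (laguerre R (n - 1) k) a0.
exists C => // l z Ml; have s0 := sqnorm_ge0 z.
rewrite /phi normrM (ger0_norm (expR_ge0 _)); set X := 2^-1 * _ * _.
have X0 : 0 <= X by rewrite !mulr_ge0 ?invr_ge0.
have -> : expR (- (4^-1 * `|l| * sqnorm z)) = expR (- (4^-1 * X)) * expR (- (4^-1 * X)).
  by rewrite -expRD; congr expR; rewrite /X; field.
rewrite mulrA; apply: ler_pM; [by rewrite mulr_ge0 ?expR_ge0|exact: expR_ge0|exact: HC|].
rewrite ler_expR lerN2 /X; have := ler_wpM2r s0 Ml.
by rewrite (_ : 4^-1 * _ = `|l| * sqnorm z / 8); [lra|field].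
Qed.

(** The integral factors over the [2 n] real coordinates into [(pi / s ^ 2) ^ n]; that this value is
    the same for all [w] makes later estimates uniform in [w]. *)
Lemma integral_gauss_Cn (s : R) : 0 < s -> exists2 K, 0 <= K & forall w,
  mun.-integrable setT (EFin \o (fun z => expR (- (s ^+ 2 * sqnorm [tuple - tnth z j + tnth w j | j < n])))) /\
  \int[mun]_z expR (- (s ^+ 2 * sqnorm [tuple - tnth z j + tnth w j | j < n])) = K.
Proof.
move=> s0.
pose h (u z : R[i]) : R[i] := (expR (- (s ^+ 2 * Normc.normc (- z + u) ^+ 2)))%:C%C.
pose g (c x : R) : R := gauss (s * (x - c)).
have ig c : (@lebesgue_measure R).-integrable setT (EFin \o g c).
  by apply: eq_integrable (integrable_affine (- (s * c)) s0 (integrable_gauss R)) => // x _; rewrite /= /g mulrBr.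
have eg c : \int[@lebesgue_measure R]_x g c x = s^-1.
  have := Rintegral_affine (- (s * c)) s0 (integrable_gauss R); rewrite Rintegral_gauss.
  under eq_Rintegral do rewrite -mulrBr -/(g c _).
  by move=> /(congr1 (fun x => s^-1 * x)); rewrite mulr1 mulrA mulVf ?gt_eqF// mul1r.
have ppE : pi * ((Num.sqrt pi)^-1 * (Num.sqrt pi)^-1) = 1 :> R.
  by rewrite -invfM -expr2 sqr_sqrtr ?pi_ge0// mulfV// gt_eqF// pi_gt0.
have hE u p : h u (p.1 +i* p.2)%C = (pi * (g (complex.Re u) p.1 * g (complex.Im u) p.2))%:C%C.
  rewrite /h normc_sqr /g /gauss /gauss_fun/=; congr (_%:C)%C.
  rewrite [X in _ = pi * X]mulrACA [RHS]mulrA ppE mul1r.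
  by rewrite -expRD; congr expR; case: u => u1 u2 /=; ring.
have mh u : measurable_fun setT (h u).
  apply: measurable_funC_real; apply: (measurableT_comp (@measurable_expR R)).
  apply: (measurableT_comp (@oppr_measurable R setT)); apply: measurable_funM => //.
  apply: measurable_funX; apply: measurable_fun_normc; apply: measurable_funC_D => //.
  exact: measurable_funC_N.
have igg u := integrable_prodM (ig (complex.Re u)) (ig (complex.Im u)).
have ih u : cintegrable (@lebesgue_C R) (h u).
  apply/(cintegrable_transport (@measurable_complex_of_parts R) (@lebesgue_C_pushforward R) (mh u)).
  rewrite (_ : h u \o _ = fun p => (pi * (g (complex.Re u) p.1 * g (complex.Im u) p.2))%:C%C).
    exact: (cintegrable_real (integrableZl measurableT pi (igg u))).
  by apply/funext => p; rewrite /= -hE.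
have eh u : cintegral (@lebesgue_C R) (h u) = (pi * (s^-1 * s^-1))%:C%C.
  rewrite (cintegral_transport (@measurable_complex_of_parts R) (@lebesgue_C_pushforward R) (ih u)).
  rewrite (_ : h u \o _ = fun p => (pi * (g (complex.Re u) p.1 * g (complex.Im u) p.2))%:C%C); last first.
    by apply/funext => p; rewrite /= -hE.
  rewrite cintegral_real (RintegralZl _ measurableT (igg u)); congr (_ * _)%:C%C.
  rewrite (Rintegral_fubini1 (igg u)) /=.
  under eq_Rintegral do rewrite (RintegralZl _ measurableT (ig _)) eg mulrC.
  by rewrite (RintegralZl _ measurableT (ig _)) eg.
exists ((pi * (s^-1 * s^-1)) ^+ n) => [|w].
  by rewrite exprn_ge0// mulr_ge0 ?pi_ge0// mulr_ge0// invr_ge0 ltW.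
have [iP eP] := tuple_prod (fun j => ih (tnth w j)).
have PE : (fun z : Cn R n => \prod_(j < n) h (tnth w j) (tnth z j)) =
    (fun z => (expR (- (s ^+ 2 * sqnorm [tuple - tnth z j + tnth w j | j < n])))%:C%C).
  apply/funext => z; rewrite -rmorph_prod/= -expR_sum /sqnorm mulr_sumr -sumrN; congr (expR _)%:C%C.
  by apply: eq_bigr => j _; rewrite tnth_mktuple.
move: iP eP; rewrite PE cintegral_real => iP eP; split; first exact: iP.1.
have := congr1 (@complex.Re R) eP; rewrite /= => ->.
under eq_bigr do rewrite eh.
by rewrite -rmorph_prod/= prodr_const card_ord.
Qed.

End laguerre_gaussian_bound.

(** * The transform along one ray *)

Section ray_transform.
Context (R : realType) (n : nat).
Local Notation mu := (@lebesgue_measure R).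
Local Notation mun := (@lebesgue_Cn R n).

(* The Strichartz transform along the ray [R_k], without the factor [c_nk]. *)
Definition ray_transform (k : nat) (v : Heis R n -> R[i]) (x : measurableTypeR R * Cn R n) : R[i] :=
  cintegral haar (fun p => v p * e_kl k x.1 (hmul (hinv p) (x.2, 0 : R))).

Lemma measurable_phi k d (T : measurableType d) (l : T -> R) (z : T -> Cn R n) :
  measurable_fun setT l -> measurable_fun setT z ->
  measurable_fun setT (fun x => phi k (l x) (z x)).
Proof.
move=> ml mz.
have ms : measurable_fun setT (fun x => sqnorm (z x)) by exact: (measurableT_comp (@measurable_sqnorm R n) mz).
have mal : measurable_fun setT (fun x => `|l x|) by exact: (measurableT_comp (@normr_measurable R setT) ml).
apply: measurable_funM.
  apply: (measurableT_comp (f := fun x => (laguerre R (n - 1) k).[x])).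
    by apply: continuous_measurable_fun; exact: continuous_horner.
  by apply: measurable_funM => //; apply: measurable_funM => //; exact: measurable_cst.
apply: (measurableT_comp (@measurable_expR R)); apply: (measurableT_comp (@oppr_measurable R setT)).
by apply: measurable_funM => //; apply: measurable_funM => //; exact: measurable_cst.
Qed.

Lemma measurable_twisted_kernel k d (T : measurableType d) (l : T -> R) (z w : T -> Cn R n) :
  measurable_fun setT l -> measurable_fun setT z -> measurable_fun setT w ->
  measurable_fun setT (fun x => twisted_kernel k (l x) (z x) (w x)).
Proof.
move=> ml mz mw; apply: measurable_funC_M.
  apply: measurable_fun_cis; apply: measurable_funM.
    by apply: (measurableT_comp (@oppr_measurable R setT)); apply: measurable_funM => //; exact: measurable_cst.
  by apply: (measurableT_comp (@measurable_Im R)); exact: measurable_hermitian.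
by apply: measurable_funC_real; apply: measurable_phi => //; exact: measurable_tuple_sub.
Qed.

Lemma measurable_ray_transform k (v : Heis R n -> R[i]) : measurable_fun setT v ->
  measurable_fun setT (ray_transform k v).
Proof.
move=> mv.
apply: (@measurable_param_cintegral _ _ _ _ _ (@haar R n)
  (fun q => v q.2 * e_kl k q.1.1 (hmul (hinv q.2) (q.1.2, 0 : R)))).
apply: measurable_funC_M; first exact: (measurableT_comp mv measurable_snd).
rewrite (_ : (fun q => _) = fun q : (measurableTypeR R * Cn R n) * Heis R n =>
    cis (- (q.1.1 * q.2.2)) * twisted_kernel k q.1.1 q.2.1 q.1.2); last first.
  by apply/funext => -[[l w] [z t]]; rewrite e_kl_twisted.
have m11 : measurable_fun setT (fun q : (measurableTypeR R * Cn R n) * Heis R n => (q.1.1 : R)).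
  exact: (measurableT_comp measurable_fst measurable_fst).
have m22 : measurable_fun setT (fun q : (measurableTypeR R * Cn R n) * Heis R n => (q.2.2 : R)).
  exact: (measurableT_comp measurable_snd measurable_snd).
apply: measurable_funC_M.
  apply: measurable_fun_cis; apply: (measurableT_comp (@oppr_measurable R setT)).
  exact: measurable_funM.
apply: measurable_twisted_kernel => //.
- exact: (measurableT_comp measurable_fst measurable_snd).
- exact: (measurableT_comp measurable_snd measurable_fst).
Qed.

Variables (k : nat) (M : R).
Hypothesis M0 : 0 < M.

Lemma cintegrable_ray_kernel (v : Heis R n -> R[i]) l w : cintegrable haar v -> M <= `|l| ->
  cintegrable haar (fun p => v p * e_kl k l (hmul (hinv p) (w, 0 : R))).
Proof.
move=> iv Ml; have [C C0 HC] := phi_le_gauss n k M0.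
rewrite (_ : (fun p => _) = fun p : Heis R n => v p * (cis (- (l * p.2)) * twisted_kernel k l p.1 w)); last first.
  by apply/funext => -[z t]; rewrite e_kl_twisted.
apply: (@cintegrableMl _ _ _ _ _ _ C iv).
  apply: measurable_funC_M.
    apply: measurable_fun_cis; apply: (measurableT_comp (@oppr_measurable R setT)).
    by apply: measurable_funM; [exact: measurable_cst|exact: measurable_snd].
  by apply: measurable_twisted_kernel; [exact: measurable_cst|exact: measurable_fst|exact: measurable_cst].
move=> p; rewrite Normc.normcM normc_cis mul1r Normc.normcM normc_cis mul1r normcR.
apply: (le_trans (HC _ _ Ml)); rewrite ler_piMr// -expR0 ler_expR oppr_le0.
by rewrite mulr_ge0 ?sqnorm_ge0// divr_ge0// ltW.
Qed.

Lemma ray_transformB (v1 v2 : Heis R n -> R[i]) l w : cintegrable haar v1 -> cintegrable haar v2 ->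
  M <= `|l| -> ray_transform k (fun p => v1 p - v2 p) (l, w) = ray_transform k v1 (l, w) - ray_transform k v2 (l, w).
Proof.
move=> i1 i2 Ml; rewrite /ray_transform -cintegralB; [|exact: cintegrable_ray_kernel..].
by congr cintegral; apply/funext => p; rewrite mulrBl.
Qed.

(** The kernel is bounded for [M <= |l|], so Fubini applies with the central variable inside. The
    inner integrals factor wherever the slice of [v] is integrable, that is, for almost every
    [z]. *)
Lemma ray_transform_fubini (v : Heis R n -> R[i]) l w : cintegrable haar v -> M <= `|l| ->
  cintegrable mun (fun z => fourier (fun t => v (z, t)) l * twisted_kernel k l z w) /\
  ray_transform k v (l, w) = cintegral mun (fun z => fourier (fun t => v (z, t)) l * twisted_kernel k l z w).
Proof.
move=> iv Ml; have [C C0 HC] := phi_le_gauss n k M0.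
have mv := cintegrable_measurable iv.
pose F (p : Heis R n) := v p * (cis (- (l * p.2)) * twisted_kernel k l p.1 w).
have F_E : (fun p => v p * e_kl k l (hmul (hinv p) (w, 0 : R))) = F.
  by apply/funext => -[z t]; rewrite /F e_kl_twisted.
have iF : cintegrable haar F by rewrite -F_E; exact: cintegrable_ray_kernel.
have FE z t : F (z, t) = v (z, t) * cis (- (l * t)) * twisted_kernel k l z w by rewrite /F mulrA.
have iF' : cintegrable (mun \x mu)%E (fun p : Heis R n => v p * cis (- (l * p.2))).
  apply: (@cintegrableMl _ _ _ _ _ _ 1 iv); last by move=> p; rewrite normc_cis.
  apply: measurable_fun_cis; apply: (measurableT_comp (@oppr_measurable R setT)).
  by apply: measurable_funM; [exact: measurable_cst|exact: measurable_snd].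
have mker : measurable_fun setT (fun z => twisted_kernel k l z w).
  by apply: measurable_twisted_kernel => //; exact: measurable_cst.
have iz : cintegrable mun (fun z => fourier (fun t => v (z, t)) l * twisted_kernel k l z w).
  apply: (@cintegrableMl _ _ _ _ _ _ C (cintegrable_cintegral1 iF')) => // z.
  rewrite Normc.normcM normc_cis mul1r normcR.
  apply: (le_trans (HC _ _ Ml)); rewrite ler_piMr// -expR0 ler_expR oppr_le0.
  by rewrite mulr_ge0 ?sqnorm_ge0// divr_ge0// ltW.
split=> //; rewrite /ray_transform F_E (cintegral_fubini1 iF); apply: eq_cintegral_ae.
- exact: (cintegrable_measurable (cintegrable_cintegral1 iF)).
- exact: cintegrable_measurable iz.
apply: (ae_S _ (ae_cintegrable1 iF')) => z ivz.
by rewrite -cintegralZr//; congr cintegral; apply/funext => t; rewrite FE.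
Qed.

(** The kernel being at most [C * G], Tonelli reduces the claim to [fourier_band_L1] on each slice.
    The term in [e] is integrated against [G], of mass [G0]; for the square integral [G <= 1]
    suffices. Neither constant depends on [w]. *)
Lemma ray_transform_band_le (A : R) : 0 < A ->
  exists K1 K2 : R, [/\ 0 <= K1, 0 <= K2 & forall (v : Heis R n -> R[i]) (e : R) (w : Cn R n),
    cintegrable haar v -> 0 < e ->
    (\int[mu]_(l in `[(- A)%R, A] `&` [set l | (M < `|l|)%R]) (Normc.normc (ray_transform k v (l, w)))%:E
      <= (e * K1)%:E + (K2 / e)%:E * \int[haar]_p (Normc.normc (v p) ^+ 2)%:E)%E].
Proof.
move=> A0; have [C C0 HC] := phi_le_gauss n k M0.
have s0 : 0 < Num.sqrt (M / 8) by rewrite sqrtr_gt0 divr_gt0.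
have [G0 G00 HG] := integral_gauss_Cn n s0.
have [Kf Kf0 HK] := fourier_band_L1 A0.
have s2 : Num.sqrt (M / 8) ^+ 2 = M / 8 by rewrite sqr_sqrtr// divr_ge0// ltW.
exists (A * C * G0), (C * Kf); split=> [||v e w iv e0].
- by rewrite !mulr_ge0// ltW.
- by rewrite mulr_ge0// ltW.
have mv := cintegrable_measurable iv.
have [iG eG] := HG w; rewrite s2 in iG eG.
pose G z := expR (- (M / 8 * sqnorm [tuple - tnth z j + tnth w j | j < n])).
have G_ge0 z : 0 <= G z by exact: expR_ge0.
have mG : measurable_fun setT G := measurable_integrable iG.
have G_le1 z : G z <= 1.
  by rewrite -expR0 ler_expR oppr_le0 mulr_ge0 ?sqnorm_ge0// divr_ge0// ltW.
pose nf (p : measurableTypeR R * Cn R n) := Normc.normc (fourier (fun t => v (p.2, t)) p.1).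
have mnf : measurable_fun setT nf.
  apply: measurable_fun_normc.
  apply: (@measurable_param_cintegral _ _ _ _ _ mu (fun q : (measurableTypeR R * Cn R n) * measurableTypeR R =>
    v (q.1.2, q.2) * cis (- (q.1.1 * q.2)))).
  have m11 : measurable_fun setT (fun q : (measurableTypeR R * Cn R n) * measurableTypeR R => q.1.1).
    exact: (measurableT_comp measurable_fst measurable_fst).
  have m12 : measurable_fun setT (fun q : (measurableTypeR R * Cn R n) * measurableTypeR R => q.1.2).
    exact: (measurableT_comp measurable_snd measurable_fst).
  apply: measurable_funC_M.
    apply: (measurableT_comp mv); apply: measurable_fun_pair => //.
  apply: measurable_fun_cis; apply: (measurableT_comp (@oppr_measurable R setT)).
  exact: measurable_funM.
pose Phi (p : measurableTypeR R * Cn R n) := nf p * (C * G p.2).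
have mPhi : measurable_fun setT Phi.
  apply: measurable_funM => //; apply: measurable_funM; first exact: measurable_cst.
  exact: (measurableT_comp mG measurable_snd).
have Phi0 p : 0 <= Phi p by rewrite mulr_ge0 ?mulr_ge0 ?normc_ge0.
have mD : measurable [set l : measurableTypeR R | M < `|l|] by exact: measurable_normr_gt.
have mI : measurable (`[- A, A]%classic : set (measurableTypeR R)) by exact: measurable_itv.
have mDI : measurable (`[- A, A]%classic `&` [set l : measurableTypeR R | M < `|l|]).
  exact: measurableI.
have mS : measurable_fun setT (fun l : measurableTypeR R => Normc.normc (ray_transform k v (l, w))).
  apply: measurable_fun_normc.
  exact: (measurableT_comp (measurable_ray_transform k mv) (measurable_pair2 w)).
have mIPhi : measurable_fun setT (fun l : measurableTypeR R => (\int[mun]_z (Phi (l, z))%:E)%E).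
  apply: (measurable_fun_fubini_tonelli_F (m2 := mun) (fun p => (Phi p)%:E)).
    exact/measurable_EFinP.
  by move=> p; rewrite lee_fin.
apply: (@le_trans _ _ (\int[mu]_(l in `[(- A)%R, A] `&` [set l | (M < `|l|)%R]) \int[mun]_z (Phi (l, z))%:E)%E).
  apply: ge0_le_integral => //.
  - by move=> l _; rewrite lee_fin normc_ge0.
  - by apply/measurable_EFinP; exact: measurable_funTS.
  - exact: measurable_funTS.
  move=> l [_ Ml]; have [ir ->] := ray_transform_fubini w iv (ltW Ml).
  have := normc_cintegral ir; rewrite -lee_fin => /le_trans; apply.
  rewrite /Rintegral fineK; last exact: (integrable_fin_num measurableT (cintegrable_normc ir)).
  apply: ge0_le_integral => //.
  - by move=> z _; rewrite lee_fin normc_ge0.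
  - exact: (measurable_int _ (cintegrable_normc ir)).
  - by apply/measurable_EFinP; exact: (measurableT_comp mPhi (measurable_pair1 l)).
  move=> z _; rewrite lee_fin Normc.normcM ler_wpM2l ?normc_ge0//.
  by rewrite Normc.normcM normc_cis mul1r normcR; exact: HC (ltW Ml).
apply: (@le_trans _ _ (\int[mu]_(l in `[(- A)%R, A]) \int[mun]_z (Phi (l, z))%:E)%E).
  apply: ge0_subset_integral => //; first exact: measurable_funTS.
  by move=> l _; apply: integral_ge0 => z _; rewrite lee_fin.
pose PhiI (p : measurableTypeR R * Cn R n) := ((Phi p)%:E * (\1_`[- A, A] p.1)%:E)%E.
have mPhiI : measurable_fun setT PhiI.
  apply: emeasurable_funM; first exact/measurable_EFinP.
  by apply/measurable_EFinP; apply: (measurableT_comp _ measurable_fst); exact: measurable_indic.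
have PhiI0 p : (0 <= PhiI p)%E by rewrite mule_ge0 ?lee_fin.
have -> : (\int[mu]_(l in `[(- A)%R, A]) \int[mun]_z (Phi (l, z))%:E = \int[mu]_l \int[mun]_z PhiI (l, z))%E.
  rewrite integral_mkcond epatch_indic; apply: eq_integral => l _ /=.
  rewrite muleC -ge0_integralZl//.
  - by apply: eq_integral => z _; rewrite /PhiI muleC.
  - by apply/measurable_EFinP; exact: (measurableT_comp mPhi (measurable_pair1 l)).
  - by move=> z _; rewrite lee_fin.
rewrite (fubini_tonelli PhiI mPhiI PhiI0).
pose N z := (\int[mu]_t (Normc.normc (v (z, t)) ^+ 2)%:E)%E.
have mv2 : measurable_fun setT (fun p => (Normc.normc (v p) ^+ 2)%:E).
  by apply/measurable_EFinP/measurable_funX; exact: measurable_fun_normc.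
have mN : measurable_fun setT N.
  apply: (measurable_fun_fubini_tonelli_F (m2 := mu) (fun p => (Normc.normc (v p) ^+ 2)%:E)) => //.
  by move=> p; rewrite lee_fin sqr_ge0.
have N0 z : (0 <= N z)%E by apply: integral_ge0 => t _; rewrite lee_fin sqr_ge0.
have Ke0 : 0 <= C * Kf / e by rewrite divr_ge0 ?mulr_ge0// ltW.
have eAC0 : 0 <= e * A * C by rewrite !mulr_ge0// ltW.
apply: (@le_trans _ _ (\int[mun]_z ((e * A * C)%:E * (G z)%:E + (C * Kf / e)%:E * N z))%E).
  apply: ae_ge0_le_integral => //.
  - by move=> z _; apply: integral_ge0 => l _.
  - exact: (measurable_fun_fubini_tonelli_G (m1 := mu) PhiI).
  - by move=> z _; rewrite adde_ge0 ?mule_ge0 ?lee_fin.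
  - apply: emeasurable_funD; apply: measurable_funeM => //; exact/measurable_EFinP.
  apply: (ae_S _ (ae_cintegrable1 iv)) => z ivz _.
  have -> : (\int[mu]_l PhiI (l, z) = (C * G z)%:E * \int[mu]_(l in `[(- A)%R, A]) (Normc.normc (fourier (fun t => v (z, t)) l))%:E)%E.
    rewrite [X in (_ = _ * X)%E]integral_mkcond epatch_indic -ge0_integralZl//.
    - apply: eq_integral => l _; rewrite /PhiI /Phi /nf/= -!EFinM; congr EFin; ring.
    - apply: emeasurable_funM; apply/measurable_EFinP; last exact: measurable_indic.
      exact: (measurableT_comp mnf (measurable_pair2 z)).
    - by move=> l _; rewrite mule_ge0 ?lee_fin ?normc_ge0.
    - by rewrite lee_fin mulr_ge0.
  apply: (@le_trans _ _ ((C * G z)%:E * ((e * A)%:E + (Kf / e)%:E * N z))%E).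
    by apply: lee_wpmul2l; [rewrite lee_fin mulr_ge0|exact: HK].
  rewrite ge0_muleDr; last 2 first.
  - by rewrite lee_fin mulr_ge0// ltW.
  - by rewrite mule_ge0// lee_fin divr_ge0// ltW.
  apply: leeD; first by rewrite -!EFinM lee_fin le_eqVlt; apply/orP; left; apply/eqP; ring.
  rewrite muleA -EFinM; apply: lee_wpmul2r => //; rewrite lee_fin.
  rewrite -[leRHS]mulrA; apply: ler_wpM2r; last by rewrite ler_piMr.
  by rewrite divr_ge0// ltW.
rewrite ge0_integralD//; last 4 first.
- by move=> z _; rewrite mule_ge0 ?lee_fin.
- by apply: measurable_funeM; exact/measurable_EFinP.
- by move=> z _; rewrite mule_ge0 ?lee_fin.
- exact: measurable_funeM.
apply: leeD.
  rewrite ge0_integralZl//; last 2 first.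
  - exact/measurable_EFinP.
  - by move=> z _; rewrite lee_fin.
  have -> : (\int[mun]_z (G z)%:E = G0%:E)%E.
    by rewrite -eG /Rintegral fineK//; exact: (integrable_fin_num measurableT iG).
  by rewrite -EFinM lee_fin le_eqVlt; apply/orP; left; apply/eqP; ring.
rewrite ge0_integralZl//.
apply: lee_wpmul2l; first by rewrite lee_fin.
by rewrite [leRHS](fubini_tonelli1 (fun p => (Normc.normc (v p) ^+ 2)%:E))// => p; rewrite lee_fin sqr_ge0.
Qed.

End ray_transform.

(** * The integral formula survives the L^2 limit *)

Section L2_convergence.
Context d (T : measurableType d) (R : realType) (mu : {measure set T -> \bar R}).
Implicit Type f : T -> R[i].

Lemma integral_normc_sqr f :
  (\int[mu]_x (Normc.normc (f x) ^+ 2)%:E = cLnorm mu 2 f `^ 2)%E.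
Proof.
rewrite /cLnorm powR_Lnorm//; apply: eq_integral => x _.
by rewrite /= ger0_norm ?normc_ge0// powR_mulrn// normc_ge0.
Qed.

Lemma integral_normc_sqr_le f (e : R) : 0 <= e -> (cLnorm mu 2 f < e%:E)%E ->
  (\int[mu]_x (Normc.normc (f x) ^+ 2)%:E <= (e ^+ 2)%:E)%E.
Proof.
move=> e0; rewrite integral_normc_sqr; move: (Lnorm_ge0 mu 2%:E (fun x => (Normc.normc (f x))%:E)).
rewrite -/(cLnorm mu 2 f); case: (cLnorm _ _ _) => [r| |]//=.
rewrite lee_fin lte_fin => r0 re; rewrite lee_fin powR_mulrn//.
by rewrite lerXn2r ?nnegrE// ltW.
Qed.

Lemma in_L1_cintegrable f : in_Lp mu 1 f -> cintegrable mu f.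
Proof.
move=> [mf f1]; apply/cintegrableP; split => //.
apply/integrableP; split; first exact/measurable_EFinP/measurable_fun_normc.
by move: f1; rewrite /cLnorm Lnorm1.
Qed.

Lemma in_L2_integrable f : in_Lp mu 2 f ->
  measurable_fun setT f /\ mu.-integrable setT (EFin \o (fun x => Normc.normc (f x) ^+ 2)).
Proof.
move=> [mf f2]; split => //; apply/integrableP; split.
  by apply/measurable_EFinP/measurable_funX; exact: measurable_fun_normc.
under eq_integral do rewrite /= ger0_norm ?sqr_ge0//.
rewrite integral_normc_sqr; move: f2 (Lnorm_ge0 mu 2%:E (fun x => (Normc.normc (f x))%:E)).
by rewrite /cLnorm; case: (Lnorm _ _ _) => [r| |]// _ _; rewrite poweR_EFin ltry.
Qed.

Lemma cvge0_lt (u : nat -> \bar R) (e : R) : 0 < e -> u m @[m --> \oo] --> 0%E ->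
  \forall m \near \oo, (u m < e%:E)%E.
Proof.
move=> e0 /fine_cvgP[ufin u0].
apply: filterS2 ufin (cvgr_lt _ u0 _ e0) => m um h.
by rewrite -(fineK um) lte_fin.
Qed.

End L2_convergence.

Lemma ge0_integral_setX2 d1 d2 (T1 : measurableType d1) (T2 : measurableType d2) (R : realType)
    (m1 : {sigma_finite_measure set T1 -> \bar R}) (m2 : {sigma_finite_measure set T2 -> \bar R})
    (D : set T1) (E : set T2) (h : T1 * T2 -> R) :
  measurable D -> measurable E -> measurable_fun setT h -> (forall p, 0 <= h p) ->
  (\int[m1 \x m2]_(p in D `*` E) (h p)%:E = \int[m2]_(y in E) \int[m1]_(x in D) (h (x, y))%:E)%E.
Proof.
move=> mD mE mh h0; rewrite integral_mkcond epatch_indic fubini_tonelli2; last 2 first.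
- apply: emeasurable_funM; first exact/measurable_EFinP.
  by apply/measurable_EFinP/measurable_indic; exact: measurableX.
- by move=> p; rewrite mule_ge0 ?lee_fin.
rewrite [RHS]integral_mkcond epatch_indic; apply: eq_integral => y _.
rewrite /fubini_G/= muleC -ge0_integralZl//.
- rewrite [RHS]integral_mkcond epatch_indic; apply: eq_integral => x _ /=.
  by rewrite -!EFinM; congr EFin; rewrite !indicE in_setX -mulnb natrM /=; ring.
- by apply/measurable_EFinP; apply: measurable_funTS; exact: (measurableT_comp mh (measurable_pair2 y)).
- by move=> x _; rewrite lee_fin.
Qed.

Lemma normc_le_sub (R : realType) (a b : R[i]) :
  Normc.normc (a - b) <= Normc.normc a + Normc.normc b.
Proof. by rewrite -(complex.normcN b); exact: (complex.le_normcD a (- b)). Qed.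

Section strichartz_on_rays.
Context (R : realType) (n : nat).
Hypothesis n_gt0 : (0 < n)%N.
Local Notation mu := (@lebesgue_measure R).
Local Notation mun := (@lebesgue_Cn R n).

Lemma ray_index_ray_point k (l : R) : l != 0 -> ray_index n (ray_point n k l) = k.
Proof.
move=> l0; apply: xget_unique; first by exists l.
move=> j [l' l'0 []] <- /eqP; rewrite (inj_eq (mulIf _)) ?normr_eq0//.
by rewrite eqr_nat => /eqP; lia.
Qed.

Variables (k : nat) (M : R).
Hypothesis M0 : 0 < M.

Lemma measurable_strichartz_ray (u : Heis R n -> R[i]) : measurable_fun setT u ->
  measurable_fun setT (strichartz u \o @ray_prod R n k).
Proof.
(* At [l = 0] the point is the origin, which lies on no ray [R_k]. Its index [k0] is a default
   value, but a fixed one, and measurability follows. *)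
move=> mu'; pose k0 := ray_index n (ray_point n k (0 : R)).
rewrite (_ : _ \o _ = fun p => if (p.1 : R) == 0 then (c_nk R n k0)%:C%C * ray_transform k0 u p
    else (c_nk R n k)%:C%C * ray_transform k u p).
  apply: measurable_fun_ifT.
  - by apply: measurable_fun_eqr; [exact: measurable_fst|exact: measurable_cst].
  - by apply: measurable_funC_M; [exact: measurable_cst|exact: measurable_ray_transform].
  - by apply: measurable_funC_M; [exact: measurable_cst|exact: measurable_ray_transform].
apply/funext => -[l w] /=; rewrite /strichartz /ray_prod /e_fan/=.
by case: eqP => [->//|/eqP l0]; rewrite ray_index_ray_point.
Qed.

Lemma strichartz_ray (u : Heis R n -> R[i]) p : (p.1 : R) != 0 ->
  strichartz u (@ray_prod R n k p) = (c_nk R n k)%:C%C * ray_transform k u p.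
Proof. by move=> l0; rewrite /strichartz /ray_prod /e_fan/= ray_index_ray_point. Qed.

Variables (f : Heis R n -> R[i]) (g : plane R * Cn R n -> R[i]).
Hypotheses (if1 : cintegrable haar f) (Fg : is_strichartz_transform f g).

Let defect p := g (@ray_prod R n k p) - (c_nk R n k)%:C%C * ray_transform k f p.

Let mf := cintegrable_measurable if1.

Let mg : measurable_fun setT g. Proof. by case: Fg => -[]. Qed.

Let mdefect : measurable_fun setT defect.
Proof.
apply: measurable_funC_B; first exact: (measurableT_comp mg (measurable_ray_prod k)).
by apply: measurable_funC_M; [exact: measurable_cst|exact: measurable_ray_transform].
Qed.

Let band (A : R) : set (measurableTypeR R) := `[- A, A]%classic `&` [set l | M < `|l|].

Let mgtM : measurable [set l : measurableTypeR R | M < `|l|].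
Proof. exact: measurable_normr_gt. Qed.

Let mband A : measurable (band A).
Proof. by apply: measurableI => //; exact: measurable_itv. Qed.

(** The defect is [c_nk] times the ray transform of [u m - f], small in L^1 of the band for every
    [w] by [ray_transform_band_le], minus a term small in L^2 by [ge0_integral_ray_le]. When both
    L^2 norms are below [e], the same [e] is used as parameter, so [e^-1 * e ^+ 2] leaves a bound
    linear in [e]. Finiteness of the measures of the band and of [E] pays for the constant terms. *)
Let defect_band0 (A : R) (E : set (Cn R n)) : 0 < A -> measurable E -> (mun E < +oo)%E ->
  (\int[mu \x mun]_(p in band A `*` E) (Normc.normc (defect p))%:E = 0)%E.
Proof.
move=> A0 mE Efin.
have [K1 [K2 [K10 K20 HK]]] := ray_transform_band_le n k M0 A0.
have [_ [u [u12 uf ug]]] := Fg.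
have mX : measurable (band A `*` E) by exact: measurableX.
have Dfin : (mu (band A) < +oo)%E.
  apply: (@le_lt_trans _ _ (mu `[- A, A]%classic)); last by rewrite lebesgue_measure_itv/= lte_fin; case: ifP; rewrite ?ltry.
  by apply: le_measure; rewrite ?inE//; exact: subIsetl.
have DE : mu (band A) = (fine (mu (band A)))%:E by rewrite fineK// ge0_fin_numE.
have EE : mun E = (fine (mun E))%:E by rewrite fineK// ge0_fin_numE.
set L0 := fine (mu (band A)) in DE; set LE := fine (mun E) in EE.
have LE0 : 0 <= LE by exact: fine_ge0.
have L00 : 0 <= L0 by exact: fine_ge0.
have c0 : 0 <= c_nk R n k by rewrite ltW// c_nk_gt0.
have XE : (mu \x mun)%E (band A `*` E) = (L0 * LE)%:E
  by rewrite product_measure1E//; exact: (congr2 (fun a b => (a * b)%E) DE EE).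
pose Kt := L0 * LE + ray_const n M + c_nk R n k * LE * (K1 + K2).
suff small e : 0 < e -> (\int[mu \x mun]_(p in band A `*` E) (Normc.normc (defect p))%:E <= (e * Kt)%:E)%E.
  have Kt0 : 0 <= Kt.
    apply: addr_ge0; last by rewrite !mulr_ge0// addr_ge0.
    by apply: addr_ge0; [rewrite mulr_ge0|exact: ray_const_ge0].
  apply/eqP; rewrite eq_le; apply/andP; split; last by apply: integral_ge0 => p _; rewrite lee_fin normc_ge0.
  apply/lee_addgt0Pr => e e0; rewrite add0e.
  have e1 : 0 < e / (Kt + 1) by rewrite divr_gt0// ltr_pwDr.
  apply: (le_trans (small _ e1)); rewrite lee_fin mulrAC ler_pdivrMr ?ltr_pwDr//.
  by rewrite ler_wpM2l ?lerDl// ltW.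
move=> e0.
have [m [um1 um2]] : exists m, (cLnorm haar 2 (fun p => (u m p - f p)%R) < e%:E)%E /\
    (cLnorm (@fan_measure R n) 2 (fun x => (strichartz (u m) x - g x)%R) < e%:E)%E.
  have h1 := cvge0_lt e0 uf; have h2 := cvge0_lt e0 ug.
  have [m _ hm] := filterI h1 h2.
  by exists m; have := hm m (leqnn m).
have := integral_normc_sqr_le (ltW e0) um1; have := integral_normc_sqr_le (ltW e0) um2.
move=> {um1 um2} am bm.
have iu := in_L1_cintegrable (u12 m).1; have mum := cintegrable_measurable iu.
pose v p := u m p - f p; have iv : cintegrable haar v by exact: cintegrableB.
pose q p := strichartz (u m) (@ray_prod R n k p) - g (@ray_prod R n k p).
have mq : measurable_fun setT q.
  apply: measurable_funC_B; first exact: measurable_strichartz_ray.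
  exact: (measurableT_comp mg (measurable_ray_prod k)).
have mrv : measurable_fun setT (fun p => Normc.normc (ray_transform k v p)).
  by apply: measurable_fun_normc; apply: measurable_ray_transform; exact: cintegrable_measurable iv.
(* The modulus [N] of [q p] is either at most [e] or at most [N ^+ 2 / e]. *)
have bound p : (band A `*` E) p -> Normc.normc (defect p) <=
    e + e^-1 * Normc.normc (q p) ^+ 2 + c_nk R n k * Normc.normc (ray_transform k v p).
  case: p => l w [[_ Ml] _].
  have l0 : l != 0 by rewrite -normr_gt0 (lt_trans M0).
  have -> : defect (l, w) = (c_nk R n k)%:C%C * ray_transform k v (l, w) - q (l, w).
    rewrite /defect /q strichartz_ray// (ray_transformB k M0 w iu if1 (ltW Ml)).
    ring.
  apply: (le_trans (normc_le_sub _ _)).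
  rewrite addrC Normc.normcM normcR ger0_norm// lerD2r.
  set N := Normc.normc _; have N0 : 0 <= N by exact: normc_ge0.
  have [Ne|Ne] := leP N e; first by rewrite (le_trans Ne)// lerDl mulr_ge0 ?sqr_ge0// invr_ge0 ltW.
  rewrite -[leLHS]add0r; apply: lerD; first exact: ltW.
  by rewrite mulrC ler_pdivlMr// expr2 ler_wpM2l// ltW.
have mq2 : measurable_fun setT (fun p => e + e^-1 * Normc.normc (q p) ^+ 2).
  apply: measurable_funD; first exact: measurable_cst.
  apply: measurable_funM; first exact: measurable_cst.
  by apply: measurable_funX; exact: measurable_fun_normc.
have e1 : 0 <= e^-1 by rewrite invr_ge0 ltW.
apply: (@le_trans _ _ (\int[mu \x mun]_(p in band A `*` E) ((e + e^-1 * Normc.normc (q p) ^+ 2)%:E +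
    (c_nk R n k * Normc.normc (ray_transform k v p))%:E))%E).
  apply: ge0_le_integral => //.
  - by move=> p _; rewrite lee_fin normc_ge0.
  - by apply/measurable_EFinP; apply: measurable_funTS; exact: measurable_fun_normc.
  - apply: emeasurable_funD; apply/measurable_EFinP; apply: measurable_funTS => //.
    by apply: measurable_funM => //; exact: measurable_cst.
rewrite ge0_integralD//; last 4 first.
- by move=> p _; rewrite lee_fin; apply: addr_ge0; [exact: ltW|rewrite mulr_ge0 ?sqr_ge0].
- by apply/measurable_EFinP; apply: measurable_funTS.
- by move=> p _; rewrite lee_fin mulr_ge0 ?normc_ge0.
- apply/measurable_EFinP; apply: measurable_funTS; apply: measurable_funM => //; exact: measurable_cst.
rewrite /Kt mulrDr EFinD; apply: leeD.
  under eq_integral do rewrite EFinD EFinM.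
  rewrite ge0_integralD//; last 3 first.
  - by move=> p _; rewrite lee_fin ltW.
  - by move=> p _; rewrite mule_ge0 ?lee_fin ?sqr_ge0.
  - apply: measurable_funeM; apply/measurable_EFinP; apply: measurable_funTS.
    by apply: measurable_funX; exact: measurable_fun_normc.
  rewrite mulrDr EFinD; apply: leeD.
    apply: (@le_trans _ _ (e%:E * (mu \x mun)%E (band A `*` E))%E); first by rewrite integral_cst.
    by rewrite XE -EFinM.
  rewrite ge0_integralZl//; last 2 first.
  - by apply/measurable_EFinP; apply: measurable_funTS; apply: measurable_funX; exact: measurable_fun_normc.
  - by move=> p _; rewrite lee_fin sqr_ge0.
  pose h x := (Normc.normc (strichartz (u m) x - g x) ^+ 2)%:E.
  have mh : measurable_fun setT (h \o @ray_prod R n k).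
    by apply/measurable_EFinP; apply: measurable_funX; exact: measurable_fun_normc.
  have h0 x : (0 <= h x)%E by rewrite lee_fin sqr_ge0.
  have hle := ge0_integral_ray_le n_gt0 M0 h0 mh.
  have sub : band A `*` E `<=` [set p | (M < `|p.1|)%R] by move=> p [[_ ?] _].
  have mM := measurable_normr_gt M (@measurable_fst _ _ (measurableTypeR R) (Cn R n)).
  have := ge0_subset_integral (mu \x mun)%E mX mM (measurable_funTS mh) (fun p _ => h0 _) sub.
  move=> /le_trans /(_ hle) h1.
  apply: (@le_trans _ _ (e^-1%:E * ((ray_const n M)%:E * (e ^+ 2)%:E))%E).
    apply: lee_wpmul2l => //; apply: (le_trans h1).
    by apply: lee_wpmul2l => //; rewrite lee_fin ray_const_ge0.
  rewrite -!EFinM lee_fin le_eqVlt; apply/orP; left; apply/eqP.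
  by field; rewrite gt_eqF.
under eq_integral do rewrite EFinM.
rewrite ge0_integralZl//; last 2 first.
- by apply/measurable_EFinP; exact: measurable_funTS.
- by move=> p _; rewrite lee_fin normc_ge0.
rewrite ge0_integral_setX2//; last by move=> p; exact: normc_ge0.
apply: (@le_trans _ _ ((c_nk R n k)%:E * \int[mun]_(w in E) (e * (K1 + K2))%:E)%E).
  apply: lee_wpmul2l => //; apply: ge0_le_integral => //.
  - by move=> w _; apply: integral_ge0 => l _; rewrite lee_fin normc_ge0.
  - apply: measurable_funTS.
    pose F (p : measurableTypeR R * Cn R n) := ((Normc.normc (ray_transform k v p))%:E * (\1_(band A) p.1)%:E)%E.
    rewrite (_ : (fun w => _) = fubini_G mu F).
      apply: measurable_fun_fubini_tonelli_G.
        apply: emeasurable_funM; first exact/measurable_EFinP.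
        by apply/measurable_EFinP; apply: (measurableT_comp _ measurable_fst); exact: measurable_indic.
      by move=> p; rewrite mule_ge0 ?lee_fin ?normc_ge0.
    by apply/funext => w; rewrite integral_mkcond epatch_indic.
  - move=> w _; apply: (le_trans (HK v e w iv e0)).
    apply: (@le_trans _ _ ((e * K1)%:E + (K2 / e)%:E * (e ^+ 2)%:E)%E).
      apply: leeD => //; apply: lee_wpmul2l => //; rewrite lee_fin.
      by rewrite mulr_ge0.
    rewrite -EFinM -EFinD lee_fin le_eqVlt; apply/orP; left; apply/eqP.
    by field; rewrite gt_eqF.
apply: (@le_trans _ _ ((c_nk R n k)%:E * ((e * (K1 + K2))%:E * mun E))%E); first by rewrite integral_cst.
by rewrite EE -!EFinM lee_fin le_eqVlt; apply/orP; left; apply/eqP; ring.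
Qed.

(** Countably many products of bounded bands with sets of finite measure exhaust the part over
    [|l| > M], and [defect] integrates to 0 in modulus on each. *)
Lemma strichartz_consistency :
  {ae (mu \x mun)%E, forall p, M < `|p.1| ->
    g (@ray_prod R n k p) = (c_nk R n k)%:C%C * ray_transform k f p}.
Proof.
have [E TE Efin] := sigma_finiteT mun.
have ae_band (ij : nat * nat) : {ae (mu \x mun)%E, forall p, (band ij.1.+1%:R `*` E ij.2) p -> defect p = 0}.
  have [mE Ei] := Efin ij.2.
  have mX : measurable (band ij.1.+1%:R `*` E ij.2) by exact: measurableX.
  have z0 := defect_band0 (ltr0Sn R ij.1) mE Ei.
  have mN : measurable_fun (band ij.1.+1%:R `*` E ij.2) (fun p => (Normc.normc (defect p))%:E).
    by apply/measurable_EFinP; apply: measurable_funTS; exact: measurable_fun_normc.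
  have [+ _] := ae_eq_integral_abs (mu \x mun)%E mX mN.
  rewrite (_ : (\int[_]_(p in _) _)%E = 0%E); last first.
    by rewrite -[RHS]z0; apply: eq_integral => p _; rewrite gee0_abs// lee_fin normc_ge0.
  move=> /(_ erefl); apply: ae_S => p h Xp.
  exact: Normc.eq0_normc (EFin_inj (h Xp)).
apply: (ae_S _ (ae_forall_count ae_band)) => p h Mp.
apply/eqP; rewrite -subr_eq0; apply/eqP.
have [j _ Ej] : (\bigcup_j E j) p.2 by rewrite -TE.
apply: (h (Num.trunc `|p.1|, j)); split => //=; split => //=.
rewrite in_itv/= -ler_norml; exact: ltW (truncnS_gt _).
Qed.

End strichartz_on_rays.
(** * Slices of a function on the Heisenberg group *)

Section ae_swap.
Context d1 d2 (T1 : measurableType d1) (T2 : measurableType d2) (R : realType).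
Variables (m1 : {sigma_finite_measure set T1 -> \bar R})
          (m2 : {sigma_finite_measure set T2 -> \bar R}).

(** Both iterated statements say that the exceptional set is null for the product; Tonelli reads
    this off its sections in the other direction. *)
Lemma ae_swap (P : T1 -> T2 -> Prop) : measurable [set p | P p.1 p.2] ->
  {ae m1, forall x, {ae m2, forall y, P x y}} -> {ae m2, forall y, {ae m1, forall x, P x y}}.
Proof.
move=> mP aeP; pose N := ~` [set p : T1 * T2 | P p.1 p.2].
have mN : measurable N by exact: measurableC.
have N0 : (m1 \x m2)%E N = 0%E by apply/(negligibleP _ mN); exact: (ae_prod _ _ mP).2.
have mf : measurable_fun setT (EFin \o (\1_N : T1 * T2 -> R)).
  by apply/measurable_EFinP; exact: measurable_indic.
have f0 p : (0 <= (EFin \o (\1_N : T1 * T2 -> R)) p)%E by rewrite /= lee_fin.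
have mG := measurable_fun_fubini_tonelli_G (m1 := m1) _ mf f0.
have G0 y : (0 <= fubini_G m1 (EFin \o (\1_N : T1 * T2 -> R)) y)%E.
  by apply: integral_ge0 => x _; exact: f0.
have /(ae_eq_integral_abs m2 measurableT mG) : (\int[m2]_y `|fubini_G m1 (EFin \o (\1_N : T1 * T2 -> R)) y| = 0)%E.
  under eq_integral do rewrite gee0_abs//.
  by rewrite -(fubini_tonelli2 _ mf f0) integral_indic// setIT.
apply: ae_S => y /(_ I) Gy.
have yE : ysection N y = ~` [set x | P x y].
  by apply/seteqP; split => x /=; rewrite /ysection/= inE.
apply/negligibleP; rewrite -yE; first exact: measurable_ysection.
transitivity (fubini_G m1 (EFin \o (\1_N : T1 * T2 -> R)) y); last exact: Gy.
transitivity (\int[m1]_x (\1_(ysection N y) x)%:E)%E.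
  by rewrite integral_indic ?setIT//; exact: measurable_ysection.
by apply: eq_integral => x _; rewrite /= !indicE mem_ysection.
Qed.

End ae_swap.

(** A finite infimum has a competitor of finite total measure, and the union of that cover is [B].
    This replaces sets measurable for the completion by measurable ones. *)
Lemma outer_measure_lty_cover d (T : measurableType d) (R : realType)
    (mu : {measure set T -> \bar R}) (A : set T) : ((mu^*)%mu A < +oo)%E ->
  exists B, [/\ measurable B, A `<=` B & (mu B < +oo)%E].
Proof.
rewrite /mu_ext => /ereal_inf_lt[_ [F [mF AF] <-] sF].
exists (\bigcup_k F k); split => //; first exact: bigcup_measurable.
apply: le_lt_trans sF; apply: generalized_Boole_inequality => //.
exact: bigcup_measurable.
Qed.

Section finite_support.
Context d (T : measurableType d) (R : realType) (mu : {measure set T -> \bar R}).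

(** The modulus of [f] is almost everywhere at most the indicator of [V] plus its own square. *)
Lemma in_L2_finite_support_cintegrable (f : T -> R[i]) (V : set T) :
  in_Lp mu 2 f -> measurable V -> (mu V < +oo)%E -> {ae mu, forall x, ~ V x -> f x = 0} ->
  cintegrable mu f.
Proof.
move=> /in_L2_integrable[mf if2] mV Vfin f0; apply/cintegrableP; split => //.
have iV : mu.-integrable setT (EFin \o (\1_V : T -> R)).
  apply/integrableP; split; first by apply/measurable_EFinP; exact: measurable_indic.
  under eq_integral do rewrite /= ger0_norm//.
  by rewrite integral_indic// setIT.
have iS : mu.-integrable setT (EFin \o (fun x => \1_V x + Normc.normc (f x) ^+ 2)).
  exact: (integrableD measurableT iV if2).
apply/integrableP; split; first exact/measurable_EFinP/measurable_fun_normc.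
have /integrableP[_] := iS; apply: le_lt_trans.
apply: ae_ge0_le_integral => //.
- by apply: measurableT_comp => //; exact/measurable_EFinP/measurable_fun_normc.
- by apply: measurableT_comp => //; exact: measurable_int iS.
apply: (ae_S _ f0) => x fx _; rewrite /= lee_fin !ger0_norm ?normc_ge0 ?addr_ge0 ?sqr_ge0//.
have [Vx|Vx] := pselect (V x); last first.
  by rewrite fx// Normc.normc0 addr_ge0 ?sqr_ge0.
rewrite indicE mem_set// (_ : true%:R = 1)//; have := sqr_ge0 (Normc.normc (f x) - 1); have := normc_ge0 (f x).
set N := Normc.normc _; nra.
Qed.

End finite_support.

Section rays_of_null_sets.
Context (R : realType) (n : nat).
Hypothesis n_gt0 : (0 < n)%N.
Local Notation mu := (@lebesgue_measure R).
Local Notation mun := (@lebesgue_Cn R n).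
Variables (k : nat) (M : R).
Hypothesis M0 : 0 < M.

(** [ge0_integral_ray_le] for the indicator of a measurable null set: its trace on the ray over
    [|l| > M] is null as well. *)
Lemma ae_ray (P : plane R * Cn R n -> Prop) : {ae (@fan_measure R n), forall x, P x} ->
  {ae (mu \x mun)%E, forall p, M < `|p.1| -> P (@ray_prod R n k p)}.
Proof.
move=> [N [mN N0 PN]].
have mM := measurable_normr_gt M (@measurable_fst _ _ (measurableTypeR R) (Cn R n)).
have mrN : measurable (@ray_prod R n k @^-1` N).
  by rewrite -[X in measurable X]setTI; exact: measurable_ray_prod.
exists ([set p | M < `|p.1|] `&` (@ray_prod R n k @^-1` N)); split.
- exact: measurableI.
- have h0 x : (0 <= (\1_N x : R)%:E)%E by rewrite lee_fin.
  have mh : measurable_fun setT ((fun x => (\1_N x : R)%:E) \o @ray_prod R n k).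
    apply/measurable_EFinP; apply: (measurableT_comp _ (measurable_ray_prod k)).
    exact: measurable_indic.
  have := ge0_integral_ray_le n_gt0 M0 h0 mh.
  rewrite (_ : (\int[@fan_measure R n]_x (\1_N x)%:E)%E = 0%E); last first.
    by rewrite integral_indic// setIT; exact: N0.
  rewrite mule0 => h.
  apply/eqP; rewrite eq_le measure_ge0 andbT; apply: le_trans h.
  rewrite setIC -integral_indic//.
- move=> p /= /not_implyP[Mp NP]; split => //; exact: PN.
Qed.

End rays_of_null_sets.
Lemma measurable_complex_eq0 d (T : measurableType d) (R : realType) (h : T -> R[i]) :
  measurable_fun setT h -> measurable [set x | h x = 0].
Proof.
move=> /measurable_fun_complexP[mr mi].
rewrite (_ : [set x | _] = [set x | complex.Re (h x) = 0] `&` [set x | complex.Im (h x) = 0]).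
  by apply: measurableI; exact: measurable_neq0.
by apply/seteqP; split => x /=; [move=> ->|move=> [? ?]; exact: complex_eqP].
Qed.

(** * Slices in the central variable *)

Section slices.
Context (R : realType) (n : nat).
Local Notation mu := (@lebesgue_measure R).
Local Notation mun := (@lebesgue_Cn R n).
Variable f : Heis R n -> R[i].
Hypothesis if1 : cintegrable haar f.

Let mf := cintegrable_measurable if1.

Lemma measurable_fourier_slice :
  measurable_fun setT (fun p : Cn R n * measurableTypeR R => fourier (fun t => f (p.1, t)) p.2).
Proof.
apply: (@measurable_param_cintegral _ _ _ _ _ mu
  (fun q : (Cn R n * measurableTypeR R) * measurableTypeR R => f (q.1.1, q.2) * cis (- (q.1.2 * q.2)))).
have m11 : measurable_fun setT (fun q : (Cn R n * measurableTypeR R) * measurableTypeR R => q.1.1).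
  exact: (measurableT_comp measurable_fst measurable_fst).
have m12 : measurable_fun setT (fun q : (Cn R n * measurableTypeR R) * measurableTypeR R => q.1.2).
  exact: (measurableT_comp measurable_snd measurable_fst).
apply: measurable_funC_M.
  by apply: (measurableT_comp mf); exact: measurable_fun_pair.
apply: measurable_fun_cis; apply: (measurableT_comp (@oppr_measurable R setT)).
exact: measurable_funM.
Qed.

Lemma cintegrable_fourier_slice l : cintegrable mun (fun z => fourier (fun t => f (z, t)) l).
Proof.
apply: (cintegrable_cintegral1 (m1 := mun) (m2 := mu) (f := fun p => f p * cis (- (l * p.2)))).
apply: (@cintegrableMl _ _ _ _ _ _ 1 if1); last by move=> p; rewrite normc_cis.
apply: measurable_fun_cis; apply: (measurableT_comp (@oppr_measurable R setT)).
by apply: measurable_funM; [exact: measurable_cst|exact: measurable_snd].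
Qed.

Lemma fourier_slice_eq0 (M l : R) : 0 < M -> M < `|l| ->
  {ae mun, forall w, forall k, ray_transform k f (l, w) = 0} ->
  {ae mun, forall z, fourier (fun t => f (z, t)) l = 0}.
Proof.
move=> M0 Ml f0; have l0 : l != 0 by rewrite -normr_gt0 (lt_trans M0).
apply: (twisted_laguerre_complete l0 (cintegrable_fourier_slice l)).
apply: (ae_S _ f0) => w fw k.
by rewrite -(ray_transform_fubini k M0 w if1 (ltW Ml)).2.
Qed.

(** The measures of the sections of [V] integrate to [haar V], so almost all are finite; for almost
    every [z] the slice of [f] vanishes off the section up to a null set [N], which is added to the
    cover. *)
Lemma ae_slice_finite_support (V : set (Heis R n)) : measurable V -> (haar V < +oo)%E ->
  {ae haar, forall p, ~ V p -> f p = 0} ->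
  {ae mun, forall z, (mu [set t | f (z, t) != 0%R] < +oo)%E}.
Proof.
move=> mV Vfin f0.
have mf0 := measurable_complex_eq0 mf.
pose P (z : Cn R n) (t : measurableTypeR R) := ~ V (z, t) -> f (z, t) = 0.
have mP : measurable [set p | P p.1 p.2].
  rewrite (_ : [set p | _] = V `|` [set p | f p = 0]); first exact: measurableU.
  apply/seteqP; split => -[z t]; rewrite /P/=; first by have [?|?] := pselect (V (z, t)); [left|right; auto].
  by move=> [|].
have aeP : {ae mun, forall z, {ae mu, forall t, P z t}}.
  by apply/(ae_prod mun mu mP); apply: (ae_S _ f0) => -[z t].
have mxV : measurable_fun setT (fun z => mu (xsection V z)) by exact: measurable_fun_xsection.
have ixV : mun.-integrable setT (fun z => mu (xsection V z)).
  apply/integrableP; split => //.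
  by under eq_integral do rewrite gee0_abs//; exact: Vfin.
apply: (ae_S2 _ aeP (integrable_ae measurableT ixV)) => z [N [mN N0 PN]] /(_ I) Vz.
have mfz : measurable [set t | f (z, t) != 0].
  rewrite (_ : [set t | _] = ~` xsection [set p | f p = 0] z).
    by apply: measurableC; exact: measurable_xsection.
  by apply/seteqP; split => t /=; rewrite /xsection/= inE/= => /eqP.
apply: (@le_lt_trans _ _ (mu (xsection V z `|` N))).
  apply: le_measure; rewrite ?inE//.
    by apply: measurableU => //; exact: measurable_xsection.
  move=> t /= ft; have [Vt|Vt] := pselect (V (z, t)); first by left; rewrite /xsection/= inE.
  by right; apply: PN => /= /(_ Vt)/eqP; exact/negP.
apply: (@le_lt_trans _ _ (mu (xsection V z) + mu N)%E).
  by apply: measureU2 => //; exact: measurable_xsection.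
by rewrite [X in (_ + X)%E]N0 adde0 ltey_eq Vz.
Qed.

End slices.

(** * Vanishing of [f] from the rays and the slices *)

Theorem theorem3p4 (R : realType) (n : nat) (n_gt0 : (0 < n)%N)
    (V : set (Heis R n)) (W : set (plane R)) (M : R) (B : set (Cn R n))
    (f : Heis R n -> R[i]) (g : plane R * Cn R n -> R[i]) :
  completion_finite_measure haar V ->
  W `<=` fan n ->
  0 < M ->
  W `<=` [set a | exists (k : nat) (l : R), M < `|l| /\ a = ray_point n k l] ->
  completion_finite_measure (nu2 n) W ->
  completion_measurable lebesgue_Cn B ->
  in_Lp haar 2 f ->
  is_strichartz_transform f g ->
  vanishes_ae_outside haar f V ->
  vanishes_ae_outside (@fan_measure R n) g (W `*` B) ->
  {ae haar, forall p, f p = 0}.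
Proof.
move=> [_ Vfin] _ M0 WM [_ Wfin] _ f2 Fg fV gW.
(* Supports may be enlarged: [V] and [W] are replaced by measurable sets of finite measure
   containing them. *)
have [V' [mV' VV' V'fin]] := outer_measure_lty_cover Vfin.
have [W' [mW' WW' W'fin]] := outer_measure_lty_cover Wfin.
have fV' : {ae haar, forall p, ~ V' p -> f p = 0}.
  by apply: (ae_S _ fV) => p fp Vp; apply: fp => /VV'.
have if1 := in_L2_finite_support_cintegrable f2 mV' V'fin fV'.
pose mu := @lebesgue_measure R; pose mun := @lebesgue_Cn R n.
pose Lam : set (measurableTypeR R) := [set l | M < `|l|] `&` \bigcup_k (ray_point n k @^-1` W').
(* Adding the strip [|l| <= M] keeps the measure finite, and outside [L] both the density bound and
   the Gaussian bounds for [|l| > M] are available. *)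
pose L : set (measurableTypeR R) := `[- M, M]%classic `|` Lam.
have mgtM : measurable [set l : measurableTypeR R | M < `|l|] by exact: measurable_normr_gt.
have mLam : measurable Lam.
  apply: measurableI => //; apply: bigcup_measurable => k _.
  by rewrite -[X in measurable X]setTI; exact: measurable_ray_point.
have mL : measurable L by apply: measurableU => //; exact: measurable_itv.
have Lamfin : (mu Lam < +oo)%E.
  apply: (@le_lt_trans _ _ ((ray_const n M)%:E * nu2 n W')%E).
    apply: measure_union_rays_le => // l [Ml [k _ Wk]]; split => //; by exists k.
  by rewrite lte_mul_pinfty// lee_fin ray_const_ge0.
have Lfin : (mu L < +oo)%E.
  apply: (@le_lt_trans _ _ (mu `[(- M)%R, M]%classic + mu Lam)%E).
    by apply: measureU2 => //; exact: measurable_itv.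
  rewrite lte_add_pinfty// /mu lebesgue_measure_itv/= lte_fin; by case: ifP; rewrite ?ltry.
have outL l : ~ L l -> M < `|l| /\ forall k, ~ W' (ray_point n k l).
  move=> Ll; have Ml : M < `|l|.
    by rewrite ltNge; apply/negP => lM; apply: Ll; left; rewrite /= in_itv/= -ler_norml.
  by split => // k Wk; apply: Ll; right; split => //; exists k.
have rays0 : {ae (mu \x mun)%E, forall p, forall k, ~ L p.1 -> ray_transform k f p = 0}.
  apply: ae_forall_count => k.
  have h1 := strichartz_consistency n_gt0 k M0 if1 Fg.
  have h2 := ae_ray n_gt0 k M0 gW.
  apply: (ae_S2 _ h1 h2) => p e1 e2 Lp.
  have [Mp Wp] := outL _ Lp.
  have : g (ray_prod k p) = 0 by apply: (e2 Mp) => -[/WW' /Wp].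
  rewrite (e1 Mp) => /eqP; rewrite mulf_eq0 => /orP[|/eqP//].
  by move=> /eqP[] /eqP; rewrite gt_eqF// c_nk_gt0.
have mf := cintegrable_measurable if1.
have mray k := measurable_complex_eq0 (measurable_ray_transform k mf).
(* Completeness of the Laguerre kernels acts at a fixed frequency [l], Benedicks' theorem at a fixed
   [z]: the statement is obtained for almost every [l] and then turned round by [ae_swap]. *)
have slices0 : {ae mu, forall l, {ae mun, forall z, ~ L l -> fourier (fun t => f (z, t)) l = 0}}.
  pose P (l : measurableTypeR R) (w : Cn R n) := forall k, ~ L l -> ray_transform k f (l, w) = 0.
  have mP : measurable [set p | P p.1 p.2].
    rewrite (_ : [set p | _] = \bigcap_k ((L `*` setT) `|` [set p | ray_transform k f p = 0])).
      apply: bigcap_measurable => // k _; apply: measurableU => //; exact: measurableX.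
    apply/seteqP; split => -[l w]; rewrite /P/= => h k.
      by move=> _; have [Ll|Ll] := pselect (L l); [left|right; exact: h].
    by move=> Ll; have [[]|] := h k I.
  have : {ae mu, forall l, {ae mun, forall w, P l w}}.
    by apply/(ae_prod mu mun mP); apply: (ae_S _ rays0) => -[l w].
  apply: ae_S => l Pl; have [Ll|Ll] := pselect (L l).
    by apply: aeW => z /(_ Ll).
  have [Ml _] := outL _ Ll.
  have : {ae mun, forall w, forall k, ray_transform k f (l, w) = 0}.
    by apply: (ae_S _ Pl) => w Pw k; exact: Pw.
  by move=> /(fourier_slice_eq0 if1 M0 Ml); apply: ae_S.
pose Q (l : measurableTypeR R) (z : Cn R n) := ~ L l -> fourier (fun t => f (z, t)) l = 0.
have mQ : measurable [set p | Q p.1 p.2].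
  rewrite (_ : [set p | _] = (L `*` setT) `|` [set p | fourier (fun t => f (p.2, t)) p.1 = 0]).
    apply: measurableU; first exact: measurableX.
    apply: measurable_complex_eq0.
    exact: (measurableT_comp (measurable_fourier_slice if1) (@measurable_swap _ _ _ _)).
  apply/seteqP; split => -[l z]; rewrite /Q/=; first by have [Ll|Ll] := pselect (L l); [left|right; auto].
  by move=> [[]|].
have := ae_swap mQ slices0.
have := ae_slice_finite_support if1 mV' V'fin fV'.
have := ae_cintegrable1 if1.
move=> h1 h2 h3.
suff : {ae haar, forall p : Heis R n, f (p.1, p.2) = 0} by apply: ae_S => -[].
apply: (@ae_prod _ _ _ _ _ mun mu (fun z t => f (z, t) = 0) _).2.
  exact: (measurable_complex_eq0 (measurableT_comp mf (measurable_fun_pair measurable_fst measurable_snd))).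
apply: (ae_S3 _ h1 h2 h3) => z iz fin Qz.
exact: (benedicks iz fin mL Lfin Qz).
Qed.
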